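(* Let $Q_0(X_2,\dots,X_n)$ be a quadratic form with integer coefficients of rank at least $3$, let $Q(X_0,\dots,X_n)=X_0X_1-Q_0(X_2,\dots,X_n)$, and let $F_1,\dots,F_r\in\mathbb{Z}[X_0,\dots,X_n]$ be forms. Assume that the variety $Z\subset\mathbb{P}^n$ defined by $Q=F_1=\dots=F_r=0$ has codimension at least $3$ in $\mathbb{P}^n$. For $B\ge1$ and $M>1$ let $N(B,M)$ be the number of vectors $\mathbf{x}\in\mathbb{Z}^{n+1}$ with $Q(\mathbf{x})=0$ and $|\mathbf{x}|\le B$ such that $F_1(\mathbf{x}),\dots,F_r(\mathbf{x})$ have a common prime divisor $p>M$. Then for every fixed $\varepsilon>0$, $$N(B,M)\ll_{\varepsilon,Q,F_1,\dots,F_r}\frac{B^{n-1+\varepsilon}}{M\log M}+B^{n-1-1/n+\varepsilon}.$$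
   Context: $|\mathbf{x}|$ denotes the supremum norm $\max_i|x_i|$. The notation $A\ll_{\dots}C$ means $|A|\le kC$ for a constant $k$ depending only on the indicated quantities. *)

(* Defs.v *)
From HB Require Import structures.
From mathcomp Require Import all_boot all_order all_algebra all_field.
From mathcomp Require Import finmap mpoly.
From mathcomp Require Import boolp classical_sets functions cardinality reals exp.

Set Implicit Arguments.
Unset Strict Implicit.
Unset Printing Implicit Defensive.

Import Order.TTheory GRing.Theory Num.Theory.

Local Open Scope classical_set_scope.
Local Open Scope ring_scope.

(* A form of unspecified degree; the zero polynomial is homogeneous of every
   degree. *)
Definition is_form (n : nat) (K : nzRingType) (p : {mpoly K[n]}) : Prop :=
  exists d : nat, p \is d.-homog.

(* The symmetric matrix A with q(x) = x A x^T: its off-diagonal entries are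
   half the coefficients of q, hence rational rather than integral. *)
Definition qf_matrix (m : nat) (q : {mpoly int[m]}) : 'M[rat]_m :=
  \matrix_(i, j) (if i == j then (q@_(U_(i) + U_(i))%MM)%:~R
                  else (q@_(U_(i) + U_(j))%MM)%:~R / 2).

Definition qf_rank (m : nat) (q : {mpoly int[m]}) : nat := \rank (qf_matrix q).

(* X_0 X_1 - Q_0(X_2, ..., X_n). The n - 1 variables of Q_0 are indexed from 0,
   so the i-th one is substituted by X_(i + 2). *)
Definition hyperbolic_form (n : nat) (Q0 : {mpoly int[n.-1]}) :
    {mpoly int[n.+1]} :=
  'X_(inord 0) * 'X_(inord 1) - (Q0 \mPo [tuple 'X_(inord i.+2) | i < n.-1]).

(* Subsets of P^n(K) are represented by the sets of their homogeneous
   coordinate vectors, i.e. by sets of nonzero vectors of K^(n+1). *)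
Section ProjectiveZariski.
Variables (K : closedFieldType) (n : nat).
Implicit Types Y A : set 'rV[K]_n.+1.

Definition proj_zeros (S : set {mpoly K[n.+1]}) : set 'rV[K]_n.+1 :=
  [set v : 'rV[K]_n.+1 | v != 0 /\ forall p, S p -> p.@[v ord0] = 0].

Definition proj_closed Y : Prop :=
  exists2 S : set {mpoly K[n.+1]},
    (forall p, S p -> is_form p) & Y = proj_zeros S.

Definition proj_irreducible Y : Prop :=
  Y !=set0 /\
  forall A1 A2, proj_closed A1 -> proj_closed A2 ->
    Y `<=` A1 `|` A2 -> Y `<=` A1 \/ Y `<=` A2.

(* The codimension of an irreducible closed Y is the largest length c of a
   chain Y = C_0 < C_1 < ... < C_c of irreducible closed subsets of P^n, and
   the codimension of a closed Z is the infimum of the codimensions of the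
   irreducible closed Y contained in Z (so it is infinite if Z is empty). *)
Definition codim_irr_ge (k : nat) Y : Prop :=
  exists C : nat -> set 'rV[K]_n.+1,
    [/\ C 0%N = Y,
        forall i, (i <= k)%N -> proj_closed (C i) /\ proj_irreducible (C i)
      & forall i, (i < k)%N -> C i `<` C i.+1].

Definition codim_ge (k : nat) (Z : set 'rV[K]_n.+1) : Prop :=
  forall Y, proj_closed Y -> proj_irreducible Y -> Y `<=` Z ->
    codim_irr_ge k Y.

End ProjectiveZariski.

(* The variety Q = F_1 = ... = F_r = 0 in P^n, through its points over the
   algebraic closure of the rationals. *)
Definition variety (n r : nat) (Q : {mpoly int[n.+1]})
    (F : 'I_r -> {mpoly int[n.+1]}) : set 'rV[algC]_n.+1 :=
  proj_zeros [set map_mpoly intr p | p in [set Q] `|` range F].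

Definition supnorm (n : nat) (x : 'rV[int]_n) : nat :=
  \max_(i < n) `|x ord0 i|%N.

Section Counting.
Variables (R : realType) (n r : nat).
Variables (Q : {mpoly int[n.+1]}) (F : 'I_r -> {mpoly int[n.+1]}).

(* 0 counts as divisible by every prime. *)
Definition counted_points (B M : R) : set 'rV[int]_n.+1 :=
  [set x : 'rV[int]_n.+1 |
          [/\ Q.@[x ord0] = 0,
               (supnorm x)%:R <= B
             & exists p : nat, [/\ prime p, M < p%:R
                 & forall j, (p%:Z %| (F j).@[x ord0])%Z]]].

Lemma counted_points_finite (B M : R) : finite_set (counted_points B M).
Proof.
have [b Bb] : exists b : nat, B <= b%:R.
  exists (Num.bound `|B|).
  exact: le_trans (ler_norm B) (ltW (archi_boundP (normr_ge0 B))).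
pose f (t : 'M['I_(b + b).+1]_(1, n.+1)) : 'rV[int]_n.+1 :=
  \row_j ((t ord0 j)%:Z - b%:Z).
apply: (@sub_finite_set _ _ (f @` setT)); last exact/finite_image/finite_finset.
move=> x [_ xB _].
have xb j : (`|x ord0 j| <= b)%N.
  rewrite -(ler_nat R); apply: le_trans Bb; apply: le_trans xB.
  by rewrite ler_nat; exact: (@leq_bigmax _ (fun i => `|x ord0 i|%N) j).
exists (\row_j inord `|(x ord0 j + b%:Z)%R|%N) => //.
apply/rowP => j; rewrite !mxE.
have /andP[xbl xbr] : (- b%:Z <= x ord0 j <= b%:Z).
  by rewrite -ler_norml -abszE lez_nat xb.
have x0 : 0 <= x ord0 j + b%:Z by rewrite -lerBlDr sub0r.
rewrite inordK; first by rewrite gez0_abs // addrK.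
by rewrite ltnS -lez_nat gez0_abs // PoszD lerD2r.
Qed.

(* fset_set is the set itself here, by counted_points_finite. *)
Definition count_points (B M : R) : nat :=
  #|` fset_set (counted_points B M)|%fset.

End Counting.

(* Main.v *)
(* Write the points of the quadric as (x0, x1, y) with x0 x1 = Q0(y), and let
   p > mu be a common prime divisor of the F_j(x). Multiplied by a power of x1, the
   F_j become forms f_j in (x1, y).

   For given x1, the vectors y with x1 | Q0(y) lie in lattices L = Z y + x1 Z^m.
   By reduction theory L has a basis of vectors of size b / mu, unless it has a
   short dual vector, which is rare. Suppose that p does not divide x1. Adding to
   y the mu^(m+1) small combinations s E - a e, with E this basis and e in L
   suitable, gives points z with x1 | Q0(z). A given z can only arise from about
   mu^m pairs (s, a), as in Ekedahl's sieve: a resultant of the f_j along the line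
   through z - s E with direction e is an integer divisible by p and, for most s,
   nonzero. So p and then a take few values. As x1 | Q0(z), there are about b^m
   pairs (x1, z), whence a saving of mu.

   If p divides x1, an isometry of the quadric changes x1 to x1 + b(y, w) + x0 Q0(w);
   when this never helps, p divides x0, x1 and the gradient of Q0 at y, which is
   again rare.

   The resultant is not identically zero because some line in the direction of e
   misses Z. Otherwise m polynomials would be algebraically independent on Z, hence
   on an irreducible closed subset, and each step of the chain given by the
   codimension adds one more: n + 2 independent polynomials in n + 1 variables. *)
Require Import Defs.
From HB Require Import structures.
From mathcomp Require Import all_boot all_order all_algebra all_field.
From mathcomp Require Import finmap mpoly.
From mathcomp Require Import boolp classical_sets functions cardinality reals exp.
From mathcomp Require Import zify ring lra.

Set Implicit Arguments.
Unset Strict Implicit.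
Unset Printing Implicit Defensive.

Import Order.TTheory GRing.Theory Num.Theory.

Local Open Scope ring_scope.

(** * Counting *)

(** A translate z has to remember how it was made, or its fibre could not be counted. It lies in the
    lattice L of y but need not generate it; adding a small multiple of a fixed generator of L,
    found by Jacobsthal's bound, gives a generator z' of L. From (x1, z') one recovers L, and with
    it E and the fixed generator, because these are chosen as functions of x1 and L alone.

    The second term of the bound comes from the lattices with a short dual vector. Up to divisor
    factors they allow about mu^m b^(m-1) pairs (x1, y), which stays below b^m / mu as long as
    mu^(m+1) <= b. As n = m + 1, mu is capped at about B^(1/n), and a larger M is replaced by that
    value.

    All divisor counts are bounded by one parameter T, which becomes a power B^(eps/2) only at the
    end. The other B^(eps/2) absorbs log M, so that a saving of mu is enough. *)

Definition atmost (T : eqType) (A : T -> Prop) (x : rat) : Prop :=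
  forall s : seq T, uniq s -> (forall t, t \in s -> A t) -> (size s)%:R <= x.

Lemma atmost_sub (T : eqType) (A B : T -> Prop) (x y : rat) :
  (forall t, A t -> B t) -> atmost B x -> x <= y -> atmost A y.
Proof.
move=> AB Bx xy s us sA; apply: le_trans xy.
by apply: Bx => // t /sA /AB.
Qed.

(** The empty list is one of the lists that [atmost] quantifies over. Counting through
    duplicate-free lists asks for neither finiteness nor decidability of the property, and rational
    bounds let quotients such as b / mu be multiplied and added. *)
Lemma atmost_ge0 (T : eqType) (A : T -> Prop) (x : rat) : atmost A x -> 0 <= x.
Proof. by move=> /(_ [::]) /=; apply. Qed.

Lemma size_fibers (T U : eqType) (f : T -> U) (s : seq T) :
  size s = (\sum_(u <- undup (map f s)) size [seq t <- s | f t == u])%N.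
Proof.
under eq_bigr do rewrite size_filter -sum1_count big_mkcond /=.
rewrite exchange_big /= -sum1_size big_seq [RHS]big_seq.
apply: eq_bigr => t ts; rewrite -big_mkcond /= sum1_count.
have -> : count (fun u => f t == u) (undup (map f s)) =
    count_mem (f t) (undup (map f s)) by apply: eq_count => u /=; rewrite eq_sym.
by rewrite count_uniq_mem ?undup_uniq// mem_undup map_f.
Qed.

(** Choosing a related [u] for each [t] splits a list into fibres. A relation instead of a map
    leaves this choice inside the proof. Most of the later counts iterate this lemma, fixing one
    parameter at a time. *)
Lemma atmost_rel (T U : eqType) (A : T -> Prop) (B : U -> Prop)
    (P : T -> U -> Prop) (n c : rat) :
  (forall t, A t -> exists2 u, B u & P t u) -> atmost B n ->
  (forall u, B u -> atmost (fun t => A t /\ P t u) c) -> 0 <= c ->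
  atmost A (n * c).
Proof.
move=> AP Bn fib c0 s us sA.
have [[u0]|noU] := pselect (exists u : U, True); last first.
  case: s us sA => [|t s] us sA.
    by rewrite mulr_ge0 ?(atmost_ge0 Bn).
  by case: (AP t (sA t (mem_head _ _))) => u; case: noU; exists u.
move=> _; pose f t := if pselect (A t) is left At then projT1 (cid2 (AP t At)) else u0.
have fP t : A t -> B (f t) /\ P t (f t).
  by rewrite /f; case: pselect => // At _; case: cid2.
rewrite (size_fibers f) natr_sum.
have fibu u : u \in undup (map f s) ->
    (size [seq t <- s | f t == u])%:R <= c.
  rewrite mem_undup => /mapP[t ts ->].
  apply: (fib (f t) (fP t (sA t ts)).1); first exact: filter_uniq.
  move=> t'; rewrite mem_filter => /andP[/eqP <- t's].
  by split; [exact: sA|exact: (fP t' (sA t' t's)).2].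
apply: (@le_trans _ _ (\sum_(u <- undup (map f s)) c)).
  by rewrite big_seq [leRHS]big_seq ler_sum.
rewrite big_const_seq count_predT iter_addr_0 -[c *+ _]mulr_natl ler_wpM2r//.
apply: Bn; first exact: undup_uniq.
by move=> u; rewrite mem_undup => /mapP[t ts ->]; exact: (fP t (sA t ts)).1.
Qed.

Lemma atmost_inj (T U : eqType) (A : T -> Prop) (B : U -> Prop) (f : T -> U)
    (n : rat) :
  (forall t, A t -> B (f t)) ->
  (forall t t', A t -> A t' -> f t = f t' -> t = t') ->
  atmost B n -> atmost A n.
Proof.
move=> AB finj Bn s us sA; rewrite -(size_map f); apply: Bn.
  by rewrite map_inj_in_uniq// => t t' /sA At /sA At'; exact: finj.
by move=> u /mapP[t ts ->]; apply: AB; exact: sA.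
Qed.

Lemma atmost1 (T : eqType) (A : T -> Prop) :
  (forall t t', A t -> A t' -> t = t') -> atmost A 1.
Proof.
move=> A1 [|t [|t' s]]//= /andP[]; rewrite inE negb_or => /andP[/eqP tt' _] _ sA.
by case: tt'; apply: A1; apply: sA; rewrite !inE eqxx ?orbT.
Qed.

Lemma atmost_seq (T : eqType) (l : seq T) : atmost (fun t => t \in l) (size l)%:R.
Proof. by move=> s us sl; rewrite ler_nat; apply: uniq_leq_size. Qed.

Lemma atmost0 (T : eqType) (A : T -> Prop) : (forall t, ~ A t) -> atmost A 0.
Proof. by move=> A0 [|t s]//= _ sA; case: (A0 t); apply: sA; rewrite mem_head. Qed.

Lemma atmost_or (T : eqType) (A B : T -> Prop) (x y : rat) :
  atmost A x -> atmost B y -> atmost (fun t => A t \/ B t) (x + y).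
Proof.
move=> Ax By s us sAB.
have -> : size s = (size [seq t <- s | `[< A t >]] +
                    size [seq t <- s | predC (fun t => `[< A t >]) t])%N.
  by rewrite !size_filter count_predC.
rewrite natrD lerD//.
  by apply: Ax; rewrite ?filter_uniq// => t; rewrite mem_filter => /andP[/asboolP].
apply: By; rewrite ?filter_uniq// => t; rewrite mem_filter => /andP[/asboolP nA ts].
by case: (sAB t ts).
Qed.

(** Double counting of the pairs (t, g). The saving in [main_count] comes from here, with [h] equal
    to mu^(m+1) / 2. *)
Lemma atmost_div (T G : eqType) (A : T -> Prop) (P : T * G -> Prop) (N h : rat) :
  0 < h ->
  (forall t, A t -> exists l : seq G,
     [/\ uniq l, h <= (size l)%:R & forall g, g \in l -> P (t, g)]) ->
  atmost P N -> atmost A (N / h).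
Proof.
move=> h0 AG PN s us sA; rewrite ler_pdivlMr//.
pose l t := if pselect (A t) is left At then projT1 (cid (AG t At)) else [::].
have lP t : A t -> [/\ uniq (l t), h <= (size (l t))%:R & forall g, g \in l t -> P (t, g)].
  by rewrite /l; case: pselect => // At _; case: cid.
have ul : uniq [seq (t, g) | t <- s, g <- l t].
  apply: allpairs_uniq_dep => //.
    by move=> t ts; case: (lP t (sA t ts)).
  by move=> [t g] [t' g'] _ _ /= [-> ->].
have := PN _ ul; rewrite size_allpairs_dep sumnE big_map natr_sum => H.
apply: le_trans (H _); last first.
  by move=> tg /allpairsPdep[t [g [ts gl ->]]]; have [_ _] := lP t (sA t ts); apply.
apply: (@le_trans _ _ (\sum_(t <- s) h)).
  by rewrite big_const_seq count_predT iter_addr_0 -[h *+ _]mulr_natl.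
by rewrite [leLHS]big_seq [leRHS]big_seq ler_sum// => t ts; case: (lP t (sA t ts)).
Qed.

Lemma atmost_row (K : eqType) (m : nat) (A : 'I_m -> K -> Prop) (n : 'I_m -> rat) :
  (forall i, atmost (A i) (n i)) ->
  atmost (fun v : 'rV[K]_m => forall i, A i (v ord0 i)) (\prod_i n i).
Proof.
elim: m A n => [|m IH] A n An.
  by rewrite big_ord0; apply: atmost1 => v w _ _; apply/rowP => -[].
rewrite big_ord_recl.
apply: (@atmost_rel 'rV[K]_m.+1 K _ (A ord0) (fun v k => v ord0 ord0 = k)).
- by move=> v vA; exists (v ord0 ord0).
- exact: An.
- move=> k Ak; apply: (@atmost_inj 'rV[K]_m.+1 'rV[K]_m _
      (fun v => forall i, A (lift ord0 i) (v ord0 i)) (fun v => \row_i v ord0 (lift ord0 i))).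
  + by move=> v [vA _] i; rewrite mxE.
  + move=> v w [_ v0] [_ w0] /rowP vw; apply/rowP => i.
    by case: (unliftP ord0 i) => [j ->|->]; [have := vw j; rewrite !mxE|rewrite v0 w0].
  + by apply: (IH (fun j => A (lift ord0 j)) (fun j => n (lift ord0 j))) => i; exact: An.
- by rewrite prodr_ge0// => i _; exact: (atmost_ge0 (An (lift ord0 i))).
Qed.

(** The quotient of a + b by q separates the elements of a residue class. *)
Lemma atmost_int_mod (b q : nat) (r : int) : (0 < q)%N ->
  atmost (fun a : int => (`|a| <= b)%N /\ (q%:Z %| a - r)%Z) (2 * b%:R / q%:R + 1).
Proof.
move=> q0.
apply: (atmost_inj (f := fun a : int => (`|(a + b%:Z)%R|%N %/ q)%N)
  (B := fun k => k \in iota 0 ((2 * b) %/ q).+1)); last first.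
- apply: (atmost_sub _ (atmost_seq (l := iota 0 ((2 * b) %/ q).+1))) => //.
  rewrite size_iota -addn1 natrD lerD2r ler_pdivlMr ?ltr0n//.
  by rewrite -!natrM ler_nat leq_divM.
- move=> a a' [ab aq] [a'b a'q] E.
  have : (q%:Z %| (a + b%:Z) - (a' + b%:Z))%Z.
    rewrite opprD addrACA subrr addr0.
    by have := rpredB aq a'q; rewrite opprB addrA subrK.
  have -> : a + b%:Z = `|(a + b%:Z)%R|%N by lia.
  have -> : a' + b%:Z = `|(a' + b%:Z)%R|%N by lia.
  rewrite -eqz_mod_dvd !modz_nat => /eqP -[] M.
  have : `|(a + b%:Z)%R|%N = `|(a' + b%:Z)%R|%N.
    by rewrite (divn_eq `|(a + b%:Z)%R|%N q) E M -divn_eq.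
  by lia.
- move=> a [ab _]; rewrite mem_iota add0n leq0n ltnS leq_div2r//.
  by lia.
Qed.

Lemma atmost_int (b : nat) : atmost (fun a : int => (`|a| <= b)%N) (2 * b%:R + 1).
Proof.
have := @atmost_int_mod b 1 0 isT; rewrite divr1.
by move=> H; apply: (atmost_sub _ H) => // a ab; split; rewrite // dvd1z.
Qed.

Lemma atmost_box (m b : nat) :
  atmost (fun v : 'rV[int]_m => forall i, (`|v ord0 i| <= b)%N) ((2 * b%:R + 1) ^+ m).
Proof.
have := @atmost_row int m (fun _ a => (`|a| <= b)%N) (fun=> 2 * b%:R + 1)
  (fun=> @atmost_int b).
by rewrite prodr_const card_ord.
Qed.

(** Two solutions differ by a multiple of d / gcd(d, w), so that all of them lie in the residue
    class of any one of them. *)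
Lemma atmost_int_lin (b d : nat) (w c : int) : (0 < d)%N ->
  atmost (fun a : int => (`|a| <= b)%N /\ (d%:Z %| w * a + c)%Z)
    (2 * b%:R * (gcdn d `|w|)%:R / d%:R + 1).
Proof.
move=> d0; set g := gcdn d `|w|.
have g0 : (0 < g)%N by rewrite gcdn_gt0 d0.
have [[a0 [a0b a0d]]|no] := pselect (exists a : int, (`|a| <= b)%N /\ (d%:Z %| w * a + c)%Z).
  have dg : (0 < d %/ g)%N by rewrite divn_gt0// dvdn_leq// dvdn_gcdl.
  apply: (atmost_sub _ (@atmost_int_mod b (d %/ g) a0 dg)).
    move=> a [ab ad]; split=> //.
    have : (d%:Z %| w * (a - a0))%Z.
      by have := rpredB ad a0d; rewrite mulrBr opprD addrACA subrr addr0.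
    rewrite !dvdzE abszM /= => H.
    rewrite -(@dvdn_pmul2r g)// divnK ?dvdn_gcdl//.
    rewrite /g muln_gcdr dvdn_gcd dvdn_mull//=.
    by rewrite mulnC.
  rewrite lerD2r -!mulrA ler_pM2l// ler_wpM2l//.
  rewrite ler_pdivlMr ?ltr0n// mulrC ler_pdivrMr ?ltr0n//.
  by rewrite -natrM ler_nat mulnC divnK// dvdn_gcdl.
apply: (atmost_sub (B := fun=> False) (x := 0)) => //.
- by move=> a H; apply: no; exists a.
- by apply: atmost0 => a [].
- by rewrite addr_ge0// divr_ge0// !mulr_ge0.
Qed.

(** * Divisors *)

Lemma size_divisors_pfactor (p a m : nat) : prime p -> coprime p m -> (0 < m)%N ->
  size (divisors (p ^ a * m)) = (a.+1 * size (divisors m))%N.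
Proof.
move=> pp pm m0.
have pa0 : (0 < p ^ a * m)%N by rewrite muln_gt0 expn_gt0 prime_gt0.
have pNd d : (d %| m)%N -> ~~ (p %| d)%N.
  by move=> dm; rewrite -prime_coprime// (coprime_dvdr dm).
have d_gt0 d : (d %| m)%N -> (0 < d)%N by move=> dm; exact: dvdn_gt0 dm.
have logE i d : (d %| m)%N -> logn p (p ^ i * d) = i.
  move=> dm; have p0 : (0 < p ^ i)%N by rewrite expn_gt0 prime_gt0.
  rewrite (lognM _ p0 (d_gt0 d dm)) pfactorK//.
  by rewrite [logn p d]lognE (negbTE (pNd d dm)) !andbF addn0.
have -> : (a.+1 * size (divisors m))%N =
    size [seq (p ^ i * d)%N | i <- iota 0 a.+1, d <- divisors m].
  by rewrite size_allpairs size_iota.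
apply: perm_size; apply: uniq_perm; first exact: divisors_uniq.
  apply: allpairs_uniq; rewrite ?iota_uniq ?divisors_uniq//.
  move=> [i d] [j e] H1 H2 /= E.
  have {H1} dm : (d %| m)%N by case/allpairsP: H1 => -[i' d'] /= [_ + [_ ->]]; rewrite -dvdn_divisors.
  have {H2} em : (e %| m)%N by case/allpairsP: H2 => -[i' d'] /= [_ + [_ ->]]; rewrite -dvdn_divisors.
  have ij : i = j by rewrite -(logE i d)// E logE.
  move: E; rewrite ij => /eqP; rewrite eqn_pmul2l ?expn_gt0 ?prime_gt0//.
  by move=> /eqP ->.
move=> d; rewrite -dvdn_divisors//; apply/idP/allpairsP.
  move=> dd; have d0 := dvdn_gt0 pa0 dd.
  exists (logn p d, d`_p^')%N; split.
  - rewrite mem_iota add0n ltnS /=.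
    by have := dvdn_leq_log p pa0 dd; rewrite logE.
  - rewrite -dvdn_divisors// -(@Gauss_dvdr _ (p ^ a)); last first.
      rewrite coprime_sym coprimeXl//.
      by rewrite prime_coprime// -p'natE// part_pnat.
    exact: dvdn_trans (dvdn_part _ _) dd.
  - by rewrite -p_part partnC.
move=> [[i e] [ia em ->]]; apply: dvdn_mul; last by rewrite dvdn_divisors.
by rewrite dvdn_exp2l//; move: ia; rewrite mem_iota add0n ltnS.
Qed.

(** Each step strips the full power of the smallest prime factor, which leaves a coprime cofactor:
    multiplicative functions are treated one prime at a time. *)
Lemma prime_part_ind (P : nat -> Prop) : P 1%N ->
  (forall p a m, prime p -> (0 < a)%N -> coprime p m -> (0 < m)%N -> P m ->
     P (p ^ a * m)%N) ->
  forall n, (0 < n)%N -> P n.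
Proof.
move=> P1 PS n; have [k] := ubnP n; elim: k n => // k IH n nk n0.
have [->//|n1] := eqVneq n 1%N.
have pp : prime (pdiv n) by rewrite pdiv_prime// ltn_neqAle eq_sym n1.
set p := pdiv n in pp *.
have nE : n = (p ^ logn p n * n`_p^')%N by rewrite -p_part partnC.
have a0 : (0 < logn p n)%N by rewrite logn_gt0 mem_primes pp n0 pdiv_dvd.
rewrite nE; apply: PS => //.
- by rewrite prime_coprime// -p'natE// part_pnat.
- apply: IH => //; apply: (@leq_trans n); last by rewrite -ltnS.
  rewrite [ltnRHS]nE -[ltnLHS]mul1n ltn_pmul2r//.
  by rewrite -[1%N](exp1n (logn p n)) ltn_exp2r// prime_gt1.
Qed.

(** Each prime contributes a factor a + 1 >= 2 to the number of divisors. In [jacobsthal] this turns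
    the sieve error into a divisor count. *)
Lemma exp_primes_divisors (n : nat) : (0 < n)%N ->
  (2 ^ size (primes n) <= size (divisors n))%N.
Proof.
move: n; apply: prime_part_ind => // p a m pp a0 pm m0 IH.
rewrite size_divisors_pfactor//.
apply: (@leq_trans (2 * 2 ^ size (primes m))); last by rewrite leq_mul.
rewrite -expnS leq_exp2l// -[(size _).+1]/(size (p :: primes m)).
apply: uniq_leq_size; first exact: primes_uniq.
have p0 : (0 < p ^ a)%N by rewrite expn_gt0 prime_gt0.
by move=> q; rewrite (primesM _ p0 m0) primesX// primes_prime// !inE.
Qed.

(* (a + 1) ^ k <= k ^ k * 2 ^ a controls the primes below 2 ^ k, and for the
   others (a + 1) ^ k <= p ^ a. *)
Lemma divisors_bound (k : nat) : exists C : nat,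
  forall n, (0 < n)%N -> (size (divisors n) ^ k <= C * n)%N.
Proof.
case: k => [|k]; first by exists 1%N => n n0; rewrite expn0 mul1n.
set K := k.+1; pose w n := (\prod_(q <- primes n | (q < 2 ^ K)%N) K ^ K)%N.
have aK a : (a.+1 ^ K <= K ^ K * 2 ^ a)%N.
  apply: (@leq_trans ((K * 2 ^ (a %/ K)) ^ K)).
    rewrite leq_exp2r//; apply: (@leq_trans (K * (a %/ K).+1)).
      by rewrite mulnC ltn_ceil.
    by rewrite leq_mul2l; apply/orP; right; exact: ltn_expl.
  rewrite expnMn leq_mul2l -expnM leq_exp2l// leq_divM.
  by rewrite orbT.
have wn n : (0 < n)%N -> (size (divisors n) ^ K <= w n * n)%N.
  move: n; apply: prime_part_ind; first by rewrite /w big_nil exp1n.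
  move=> p a m pp a0 pm m0 IH; rewrite size_divisors_pfactor// expnMn.
  have -> : (w (p ^ a * m) = (if p < 2 ^ K then K ^ K else 1) * w m)%N.
    have pmi : p \notin primes m by rewrite mem_primes pp m0 /= -prime_coprime.
    rewrite /w (perm_big (p :: primes m)) ?big_cons/=.
      by case: ifP => _; rewrite ?mul1n.
    apply: uniq_perm; rewrite ?primes_uniq//= ?pmi ?primes_uniq//.
    have p0 : (0 < p ^ a)%N by rewrite expn_gt0 prime_gt0.
    by move=> q; rewrite (primesM _ p0 m0) primesX// primes_prime// !inE.
  rewrite mulnACA leq_mul//; case: ifP => pK.
    by apply: leq_trans (aK a) _; rewrite leq_mul2l leq_exp2r// prime_gt1// orbT.
  rewrite mul1n; move/negbT: pK; rewrite -leqNgt => pK.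
  apply: (@leq_trans ((2 ^ K) ^ a)); last by rewrite leq_exp2r.
  by rewrite -expnM mulnC expnM leq_exp2r// ltn_expl.
exists (\prod_(q < 2 ^ K) K ^ K)%N => n n0.
apply: leq_trans (wn n n0) _; rewrite leq_mul2r; apply/orP; right.
rewrite /w -big_filter.
have := @uniq_leq_size _ [seq q <- primes n | (q < 2 ^ K)%N] (iota 0 (2 ^ K)).
rewrite filter_uniq ?primes_uniq// => /(_ isT) H.
rewrite big_const_seq count_predT iter_muln_1 prod_nat_const card_ord.
rewrite leq_pexp2l ?expn_gt0//; rewrite size_iota in H; apply: H => q.
by rewrite mem_filter mem_iota add0n => /andP[].
Qed.

(** The multiples l y in a window correspond to the y in another window, whose ends are values of
    the ceiling of n / l, written [c] in the proof. The sieve induction thus stays within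
    intervals. *)
Lemma count_multiples (l : nat) (P : pred nat) (a J : nat) : (0 < l)%N ->
  exists A B : nat, [/\ `|B%:R - J%:R / l%:R| <= 1 :> rat &
    count (fun x => (l %| x)%N && P x) (iota a J) = count (fun y => P (l * y)%N) (iota A B)].
Proof.
move=> l0; pose c n := (n %/ l + ~~ (l %| n))%N.
have cS n : c n.+1 = (c n + (l %| n))%N.
  rewrite /c (divn_eq n l) -addnS; set q := (n %/ l)%N; have := ltn_pmod n l0.
  move: (n %% l)%N => r rl; rewrite !divnMDl// !dvdn_addr ?dvdn_mull// -!addnA.
  congr addn; rewrite (divn_small rl) add0n.
  have [->|r1] := eqVneq r 0%N.
    rewrite dvdn0 /=; have [->//|l1] := eqVneq l 1%N.
    by rewrite divn_small ?dvdn1 ?(negbTE l1)//; lia.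
  have -> : (l %| r)%N = false by apply/negbTE; rewrite gtnNdvd//; lia.
  have [<-|rl'] := eqVneq r.+1 l; first by rewrite divnn dvdnn.
  by rewrite divn_small ?gtnNdvd//; lia.
have cle n : (c a <= c (a + n))%N.
  by elim: n => [|n IH]; rewrite ?addn0// addnS cS (leq_trans IH) ?leq_addr.
have cb n : n%:R / l%:R <= (c n)%:R :> rat /\ (c n)%:R <= n%:R / l%:R + 1 :> rat.
  have nl : n%:R / l%:R = (n %/ l)%:R + (n %% l)%:R / l%:R :> rat.
    rewrite {1}(divn_eq n l) natrD natrM mulrDl mulfK//.
    by rewrite pnatr_eq0 -lt0n.
  have r1 : (n %% l)%:R / l%:R <= 1 :> rat.
    by rewrite ler_pdivrMr ?ltr0n// mul1r ler_nat ltnW// ltn_pmod.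
  have r0 : 0 <= (n %% l)%:R / l%:R :> rat by rewrite divr_ge0.
  rewrite /c nl natrD; case: (boolP (l %| n)%N) => ln /=; last by split; lra.
  by rewrite (eqP ln) mul0r; split; lra.
exists (c a), (c (a + J) - c a)%N; split.
  rewrite natrB//; have [h1 h2] := cb a; have [] := cb (a + J)%N.
  by rewrite natrD mulrDl => h3 h4; rewrite ler_norml; apply/andP; split; lra.
elim: J => [|J IH]; first by rewrite addn0 subnn.
rewrite -addn1 iotaD count_cat IH /= addn0 addn1 addnS cS.
rewrite -addnBAC//.
case: (boolP (l %| a + J)%N) => ln /=; last by rewrite !addn0.
rewrite iotaD count_cat /= addn0 subnKC//.
by congr (_ + (P _ : nat))%N; rewrite /c ln addn0 mulnC divnK.
Qed.

(* Eratosthenes-Legendre: each further prime doubles the error term. *)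
Lemma count_sieve (ps : seq nat) : uniq ps -> all prime ps -> forall a J : nat,
  `|(count (fun x => all (fun l => ~~ (l %| x)%N) ps) (iota a J))%:R
     - J%:R * \prod_(l <- ps) (1 - l%:R^-1)| <= 2 ^+ size ps - 1 :> rat.
Proof.
elim: ps => [|l ps IH] /=.
  by move=> _ _ a J; rewrite big_nil mulr1 expr0 subrr count_predT size_iota subrr normr0.
move=> /andP[lps ups] /andP[pl pps] a J; rewrite big_cons exprS.
set Q := \prod_(l <- ps) _ in IH *.
have Q01 : 0 <= Q <= 1.
  rewrite /Q; elim: (ps) pps => [|q qs IHq] /=; first by rewrite big_nil ler01 lexx.
  move=> /andP[pq /IHq /andP[h0 h1]]; rewrite big_cons.
  have q1 : 0 < q%:R^-1 :> rat by rewrite invr_gt0 ltr0n prime_gt0.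
  have q2 : q%:R^-1 <= 1 :> rat by rewrite invf_le1 ?ltr0n ?prime_gt0// ler1n prime_gt0.
  apply/andP; split; first by rewrite mulr_ge0//; lra.
  by rewrite mulr_ile1//; lra.
have [A [B [BJ E]]] := @count_multiples l (fun x => all (fun q => ~~ (q %| x)%N) ps) a J (prime_gt0 pl).
have := IH ups pps A B; have := IH ups pps a J.
rewrite (@eq_count _ (fun y => all (fun q => ~~ (q %| l * y)%N) ps)
  (fun y => all (fun q => ~~ (q %| y)%N) ps)) in E; last first.
  move=> y; apply: eq_in_all => q qps; rewrite Gauss_dvdr//.
  have pq : prime q := allP pps q qps.
  rewrite prime_coprime//; apply: contra lps => ql.
  by move: ql; rewrite dvdn_prime2// => /eqP <-.
rewrite -E; set c1 := count _ _; set c2 := count _ _.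
have -> : count (fun x => ~~ (l %| x)%N && all (fun q => ~~ (q %| x)%N) ps) (iota a J)
    = (c1 - c2)%N.
  rewrite /c1 /c2; elim: (iota a J) => //= x s IHs.
  have h : (count (fun x => (l %| x)%N && all (fun q => ~~ (q %| x)%N) ps) s
    <= count (fun x => all (fun q => ~~ (q %| x)%N) ps) s)%N by apply: sub_count => y /andP[].
  by rewrite IHs; case: (l %| x)%N => /=; case: all => /=; lia.
have c21 : (c2 <= c1)%N by apply: sub_count => x /andP[].
rewrite natrB// !ler_norml => /andP[h1 h2] /andP[h3 h4].
move: BJ; rewrite ler_norml => /andP[h5 h6].
have h7 : `|(B%:R - J%:R / l%:R) * Q| <= 1.
  rewrite normrM mulr_ile1//; first by rewrite ler_norml h5 h6.
  by rewrite ger0_norm; case/andP: Q01.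
move: h7; rewrite ler_norml => /andP[h7 h8].
have -> : J%:R * ((1 - l%:R^-1) * Q) = J%:R * Q - B%:R * Q + (B%:R - J%:R / l%:R) * Q.
  by ring.
by apply/andP; split; lra.
Qed.

(** With w the number of primes dividing q, the main term of the sieve is at least J / 2^w >= 4 *
    2^w, and the error is below 2^w. Three survivors are wanted because a nonzero quadratic
    polynomial cannot vanish at all of them. *)
Lemma jacobsthal (q a J : nat) : (0 < q)%N -> (4 * size (divisors q) ^ 2 <= J)%N ->
  (3 <= count (fun x => coprime x q) (iota a J))%N.
Proof.
move=> q0 qJ.
have pq : all prime (primes q) by apply/allP => p; rewrite mem_primes => /andP[].
have := count_sieve (primes_uniq q) pq a J.
rewrite (eq_count (a2 := fun x => coprime x q)); last first.
  move=> x; have [->|x0] := posnP x.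
    rewrite /coprime gcd0n; have [->//|q1] := eqVneq q 1%N.
    apply/negbTE/allPn; exists (pdiv q); rewrite ?dvdn0// mem_primes q0 pdiv_dvd.
    by rewrite pdiv_prime// ltn_neqAle eq_sym q1.
  rewrite coprime_has_primes// -all_predC; apply: eq_in_all => p.
  by rewrite mem_primes /= mem_primes => /andP[-> /andP[_ _]]; rewrite x0.
set c := count _ _; set s := size _.
have : (1 / 2) ^+ s <= \prod_(l <- primes q) (1 - l%:R^-1) :> rat.
  rewrite /s; elim: (primes q) pq => [|p ps IH] /=; first by rewrite big_nil.
  move=> /andP[pp /IH h]; rewrite exprS big_cons; apply: ler_pM; [by lra|by apply: exprn_ge0; lra| |exact: h].
  have : p%:R^-1 <= 2^-1 :> rat by rewrite lef_pV2 ?posrE ?ltr0n ?prime_gt0// ler_nat prime_gt1.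
  by lra.
set Q := \prod_(l <- _) _ => QS.
have sJ : 4 * (2 ^+ s) ^+ 2 <= J%:R :> rat.
  rewrite -!natrX -natrM ler_nat; apply: leq_trans qJ; rewrite leq_mul// leq_exp2r//.
  exact: exp_primes_divisors.
have s1 : 1 <= 2 ^+ s :> rat by rewrite -natrX ler1n expn_gt0.
have JQ : 4 * (2 ^+ s) <= J%:R * Q.
  have -> : 4 * 2 ^+ s = 4 * (2 ^+ s) ^+ 2 * (1 / 2) ^+ s :> rat.
    by rewrite div1r exprVn; field; rewrite expf_neq0.
  apply: ler_pM; [|by apply: exprn_ge0; lra|exact: sJ|exact: QS].
  by apply: mulr_ge0; [lra|do 2!apply: exprn_ge0; lra].
rewrite ler_norml => /andP[h1 h2]; rewrite -(ler_nat rat); lra.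
Qed.

(** * Polynomials *)

Lemma msizeM_bound (R : nzRingType) (n d1 d2 : nat) (p q : {mpoly R[n]}) :
  (msize p <= d1.+1)%N -> (msize q <= d2.+1)%N -> (msize (p * q) <= (d1 + d2).+1)%N.
Proof.
move=> h1 h2; apply/bigmax_leqP_seq => m /msuppM_le/allpairsP[[m1 m2] /= [p1 q2 ->]] _.
rewrite mdegD; have := leq_trans (msize_mdeg_lt p1) h1.
by have := leq_trans (msize_mdeg_lt q2) h2; lia.
Qed.

Lemma abszD_le (a b : int) : (absz (a + b)%R <= absz a + absz b)%N.
Proof. by lia. Qed.

(** A single evaluation serves the integers, the prime fields, the algebraic numbers and polynomial
    rings, so that reduction and substitution are instances of [evz_morph]. *)
Definition evz (R : comNzRingType) (n : nat) (f : {mpoly int[n]}) (v : 'I_n -> R) : R :=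
  mmap intr v f.

Section Evz.
Variable n : nat.
Implicit Types f g : {mpoly int[n]}.

Lemma evzE (R : comNzRingType) f (v : 'I_n -> R) :
  evz f v = \sum_(m <- msupp f) (f@_m)%:~R * \prod_i v i ^+ m i.
Proof. by []. Qed.

Lemma eq_evz (R : comNzRingType) f (v w : 'I_n -> R) : v =1 w -> evz f v = evz f w.
Proof.
move=> vw; rewrite !evzE; apply: eq_bigr => m _; congr (_ * _).
by apply: eq_bigr => i _; rewrite vw.
Qed.

Lemma evz_morph (R S : comNzRingType) (phi : {rmorphism R -> S}) f (v : 'I_n -> R) :
  phi (evz f v) = evz f (phi \o v).
Proof.
rewrite !evzE rmorph_sum; apply: eq_bigr => m _; rewrite rmorphM rmorph_int rmorph_prod.
by congr (_ * _); apply: eq_bigr => i _; rewrite rmorphXn.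
Qed.

Lemma evz_meval f (v : 'I_n -> int) : f.@[v] = evz f v.
Proof. by rewrite mevalE evzE; apply: eq_bigr => m _; rewrite intz. Qed.

Lemma evz_map (R : comNzRingType) f (v : 'I_n -> R) : (map_mpoly intr f).@[v] = evz f v.
Proof.
rewrite /map_mpoly /mmap /evz [LHS]raddf_sum /mmap; apply: eq_bigr => m _.
rewrite /= mevalM mevalC; congr (_ * _); rewrite /mmap1 (rmorph_prod (meval v)).
by apply: eq_bigr => i _; rewrite rmorphXn /= mevalXU.
Qed.

Lemma evz_homog_scale (R : comNzRingType) (d : nat) f (v : 'I_n -> R) (c : R) :
  f \is d.-homog -> evz f (fun i => c * v i) = c ^+ d * evz f v.
Proof.
move=> /dhomogP fd; rewrite !evzE mulr_sumr big_seq [RHS]big_seq.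
apply: eq_bigr => m mf; rewrite mulrCA; congr (_ * _).
under eq_bigr do rewrite exprMn; rewrite big_split /=; congr (_ * _).
by rewrite prodrXr -mdegE (fd m mf).
Qed.

Lemma evz_dvd f (q : int) (v w : 'I_n -> int) :
  (forall i, (q %| v i - w i)%Z) -> (q %| evz f v - evz f w)%Z.
Proof.
move=> vw; rewrite !evzE -sumrB; apply: rpred_sum => m _.
rewrite -mulrBr; apply: dvdz_mull.
apply: (big_ind2 (fun a b => q %| a - b)%Z) => [|a b a' b' ab ab'|i _].
- by rewrite subrr dvdz0.
- have -> : a * a' - b * b' = a * (a' - b') + (a - b) * b' by ring.
  by apply: rpredD; [exact: dvdz_mull|exact: dvdz_mulr].
- by rewrite subrXX dvdz_mulr.
Qed.

Definition mnorm f : nat := (\sum_(m <- msupp f) absz (f@_m))%N.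

(** The exponent [msize f] exceeds the degree by one; only a bound by a fixed power of X matters
    later. *)
Lemma evz_bound f (X : nat) (v : 'I_n -> int) : (0 < X)%N ->
  (forall i, (`|v i| <= X)%N) -> (`|evz f v| <= mnorm f * X ^ msize f)%N.
Proof.
move=> X0 vX; rewrite evzE /mnorm big_distrl /=.
apply: (@leq_trans (\sum_(m <- msupp f) absz ((f@_m)%:~R * \prod_i v i ^+ m i)%R)%N).
  elim/big_rec2 : _ => [//|m x y _ H].
  by apply: leq_trans (abszD_le _ _) _; rewrite leq_add2l.
rewrite big_seq [leqRHS]big_seq; apply: leq_sum => m mf.
rewrite intz abszM leq_mul2l; apply/orP; right.
apply: (@leq_trans (\prod_i X ^ m i)%N).
  rewrite (big_morph absz abszM absz1); apply: leq_prod => i _.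
  by rewrite abszX; have [->//|mi] := posnP (m i); rewrite leq_exp2r.
rewrite -expn_sum -mdegE leq_pexp2l// ltnW//.
exact: msize_mdeg_lt.
Qed.

Lemma msize_evz (k D : nat) f (h : 'I_n -> {mpoly int[k]}) :
  (forall i, (msize (h i) <= D.+1)%N) -> (msize (evz f h) <= (msize f * D).+1)%N.
Proof.
move=> hD; rewrite evzE; apply: leq_trans (mmeasure_sum _ _ _ _) _.
apply/bigmax_leqP_seq => m mf _.
have H : forall (c : int) (p : {mpoly int[k]}) N, (msize p <= N.+1)%N -> (msize (c%:~R * p) <= N.+1)%N.
  by move=> c p N pN; rewrite -(rmorph_int (@mpolyC k int)) mul_mpolyC (leq_trans (mmeasureZ_le _ _ _)).
apply: H; apply: (@leq_trans (mdeg m * D).+1); last first.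
  by rewrite ltnS leq_mul2r ltnW ?orbT// msize_mdeg_lt.
rewrite mdegE big_distrl /=.
elim/big_rec2 : _ => [|i y p _ H1]; first by rewrite msize1.
apply: msizeM_bound => //; rewrite mulnC; elim: (m i) => [|j IHj]; first by rewrite expr0 msize1.
by rewrite exprS mulnS; apply: msizeM_bound.
Qed.

End Evz.

(** * Zeros of polynomials on grids *)

Section SchwartzZippel.
Variable R : idomainType.

Lemma coef_muni (m k : nat) (P : {mpoly R[m.+1]}) (mu : 'X_{1..m}) :
  ((muni P)`_k)@_mu = P@_[multinom (if unlift ord_max i is Some j then mu j else k) | i < m.+1].
Proof.
set nu := [multinom _ | i < _].
rewrite muniE coef_sum raddf_sum /=.
have E (M : 'X_{1..m.+1}) : ((P@_M *: 'X_[[multinom M (widen_ord (leqnSn m) i) | i < m]] *: 'X^(M ord_max) : {poly {mpoly R[m]}})`_k)@_mu = P@_M * (M == nu)%:R.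
  rewrite coefZ coefXn; have [kM|kM] := eqVneq k (M ord_max); last first.
    rewrite mulr0 mcoeff0; have [MN|] := eqVneq M nu; last by rewrite mulr0.
    by case/eqP: kM; rewrite MN mnmE unlift_none.
  rewrite mulr1 mcoeffZ mcoeffX; congr (_ * (nat_of_bool _)%:R).
  apply/eqP/eqP => [muE|->].
    apply/mnmP => i; rewrite mnmE -muE; case: unliftP => [j ->|->//].
    by rewrite mnmE; congr (M _); apply/val_inj; rewrite /= /bump leqNgt ltn_ord.
  apply/mnmP => i; rewrite !mnmE; case: unliftP => [j|] /(congr1 val) /=.
    by rewrite /bump leqNgt ltn_ord add0n => /val_inj ->.
  by move=> im; have := ltn_ord i; rewrite im ltnn.
under eq_bigr do rewrite E.
have [nuP|nuP] := boolP (nu \in msupp P).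
  rewrite (bigD1_seq nu)//= eqxx mulr1 big1 ?addr0// => M /negbTE ->.
  by rewrite mulr0.
rewrite (memN_msupp_eq0 nuP) big_seq big1// => M MP.
by have [MN|] := eqVneq M nu; rewrite ?mulr0//; rewrite MN (negbTE nuP) in MP.
Qed.

Lemma meval_muni (m : nat) (P : {mpoly R[m.+1]}) (v : 'I_m.+1 -> R) :
  P.@[v] = (map_poly (meval (fun i => v (widen_ord (leqnSn m) i))) (muni P)).[v ord_max].
Proof.
rewrite mevalE muniE raddf_sum horner_sum; apply: eq_bigr => M _.
rewrite big_ord_recr /= map_polyZ map_polyXn hornerZ hornerXn /= mevalZ mevalX mulrA.
by congr (_ * _ * _); apply: eq_bigr => i _; rewrite mnmE.
Qed.

(** Either the leading coefficient in the last variable vanishes at the other coordinates, which is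
    the induction, or fewer than D values of the last coordinate are roots. Dividing by |A| instead
    of writing the exponent m - 1 gives the bound 0 for m = 0. *)
Lemma schwartz_zippel (m D : nat) (P : {mpoly R[m]}) (A : seq R) :
  P != 0 -> (msize P <= D)%N -> uniq A -> (0 < size A)%N ->
  atmost (fun v : 'rV[R]_m => (forall i, v ord0 i \in A) /\ P.@[v ord0] = 0)
    ((m * D)%:R * (size A)%:R ^+ m / (size A)%:R).
Proof.
move=> + + uA A0; elim: m P => [|m IH] P P0 PD.
  rewrite mul0n !mul0r; apply: atmost0 => v [_]; rewrite (nvar0_mpolyC P) mevalC => P00.
  by case/eqP: P0; rewrite (nvar0_mpolyC P) P00.
have mup0 : muni P != 0.
  apply: contraNneq P0 => mup0; apply/eqP/mpolyP => M; rewrite mcoeff0.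
  have := coef_muni (M ord_max) P [multinom M (widen_ord (leqnSn m) i) | i < m].
  rewrite mup0 coef0 mcoeff0 => ->; congr (P@__); apply/mnmP => i; rewrite mnmE.
  case: unliftP => [j ->|->//]; rewrite mnmE; congr (M _); apply/val_inj.
  by rewrite /= /bump leqNgt ltn_ord.
set nu := fun (M : 'X_{1..m}) k =>
  [multinom (if unlift ord_max i is Some j then M j else k) | i < m.+1].
have nudeg M k : mdeg (nu M k) = (mdeg M + k)%N.
  rewrite !mdegE big_ord_recr /= mnmE unlift_none; congr addn.
  apply: eq_bigr => i _; rewrite mnmE; case: unliftP => [j|] /(congr1 val) /=.
    by rewrite /bump leqNgt ltn_ord => /val_inj ->.
  by move=> im; have := ltn_ord i; rewrite im ltnn.
have szP : (size (muni P) <= D)%N.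
  apply/leq_sizeP => k Dk; apply/mpolyP => M; rewrite coef_muni mcoeff0.
  apply: memN_msupp_eq0; apply: msize_mdeg_ge; rewrite -/(nu M k) nudeg.
  by rewrite (leq_trans PD)// (leq_trans Dk)// leq_addl.
set a := lead_coef (muni P).
have a0 : a != 0 by rewrite lead_coef_eq0.
have aD : (msize a <= D)%N.
  apply/bigmax_leqP_seq => M Ma _; apply: leq_trans PD.
  move: Ma; rewrite mcoeff_msupp /a lead_coefE coef_muni -mcoeff_msupp.
  by move=> /msize_mdeg_lt; rewrite -/(nu M _) nudeg; apply: leq_ltn_trans (leq_addr _ _).
pose res (v : 'rV[R]_m.+1) : 'rV[R]_m := \row_i v ord0 (widen_ord (leqnSn m) i).
have row_eq (v w : 'rV[R]_m.+1) : res v = res w -> v ord0 ord_max = w ord0 ord_max -> v = w.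
  move=> /rowP vw vw'; apply/rowP => i; case: (unliftP ord_max i) => [j ->|->//].
  have := vw j; rewrite !mxE.
  suff -> : lift ord_max j = widen_ord (leqnSn m) j by [].
  by apply/val_inj; rewrite /= /bump leqNgt ltn_ord.
have AR : (size A)%:R != 0 :> rat by rewrite pnatr_eq0 -lt0n.
have AmR : 0 <= (size A)%:R ^+ m :> rat by rewrite exprn_ge0.
apply: (atmost_sub (B := fun v : 'rV[R]_m.+1 =>
  ((forall i, v ord0 i \in A) /\ a.@[res v ord0] = 0) \/
  ((forall i, v ord0 i \in A) /\ a.@[res v ord0] <> 0 /\ P.@[v ord0] = 0))
  (x := (size A)%:R * ((m * D)%:R * (size A)%:R ^+ m / (size A)%:R)
     + (size A)%:R ^+ m * D%:R)).
- by move=> v [vA Pv]; have [|] := eqVneq (a.@[res v ord0]) 0; [left|right; split=> //; split=> //; apply/eqP].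
- apply: atmost_or.
    apply: (@atmost_rel 'rV[R]_m.+1 R _ (fun x => x \in A) (fun v x => v ord0 ord_max = x)).
    + by move=> v [vA _]; exists (v ord0 ord_max).
    + exact: atmost_seq.
    + move=> x xA; apply: (@atmost_inj 'rV[R]_m.+1 'rV[R]_m _ _ res _ _ _ (IH a a0 aD)).
        by move=> v [[vA av] _]; split=> // i; rewrite mxE.
      by move=> v w [_ v1] [_ w1] /row_eq; apply; rewrite v1 w1.
    + by rewrite divr_ge0// mulr_ge0.
  apply: (@atmost_rel 'rV[R]_m.+1 'rV[R]_m _ (fun w => (forall i, w ord0 i \in A) /\ a.@[w ord0] <> 0)
     (fun v w => res v = w)).
  + move=> v [vA [av _]]; exists (res v) => //; split=> // i; rewrite mxE//.
  + apply: (atmost_sub (B := fun w : 'rV[R]_m => (forall i, w ord0 i \in A)) (x := (size A)%:R ^+ m)) => //.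
      by move=> w [].
    have := @atmost_row R m (fun=> fun x => x \in A) (fun=> (size A)%:R) (fun=> @atmost_seq _ A).
    by rewrite prodr_const card_ord.
  + move=> w [wA aw]; set p := map_poly (meval (w ord0)) (muni P).
    have p0 : p != 0.
      apply/eqP => /(congr1 (fun q : {poly R} => q`_(size (muni P)).-1)).
      by rewrite coef0 coef_map -lead_coefE => /aw.
    move=> s us sP; rewrite ler_nat.
    have sz : (size s <= size [seq v ord0 ord_max | v : 'rV[R]_m.+1 <- s])%N by rewrite size_map.
    apply: leq_trans sz _; apply: leq_trans szP.
    apply: (@leq_trans (size p)); last exact: size_poly.
    apply/ltnW; apply: max_poly_roots => //.
      apply/allP => x /mapP[v vs ->]; have [[vA [_ Pv]] vw] := sP v vs.
      rewrite rootE; apply/eqP; rewrite -[RHS]Pv meval_muni /p; congr (_.[_]).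
      by apply: eq_map_poly => q; apply: meval_eq => i; rewrite -vw mxE.
    rewrite map_inj_in_uniq// => v v' /sP[_ vw] /sP[_ v'w]; apply: row_eq.
    by rewrite vw v'w.
  + by [].
- rewrite [X in X + _]mulrCA mulfV// mulr1 exprSr mulrA mulfK//.
  by rewrite [X in _ + X]mulrC -mulrDl -natrD mulSn addnC.
Qed.

(** The grid has |A|^m points, more than its at most m * msize P * |A|^m / |A| zeros. *)
Lemma mpoly_nonvanishing (m : nat) (P : {mpoly R[m]}) (A : seq R) :
  P != 0 -> uniq A -> (m * msize P < size A)%N ->
  exists2 v : 'rV[R]_m, (forall i, v ord0 i \in A) & P.@[v ord0] != 0.
Proof.
move=> P0 uA mA; apply: contrapT => no.
have A0 : (0 < size A)%N by apply: leq_ltn_trans mA.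
have := schwartz_zippel P0 (leqnn _) uA A0.
pose s := [seq (\row_i tnth t i : 'rV[R]_m) | t <- [seq [tuple of [seq nth 0 A (i : 'I_(size A)) | i <- t]] | t : m.-tuple 'I_(size A)]].
move=> /(_ s).
have us : uniq s.
  rewrite map_inj_uniq; last first.
    by move=> t t' /rowP tt; apply/eq_from_tnth => i; have := tt i; rewrite !mxE.
  rewrite map_inj_uniq ?enum_uniq// => t t' /(congr1 val) /=.
  have inj : injective (fun i : 'I_(size A) => nth 0 A i).
    by move=> i j /eqP; rewrite nth_uniq// => /eqP/val_inj.
  by move=> /(inj_map inj)/val_inj.
move=> /(_ us); rewrite /s size_map size_image card_tuple card_ord.
have sP : forall t, t \in s -> (forall i, t ord0 i \in A) /\ P.@[t ord0] = 0.
  move=> v /mapP[t /mapP[t' _ ->] ->].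
  have vA i : (\row_i0 tnth [tuple of [seq nth 0 A (i1 : 'I_(size A)) | i1 <- t']] i0 : 'rV[R]_m) ord0 i \in A.
    by rewrite mxE tnth_map mem_nth.
  split=> //; apply/eqP/negP => /negP Pv; apply: no.
  by exists (\row_i0 tnth [tuple of [seq nth 0 A (i1 : 'I_(size A)) | i1 <- t']] i0).
move=> /(_ sP); rewrite natrX ler_pdivlMr ?ltr0n// mulrC ler_pM2r ?exprn_gt0 ?ltr0n//.
by rewrite ler_nat leqNgt mA.
Qed.

End SchwartzZippel.

(** * Restriction to lines and resultants *)

Definition line_poly (R : comNzRingType) (n : nat) (f : {mpoly int[n]}) (a b : 'I_n -> R) :
  {poly R} := evz f (fun i => (a i)%:P + (b i)%:P * 'X).

Section LinePoly.
Variable n : nat.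
Implicit Types f g : {mpoly int[n]}.

Lemma horner_line_poly (R : comNzRingType) f (a b : 'I_n -> R) (t : R) :
  (line_poly f a b).[t] = evz f (fun i => a i + b i * t).
Proof.
rewrite /line_poly -[LHS]/(horner_eval t _) evz_morph; apply: eq_evz => i /=.
by rewrite /horner_eval !hornerE.
Qed.

Lemma map_line_poly (R S : comNzRingType) (phi : {rmorphism R -> S}) f (a b : 'I_n -> R) :
  map_poly phi (line_poly f a b) = line_poly f (phi \o a) (phi \o b).
Proof.
rewrite /line_poly (evz_morph (map_poly phi)); apply: eq_evz => i /=.
by rewrite rmorphD rmorphM /= !map_polyC map_polyX.
Qed.

Section Top.
Variables (R : comNzRingType) (a b : 'I_n -> R).

Let has_top (d : nat) (c : R) (p : {poly R}) := (size p <= d.+1)%N /\ p`_d = c.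

Let has_topM d1 d2 c1 c2 p1 p2 : has_top d1 c1 p1 -> has_top d2 c2 p2 ->
  has_top (d1 + d2) (c1 * c2) (p1 * p2).
Proof.
move=> [s1 h1] [s2 h2]; split.
  by apply: leq_trans (size_polyMleq _ _) _; move: s1 s2; lia.
rewrite coefM (bigD1 (inord d1)) //= inordK ?ltnS ?leq_addr// addKn h1 h2.
rewrite big1 ?addr0// => i id1.
have [ltd|led] := ltnP i d1.
  rewrite [X in _ * X]nth_default ?mulr0//; apply: leq_trans s2 _.
  by move: ltd; lia.
rewrite nth_default ?mul0r//; apply: leq_trans s1 _; rewrite ltn_neqAle led andbT.
apply/eqP => E; case/eqP: id1; apply/val_inj.
by rewrite /= inordK ?ltnS ?leq_addr// E.
Qed.

Let has_top_monomial (m : 'X_{1..n}) :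
  has_top (mdeg m) (\prod_i b i ^+ m i) (\prod_i ((a i)%:P + (b i)%:P * 'X) ^+ m i).
Proof.
rewrite mdegE; elim/big_rec3 : _ => [|i p c d _ H]; first by split; rewrite ?size_poly1 ?coef1.
apply: has_topM => //; elim: (m i) => [|k IH]; first by split; rewrite ?size_poly1 ?coef1.
rewrite !exprS -add1n; apply: has_topM => //; split.
  rewrite (leq_trans (size_polyD _ _))// geq_max (leq_trans (size_polyC_leq1 _))//=.
  rewrite (leq_trans (size_polyMleq _ _))// size_polyX.
  by have := size_polyC_leq1 (b i); case: size => [|[]].
by rewrite coefD coefC coefMX coefC /= add0r.
Qed.

Lemma size_line_poly f : (size (line_poly f a b) <= msize f)%N.
Proof.
rewrite /line_poly evzE; apply: leq_trans (size_sum _ _ _) _.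
apply/bigmax_leqP_seq => m mf _; rewrite -(rmorph_int (@polyC R)) mul_polyC.
apply: leq_trans (size_scale_leq _ _) _.
exact: leq_trans (has_top_monomial m).1 (msize_mdeg_lt mf).
Qed.

(** The coefficient in degree d depends on the direction b alone. Where f(b) is nonzero, the degree
    along the line is therefore exact, whatever the base point. *)
Lemma coef_line_poly (d : nat) f : f \is d.-homog ->
  (size (line_poly f a b) <= d.+1)%N /\ (line_poly f a b)`_d = evz f b.
Proof.
move=> /dhomogP fd; split.
  rewrite /line_poly evzE; apply: leq_trans (size_sum _ _ _) _.
  apply/bigmax_leqP_seq => m mf _; rewrite -(rmorph_int (@polyC R)) mul_polyC.
  apply: leq_trans (size_scale_leq _ _) _.
  by rewrite -(fd m mf); exact: (has_top_monomial m).1.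
rewrite /line_poly !evzE coef_sum big_seq [RHS]big_seq; apply: eq_bigr => m mf.
by rewrite -(rmorph_int (@polyC R)) coefCM -{1}(fd m mf) (has_top_monomial m).2.
Qed.

End Top.
End LinePoly.

(** The shape of the Sylvester matrix depends only on the two degrees, which are kept when neither
    leading coefficient is sent to 0. *)
Lemma rmorph_resultant (R S : nzRingType) (phi : {rmorphism R -> S}) (p q : {poly R}) :
  phi (lead_coef p) != 0 -> phi (lead_coef q) != 0 ->
  phi (resultant p q) = resultant (map_poly phi p) (map_poly phi q).
Proof.
move=> pp pq; rewrite /resultant -det_map_mx /Sylvester_mx !size_map_poly_id0//.
rewrite map_col_mx; congr (\det (col_mx _ _)); apply: map_lin1_mx => v.
  by rewrite /= map_poly_rV rmorphM /= map_rVpoly.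
by rewrite /= map_poly_rV rmorphM /= map_rVpoly.
Qed.

Definition pair_val (R : Type) (n : nat) (a b : 'I_n -> R) (i : 'I_(n + n)) : R :=
  match fintype.split i with inl j => a j | inr j => b j end.

Section LineResultant.
Variables (n k : nat) (f : {mpoly int[n]}).
Hypotheses (f_homog : f \is k.-homog) (k_gt0 : (0 < k)%N).

(* Adding 'X^K * f makes the degree of the second polynomial, like that of the
   first, independent of the line, so that the resultant specializes. *)
Definition line_cofactor (R : comNzRingType) (g : {mpoly int[n]}) (a b : 'I_n -> R) : {poly R} :=
  line_poly g a b + 'X^((msize g).+1) * line_poly f a b.

Definition line_res (g : {mpoly int[n]}) : {mpoly int[n + n]} :=
  let a i := 'X_(lshift n i) in let b i := 'X_(rshift n i) in
  resultant (line_poly f a b) (line_cofactor g a b).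

Section Spec.
Variables (R : comNzRingType) (g : {mpoly int[n]}) (a b : 'I_n -> R).
Hypothesis b0 : evz f b != 0.

Lemma size_line_polyE : size (line_poly f a b) = k.+1.
Proof.
have [s c] := coef_line_poly a b f_homog; apply/eqP; rewrite eqn_leq s /=.
by rewrite ltnNge; apply: contra b0 => sk; rewrite -c nth_default.
Qed.

Lemma size_line_cofactor :
  size (line_cofactor g a b) = ((msize g).+1 + k.+1)%N /\
  lead_coef (line_cofactor g a b) = evz f b.
Proof.
have p0 : line_poly f a b != 0 by rewrite -size_poly_eq0 size_line_polyE.
have E : size ('X^((msize g).+1) * line_poly f a b) = ((msize g).+1 + k.+1)%N.
  by rewrite size_monicM ?monicXn// size_polyXn size_line_polyE addSn.
have lt : (size (line_poly g a b) < size ('X^((msize g).+1) * line_poly f a b)%R)%N.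
  by rewrite E; apply: leq_trans (leq_addr _ _); rewrite ltnS; apply: size_line_poly.
split; first by rewrite /line_cofactor addrC size_polyDl.
rewrite /line_cofactor addrC lead_coefDl// mulrC lead_coef_Mmonic ?monicXn//.
by rewrite lead_coefE size_line_polyE (coef_line_poly a b f_homog).2.
Qed.

End Spec.

Lemma line_resE (R : comNzRingType) g (a b : 'I_n -> R) : evz f b != 0 ->
  evz (line_res g) (pair_val a b) = resultant (line_poly f a b) (line_cofactor g a b).
Proof.
move=> fb; set phi : {rmorphism {mpoly int[n + n]} -> R} := mmap intr (pair_val a b).
set A := fun i : 'I_n => 'X_(lshift n i) : {mpoly int[n + n]}.
set B := fun i : 'I_n => 'X_(rshift n i) : {mpoly int[n + n]}.
have phiA : phi \o A =1 a.
  by move=> i; rewrite /= mmapX mmap1U /pair_val -[lshift _ _]/(unsplit (inl i)) unsplitK.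
have phiB : phi \o B =1 b.
  by move=> i; rewrite /= mmapX mmap1U /pair_val -[rshift _ _]/(unsplit (inr i)) unsplitK.
have phifB : phi (evz f B) = evz f b by rewrite evz_morph; exact: eq_evz.
have fB : evz f B != 0 by apply: contraNneq fb => fB; rewrite -phifB fB rmorph0.
have lE h : map_poly phi (line_poly h A B) = line_poly h a b.
  by rewrite map_line_poly; apply: eq_evz => i; rewrite phiA phiB.
rewrite -[LHS]/(phi (line_res g)) /line_res -/A -/B rmorph_resultant.
- by rewrite /line_cofactor rmorphD rmorphM /= map_polyXn !lE.
- by rewrite lead_coefE (size_line_polyE A fB) (coef_line_poly A B f_homog).2 phifB.
- by rewrite (size_line_cofactor g A fB).2 phifB.
Qed.

(** The resultant is a combination of the two polynomials on the line, and at the parameter t both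
    have values divisible by d. *)
Lemma line_res_dvd (g : {mpoly int[n]}) (a b : 'I_n -> int) (t d : int) : evz f b != 0 ->
  (d %| evz f (fun i => a i + b i * t))%Z -> (d %| evz g (fun i => a i + b i * t))%Z ->
  (d %| evz (line_res g) (pair_val a b))%Z.
Proof.
move=> fb df dg; rewrite line_resE//.
have [||[u v] /= _ E] := @resultant_in_ideal _ (line_poly f a b) (line_cofactor g a b).
- by rewrite size_line_polyE// ltnS.
- by rewrite (size_line_cofactor g a fb).1 addnS ltnS addn_gt0.
have := congr1 (horner^~ t) E; rewrite hornerC hornerD !hornerM => ->.
rewrite /line_cofactor hornerD hornerM !horner_line_poly.
by rewrite rpredD ?dvdz_mull// rpredD// dvdz_mull.
Qed.

Lemma line_res_root (K : closedFieldType) (g : {mpoly int[n]}) (a b : 'I_n -> K) :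
  evz f b != 0 -> evz (line_res g) (pair_val a b) = 0 ->
  exists t, evz f (fun i => a i + b i * t) = 0 /\ evz g (fun i => a i + b i * t) = 0.
Proof.
move=> fb; rewrite line_resE// => /eqP; rewrite resultant_eq0 => sz.
have /closed_rootP[t] : size (gcdp (line_poly f a b) (line_cofactor g a b)) != 1 by rewrite gtn_eqF.
rewrite root_gcd => /andP[/rootP pt]; rewrite rootE /line_cofactor hornerD hornerM pt mulr0 addr0.
by move=> /eqP gt; exists t; rewrite -!horner_line_poly.
Qed.

(** One polynomial in place of r of them: at a given point its value is a polynomial in c of degree
    below r, with the values of the F_j as coefficients. *)
Definition power_comb (r : nat) (F : 'I_r -> {mpoly int[n]}) (c : nat) : {mpoly int[n]} :=
  \sum_(j < r) (c ^ j)%:R * F j.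

Lemma evz_power_comb (R : comNzRingType) r (F : 'I_r -> {mpoly int[n]}) c (v : 'I_n -> R) :
  evz (power_comb F c) v = \sum_(j < r) c%:R ^+ j * evz (F j) v.
Proof.
set phi : {rmorphism {mpoly int[n]} -> R} := mmap intr v.
rewrite -[LHS]/(phi _) /power_comb rmorph_sum; apply: eq_bigr => j _.
by rewrite rmorphM /= rmorph_nat natrX.
Qed.

(** Pigeonhole over c. Each of the kr + 1 values of c leads to one of at most k roots t of f on the
    line, and if some F_j is nonzero at t, at most r values of c lead to t. *)
Lemma common_root (K : numClosedFieldType) (r : nat) (F : 'I_r -> {mpoly int[n]})
    (a b : 'I_n -> K) :
  evz f b != 0 ->
  (forall c : nat, (c <= k * r)%N -> evz (line_res (power_comb F c)) (pair_val a b) = 0) ->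
  exists t, evz f (fun i => a i + b i * t) = 0 /\
    forall j, evz (F j) (fun i => a i + b i * t) = 0.
Proof.
move=> fb res0; apply: contrapT => no.
pose P := line_poly f a b; pose Fp t : {poly K} := \poly_(j < r) (if insub j is Some i then evz (F i) (fun i => a i + b i * t) else 0).
have Fpc t (c : nat) : (Fp t).[c%:R] = evz (power_comb F c) (fun i => a i + b i * t).
  rewrite evz_power_comb horner_poly; apply: eq_bigr => j _.
  by rewrite mulrC (valK j).
have P0 : P != 0 by rewrite -size_poly_eq0 size_line_polyE.
have natK : injective (fun c : nat => c%:R : K) by move=> c c' /eqP; rewrite eqr_nat => /eqP.
have H : atmost (fun c => (c <= k * r)%N) (k%:R * r%:R).
  apply: (@atmost_rel nat K _ (root P)
    (fun c t => evz (power_comb F c) (fun i => a i + b i * t) = 0)).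
  - by move=> c /res0/(line_res_root fb)[t [ft gt]]; exists t; rewrite // /P rootE horner_line_poly ft.
  - move=> s us sP; rewrite ler_nat -ltnS -(size_line_polyE a fb); apply: max_poly_roots => //.
    exact/allP.
  - move=> t /rootP; rewrite horner_line_poly => ft s us sF; rewrite ler_nat.
    rewrite -(size_map (fun c : nat => c%:R : K)); apply: leq_trans (size_poly r _).
    apply/ltnW/(@max_poly_roots _ (Fp t)); last by rewrite map_inj_uniq.
      apply/eqP => F0; apply: no; exists t; split=> // j.
      have := congr1 (fun q : {poly K} => q`_j) F0; rewrite coef_poly ltn_ord coef0.
      by rewrite (valK j).
    by apply/allP => _ /mapP[c cs ->]; rewrite rootE Fpc (sF c cs).2.
  - by [].
have := H (iota 0 (k * r).+1) (iota_uniq _ _).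
rewrite size_iota -natrM ler_nat ltnn => /(_ _)/notF; apply=> c.
by rewrite mem_iota add0n ltnS.
Qed.

End LineResultant.

(** * Short bases of lattices *)

Section Forms.
Variable k : nat.
Implicit Types (G : 'M[rat]_k) (u v w : 'rV[rat]_k).

Definition bil G u v : rat := (u *m G *m v^T) ord0 ord0.

Lemma bilDl G u v w : bil G (u + v) w = bil G u w + bil G v w.
Proof. by rewrite /bil !mulmxDl mxE. Qed.

Lemma bilDr G u v w : bil G u (v + w) = bil G u v + bil G u w.
Proof. by rewrite /bil linearD mulmxDr mxE. Qed.

Lemma bilZl G c u v : bil G (c *: u) v = c * bil G u v.
Proof. by rewrite /bil -!scalemxAl mxE. Qed.

Lemma bilZr G c u v : bil G u (c *: v) = c * bil G u v.
Proof. by rewrite /bil linearZ -scalemxAr mxE. Qed.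

Lemma bil0l G v : bil G 0 v = 0.
Proof. by rewrite /bil !mul0mx mxE. Qed.

Lemma bil0r G u : bil G u 0 = 0.
Proof. by rewrite /bil linear0 mulmx0 mxE. Qed.

Lemma bil_mul (l : nat) (U : 'M[rat]_(l, k)) G (u v : 'rV[rat]_l) :
  (u *m (U *m G *m U^T) *m v^T) ord0 ord0 = bil G (u *m U) (v *m U).
Proof. by rewrite /bil trmx_mul !mulmxA. Qed.

Definition posdef G : Prop := G^T = G /\ forall v, v != 0 -> 0 < bil G v v.

Lemma bilC G u v : G^T = G -> bil G u v = bil G v u.
Proof.
move=> Gs; rewrite /bil; have -> : (u *m G *m v^T) ord0 ord0 = (u *m G *m v^T)^T ord0 ord0 by rewrite [RHS]mxE.
by rewrite !trmx_mul trmxK Gs mulmxA.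
Qed.

Lemma posdef_ge0 G v : posdef G -> 0 <= bil G v v.
Proof.
move=> [_ Gp]; have [->|/Gp/ltW//] := eqVneq v 0.
by rewrite /bil !mul0mx mxE.
Qed.

Lemma posdef_unit G : posdef G -> G \in unitmx.
Proof.
move=> [_ Gp]; rewrite unitmxE unitfE; apply/det0P => -[v v0 vG].
by have := Gp v v0; rewrite /bil vG mul0mx mxE ltxx.
Qed.

Lemma bil_invmx G u v : posdef G -> bil (invmx G) (u *m G) (v *m G) = bil G u v.
Proof.
move=> Gp; have Gu := posdef_unit Gp.
by rewrite /bil mulmxK// trmx_mul mulmxA Gp.1.
Qed.

Lemma posdef_invmx G : posdef G -> posdef (invmx G).
Proof.
move=> Gp; have Gu := posdef_unit Gp; split; first by rewrite trmx_inv Gp.1.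
move=> w w0; rewrite -(mulmxKV Gu w) bil_invmx//; apply: Gp.2.
by apply: contraNneq w0 => H; rewrite -(mulmxKV Gu w) H mul0mx.
Qed.

(** Expand and use 2 G(x, y) <= G(x, x) + G(y, y); this avoids square roots. *)
Lemma bil_sum_le G (I : finType) (x : I -> 'rV[rat]_k) : posdef G ->
  bil G (\sum_i x i) (\sum_i x i) <= #|I|%:R * \sum_i bil G (x i) (x i).
Proof.
move=> Gp.
have -> : bil G (\sum_i x i) (\sum_i x i) = \sum_i \sum_j bil G (x i) (x j).
  rewrite (big_morph (fun u => bil G u _) (fun u v => bilDl G u v _) (bil0l G _)).
  by apply: eq_bigr => i _; rewrite (big_morph (bil G (x i)) (bilDr G (x i)) (bil0r G _)).
have H i j : bil G (x i) (x j) <= (bil G (x i) (x i) + bil G (x j) (x j)) / 2.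
  have := posdef_ge0 (x i - x j) Gp; rewrite -scaleN1r !(bilDl, bilDr, bilZl, bilZr).
  by rewrite (bilC (x j) (x i) Gp.1); lra.
apply: (@le_trans _ _ (\sum_i \sum_j (bil G (x i) (x i) + bil G (x j) (x j)) / 2)).
  by apply: ler_sum => i _; apply: ler_sum => j _.
under eq_bigr => i _ do rewrite -mulr_suml big_split /= sumr_const.
rewrite -mulr_suml big_split /= sumr_const sumrMnl.
by set S := \sum_i _; rewrite -[S *+ _]mulr_natl -mulrDl; lra.
Qed.

End Forms.

Lemma common_denominator (I : finType) (x : I -> rat) :
  exists2 d : nat, (0 < d)%N & forall i, exists z : int, d%:R * x i = z%:~R.
Proof.
exists (\prod_i `|denq (x i)|)%N; first by rewrite prodn_gt0// => i; rewrite absz_gt0 denq_neq0.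
move=> i; rewrite (bigD1 i) //= natrM.
exists (Posz (\prod_(j | j != i) `|denq (x j)|)%N * numq (x i)).
by rewrite rmorphM /= numqE natr_absz gtr0_norm ?denq_gt0//; ring.
Qed.

Lemma rat_round (x : rat) : exists z : int, `|z%:~R - x| <= 1 / 2.
Proof.
exists (Num.floor (x + 1 / 2)); have := floor_itv (x + 1 / 2).
by rewrite intrD ler_norml => /andP[h1 h2]; apply/andP; split; lra.
Qed.

(** Smith normal form of a single row: w is a multiple of a primitive vector, and this vector
    extends to a basis. *)
Lemma int_row_unimodular (k : nat) (w : 'rV[int]_k.+1) : w != 0 ->
  exists (V : 'M[int]_k.+1) (c : int), [/\ V \in unitmx, c != 0 & w = c *: row ord0 V].
Proof.
move=> w0; have [L Lu [V Vu [d _ E]]] := int_Smith_normal_form w.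
exists V, (L ord0 ord0 * d`_0); have wE : w = (L ord0 ord0 * d`_0) *: row ord0 V.
  apply/rowP => j; rewrite {1}E mxE big_ord_recl big1 ?addr0; last first.
    by move=> i _; rewrite mxE big_ord1 !mxE mulr0n mulr0 mul0r.
  by rewrite mxE big_ord1 !mxE.
by split=> //; apply: contraNneq w0 => c0; rewrite wE c0 scale0r.
Qed.

(** Once denominators are cleared, the values of H at integral vectors are natural numbers, so that
    a minimum exists. The primitive vector of which a minimal vector is a multiple is no longer than
    it. *)
Lemma shortest_vector (k : nat) (H : 'M[rat]_k.+1) : posdef H ->
  exists2 V : 'M[int]_k.+1, V \in unitmx &
    forall w : 'rV[int]_k.+1, w != 0 ->
      bil H (map_mx intr (row ord0 V)) (map_mx intr (row ord0 V)) <=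
      bil H (map_mx intr w) (map_mx intr w).
Proof.
move=> Hp; set q := fun w : 'rV[int]_k.+1 => bil H (map_mx intr w) (map_mx intr w).
have [d d0 dH] := @common_denominator ('I_k.+1 * 'I_k.+1)%type (fun ij => H ij.1 ij.2).
have qz w : exists z : int, d%:R * q w = z%:~R.
  rewrite /q /bil mxE mulr_sumr; elim/big_ind : _ => [|x y [z1 ->] [z2 ->]|j _].
  - by exists 0.
  - by exists (z1 + z2); rewrite rmorphD.
  rewrite !mxE mulr_suml mulr_sumr; elim/big_ind : _ => [|x y [z1 ->] [z2 ->]|i _].
  - by exists 0.
  - by exists (z1 + z2); rewrite rmorphD.
  have [z zE] := dH (i, j); exists (w ord0 i * z * w ord0 j).
  by rewrite !rmorphM /= -zE !mxE /=; ring.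
have d0R : 0 < d%:R :> rat by rewrite ltr0n.
have q_ge0 w : 0 <= q w by exact: posdef_ge0.
have : exists t : nat, `[< exists2 w, w != 0 & d%:R * q w = t%:R >].
  have [z zE] := qz (delta_mx ord0 ord0); exists `|z|%N; apply/asboolP.
  exists (delta_mx ord0 ord0).
    by apply/eqP => /rowP/(_ ord0); rewrite !mxE !eqxx.
  have z0 : 0 <= z by rewrite -(ler0z rat) -zE mulr_ge0// ltW.
  by rewrite zE -[in LHS](gez0_abs z0).
move=> ex; case: (ex_minnP ex) => t /asboolP[w w0 wt] tmin.
have [V [c [Vu c0 wE]]] := int_row_unimodular w0.
exists V => // w' w'0; rewrite -/(q w') -/(q (row ord0 V)).
have qw : q w <= q w'.
  have [z zE] := qz w'; have z0 : 0 <= z by rewrite -(ler0z rat) -zE mulr_ge0// ltW.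
  have /tmin tz : `[< exists2 w, w != 0 & d%:R * q w = `|z|%N%:R >].
    by apply/asboolP; exists w' => //; rewrite zE -[in LHS](gez0_abs z0).
  rewrite -(ler_pM2l d0R) wt zE -[z](gez0_abs z0) -[leRHS]/(`|z|%N%:R) ler_nat.
  exact: tz.
apply: le_trans qw; rewrite wE /q map_mxZ bilZl bilZr mulrA -expr2.
rewrite /= ler_peMl ?(q_ge0 (row ord0 V))//.
by rewrite -rmorphXn /= ler1z -gtz0_ge1 exprn_even_gt0// c0 orbT.
Qed.

Lemma intr_unitmx (k : nat) (U : 'M[int]_k) : U \in unitmx -> map_mx intr U \in @unitmx rat k.
Proof. by rewrite !unitmxE det_map_mx; exact: rmorph_unit. Qed.

Lemma intr_invmx (k : nat) (U : 'M[int]_k) : U \in unitmx ->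
  map_mx intr (invmx U) = invmx (map_mx intr U) :> 'M[rat]_k.
Proof.
move=> Uu; apply: (can_inj (mulmxK (intr_unitmx Uu))).
by rewrite -map_mxM !mulVmx ?intr_unitmx// map_mx1.
Qed.

Lemma sqr_le_quarter (s : rat) : `|s| <= 1 / 2 -> 0 <= s * s <= 1 / 4.
Proof.
rewrite ler_norml => /andP[h1 h2]; rewrite -expr2 sqr_ge0 expr2 /=.
have : 0 <= (1 / 2 - s) * (1 / 2 + s) by apply: mulr_ge0; lra.
by rewrite mulrDr !mulrBl; lra.
Qed.

(* With v the vector dual to the shortest dual vector, G splits as the direct
   sum of v and of the lattice D orthogonal to it; the dual of D is a
   projection of the dual of G, so that its minimum loses at most a factor 3/4. *)
Lemma short_basis_step (k : nat) (C mu : rat) (G : 'M[rat]_(1 + k)) :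
  0 < C -> posdef G -> 0 < mu -> mu = invmx G ord0 ord0 ->
  (forall w : 'rV[int]_(1 + k), w != 0 -> mu <= bil (invmx G) (map_mx intr w) (map_mx intr w)) ->
  (forall (D : 'M[rat]_k) (nu : rat), posdef D -> 0 < nu ->
    (forall w : 'rV[int]_k, w != 0 -> nu <= bil (invmx D) (map_mx intr w) (map_mx intr w)) ->
    exists2 U : 'M[int]_k, U \in unitmx &
      forall i, bil D (map_mx intr (row i U)) (map_mx intr (row i U)) <= C / nu) ->
  exists2 U : 'M[int]_(1 + k), U \in unitmx &
    forall i, bil G (map_mx intr (row i U)) (map_mx intr (row i U)) <= (1 + (k%:R * k%:R + 2) * C) / mu.
Proof.
move=> C0 Gp mu0 muE mu_min IH.
set a := ulsubmx G; set b := ursubmx G; set c := dlsubmx G; set D := drsubmx G.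
have GE : G = block_mx a b c D by rewrite submxK.
have cE : c = b^T by rewrite /c /b trmx_ursub Gp.1.
have bilD u v : bil D u v = bil G (row_mx 0 u) (row_mx 0 v).
  by rewrite /bil GE mul_row_block !mul0mx !add0r tr_row_mx mul_row_col trmx0 mulmx0 add0r.
have Dp : posdef D.
  split; first by rewrite /D trmx_drsub Gp.1.
  move=> v v0; rewrite bilD; apply: Gp.2; apply: contraNneq v0 => /eqP.
  by rewrite row_mx_eq0 => /andP[_].
have Gu := posdef_unit Gp; have Du := posdef_unit Dp.
have Hp := posdef_invmx Gp.
set e := row_mx 1%:M 0 : 'rV[rat]_(1 + k).
have eE t : row_mx t 0 = t ord0 ord0 *: e.
  by rewrite /e scale_row_mx scaler0 scalemx1 -mx11_scalar.
have mue : bil (invmx G) e e = mu.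
  rewrite muE /bil; have -> : e = delta_mx ord0 ord0.
    apply/rowP => j; rewrite /e; case: (split_ordP j) => j' ->.
      by rewrite row_mxEl !mxE ord1 /=.
    by rewrite row_mxEr !mxE /=.
  by rewrite -rowE trmx_delta -colE !mxE.
(* Rounding the coordinate [tau] to an integer adds at most mu / 4 to the value of the dual form,
   and the integral vector so obtained has value at least mu. Hence the dual of D has minimum at
   least 3 mu / 4. *)
have [||U' Uu' HU'] := IH D (3 / 4 * mu) Dp; first by lra.
  move=> w w0; set u := map_mx intr w; set y := u *m invmx D.
  set tau := y *m c; set v := row_mx tau u : 'rV[rat]_(1 + k).
  have vG : v *m invmx G = row_mx 0 y.
    have -> : v = row_mx 0 y *m G.
      by rewrite GE mul_row_block !mul0mx !add0r /y mulmxKV.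
    by rewrite mulmxK.
  have [t tP] := rat_round (tau ord0 ord0).
  have := mu_min (row_mx t%:M w); rewrite row_mx_eq0 (negbTE w0) andbF => /(_ isT).
  rewrite map_row_mx map_scalar_mx /= -/u.
  have -> : row_mx (t%:~R)%:M u = v + (t%:~R - tau ord0 ord0) *: e.
    rewrite /v /e scale_row_mx add_row_mx scaler0 addr0; congr row_mx.
    by rewrite {1}[tau]mx11_scalar scalemx1 -raddfD /= addrC subrK.
  have ve : bil (invmx G) v e = 0.
    by rewrite /bil vG /e tr_row_mx mul_row_col mul0mx trmx0 mulmx0 addr0 mxE.
  have vv : bil (invmx G) v v = bil (invmx D) u u.
    by rewrite {1}/bil vG /v tr_row_mx mul_row_col mul0mx add0r.
  rewrite !(bilDl, bilDr, bilZl, bilZr) (bilC e v Hp.1) ve vv mue.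
  set s := t%:~R - _ in tP *; have /andP[_ s2] := sqr_le_quarter tP.
  have : s * s * mu <= 1 / 4 * mu by apply: ler_wpM2r; first exact: ltW.
  by lra.
(* The vector (1, s0) is orthogonal to D and has square length 1 / mu. It is rounded to the integral
   vector (1, s) in the basis U', with an error whose coefficients are at most 1/2. *)
pose s0 := - b *m invmx D.
set Uq := map_mx intr U' : 'M[rat]_k.
have Uqu : Uq \in unitmx by exact: intr_unitmx.
have /choice[z zP] : forall i, exists z : int, `|z%:~R - (s0 *m invmx Uq) ord0 i| <= 1 / 2.
  by move=> i; exact: rat_round.
pose s : 'rV[int]_k := (\row_i z i) *m U'.
exists (block_mx 1%:M s 0 U'); first by rewrite unitmxE det_ublock det1 mul1r -unitmxE.
have mu_inv : 0 < mu^-1 by rewrite invr_gt0.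
have CC i : bil D (map_mx intr (row i U')) (map_mx intr (row i U')) <= 4 / 3 * C / mu.
  by apply: le_trans (HU' i) _; rewrite invfM invf_div; lra.
have kk : 0 <= k%:R * k%:R * C / mu by rewrite !mulr_ge0// ltW.
have CC0 : 0 < C / mu by rewrite divr_gt0.
move=> i; case: (split_ordP i) => j ->; last first.
  rewrite /block_mx rowKd row_row_mx row0 map_row_mx raddf0 -bilD.
  by apply: le_trans (CC j) _; lra.
rewrite /block_mx rowKu row_row_mx map_row_mx ord1 row1 !row_id.
have -> : map_mx intr (delta_mx 0 0) = 1%:M :> 'M[rat]_1.
  by apply/matrixP => x y; rewrite !ord1 !mxE.
set sq := map_mx intr s; set d := sq - s0.
have -> : row_mx 1%:M sq = row_mx 1%:M s0 + row_mx 0 d :> 'rV[rat]_(1 + k).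
  by rewrite add_row_mx addr0 /d addrC subrK.
set al := a + s0 *m c.
have v0G : row_mx 1%:M s0 *m G = row_mx al 0.
  rewrite GE mul_row_block !mul1mx; congr row_mx.
  by rewrite /s0 mulmxKV// subrr.
have alE : al ord0 ord0 * mu = 1.
  have : bil (invmx G) (row_mx al 0) e = 1.
    rewrite -v0G /bil mulmxK// /e tr_row_mx mul_row_col trmx1 mulmx1 trmx0 mulmx0 addr0.
    by rewrite mxE.
  by rewrite eE bilZl mue.
have alV : al ord0 ord0 = mu^-1 by apply: (mulIf (lt0r_neq0 mu0)); rewrite alE mulVf// gt_eqF.
have b00 : bil G (row_mx 1%:M s0) (row_mx 1%:M s0) = mu^-1.
  by rewrite /bil v0G tr_row_mx mul_row_col mul0mx addr0 trmx1 mulmx1.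
have b0d : bil G (row_mx 1%:M s0) (row_mx 0 d) = 0.
  by rewrite /bil v0G tr_row_mx mul_row_col mul0mx addr0 trmx0 mulmx0 mxE.
rewrite !(bilDl, bilDr) (bilC (row_mx 0 d) _ Gp.1) b00 b0d -bilD.
pose q i := (z i)%:~R - (s0 *m invmx Uq) ord0 i.
have dE : d = \sum_i q i *: row i Uq.
  rewrite /d /sq /s map_mxM -/Uq -[s0](mulmxKV Uqu) -mulmxBl mulmx_sum_row.
  apply: eq_bigr => i' _; congr (_ *: _).
  by rewrite /q !mxE.
have dle : bil D d d <= k%:R * (k%:R * (1 / 4 * (4 / 3 * C / mu))).
  rewrite dE; apply: le_trans (bil_sum_le _ Dp) _.
  rewrite card_ord ler_wpM2l//.
  apply: (@le_trans _ _ (\sum_(i < k) (1 / 4 * (4 / 3 * C / mu)))); last first.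
    by rewrite sumr_const card_ord -[X in X <= _]mulr_natl.
  apply: ler_sum => i' _; rewrite bilZl bilZr mulrA.
  have /andP[q3 q4] := sqr_le_quarter (zP i'). apply: ler_pM => //; first exact: posdef_ge0.
  by rewrite /Uq -map_row.
by lra.
Qed.

Lemma short_basis (k : nat) : exists2 C : rat, 0 < C &
  forall (G : 'M[rat]_k) (nu : rat), posdef G -> 0 < nu ->
  (forall w : 'rV[int]_k, w != 0 -> nu <= bil (invmx G) (map_mx intr w) (map_mx intr w)) ->
  exists2 U : 'M[int]_k, U \in unitmx &
    forall i, bil G (map_mx intr (row i U)) (map_mx intr (row i U)) <= C / nu.
Proof.
elim: k => [|k [C C0 IH]].
  by exists 1 => // G nu _ _ _; exists 1%:M; rewrite ?unitmx1// => -[].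
have C10 : 0 < 1 + (k%:R * k%:R + 2) * C.
  by rewrite ltr_wpDr// mulr_ge0 ?(ltW C0)// addr_ge0// mulr_ge0.
(* The rounded vector has square length at most 1 / mu + k^2 (1/4) (4/3) C / mu, the basis vectors
   of D at most (4/3) C / mu; the constant covers both. *)
exists (1 + (k%:R * k%:R + 2) * C) => //.
move=> G nu Gp nu0 Gnu.
have [V Vu Vmin] := shortest_vector (posdef_invmx Gp).
set R := map_mx intr V : 'M[rat]_k.+1.
have Ru : R \in unitmx by exact: intr_unitmx.
have Gu := posdef_unit Gp.
(* In this basis the dual form takes its minimum at the first unit vector, as [short_basis_step]
   requires. *)
set W := (invmx R)^T.
have Wu : W \in unitmx by rewrite unitmx_tr unitmx_inv.
set G1 := W *m G *m W^T.
have G1p : posdef G1.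
  split; first by rewrite /G1 !trmx_mul trmxK Gp.1 mulmxA.
  move=> v v0; rewrite /bil bil_mul; apply: Gp.2; apply: contraNneq v0 => H.
  by rewrite -(mulmxK Wu v) H mul0mx.
have G1V : invmx G1 = R *m invmx G *m R^T.
  apply: (can_inj (mulmxK (posdef_unit G1p))); rewrite mulVmx ?posdef_unit//.
  rewrite /G1 /W trmxK -!mulmxA [R^T *m _]mulmxA -trmx_mul mulVmx// trmx1 mul1mx.
  by rewrite [invmx G *m _]mulmxA mulVmx// mul1mx mulmxV.
set mu := invmx G1 ord0 ord0.
have bilG1 w : bil (invmx G1) (map_mx intr w) (map_mx intr w) =
    bil (invmx G) (map_mx intr (w *m V)) (map_mx intr (w *m V)).
  by rewrite G1V /bil bil_mul -map_mxM.
have muE : mu = bil (invmx G) (map_mx intr (row ord0 V)) (map_mx intr (row ord0 V)).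
  rewrite rowE -bilG1 /bil; have -> : map_mx intr (delta_mx ord0 ord0) = delta_mx ord0 ord0 :> 'rV[rat]_k.+1.
    by apply/rowP => j; rewrite !mxE; case: (_ && _).
  by rewrite -rowE trmx_delta -colE !mxE.
have mu_min w : w != 0 :> 'rV[int]_k.+1 -> mu <= bil (invmx G1) (map_mx intr w) (map_mx intr w).
  move=> w0; rewrite muE bilG1; apply: Vmin.
  by apply: contraNneq w0 => H; rewrite -(mulmxK Vu w) H mul0mx.
have nu_mu : nu <= mu.
  rewrite muE; apply: Gnu; apply/eqP => r0; move: Vu; rewrite unitmxE.
  suff -> : \det V = 0 by rewrite unitr0.
  rewrite (expand_det_row V ord0) big1// => j _.
  by have /rowP/(_ j) := r0; rewrite !mxE => ->; rewrite mul0r.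
have mu0 : 0 < mu by apply: lt_le_trans nu_mu.
have WE : W = map_mx intr (invmx V)^T by rewrite /W /R -intr_invmx// map_trmx.
have [U Uu HU] := @short_basis_step k C mu G1 C0 G1p mu0 erefl mu_min IH.
exists (U *m (invmx V)^T); first by rewrite unitmx_mul Uu unitmx_tr unitmx_inv.
move=> i; rewrite row_mul map_mxM -WE -bil_mul; apply: le_trans (HU i) _.
apply: ler_wpM2l; first exact: ltW.
by rewrite lef_pV2 ?posrE.
Qed.

Definition dot (R : comNzRingType) (m : nat) (v w : 'rV[R]_m) : R := (v *m w^T) ord0 ord0.

(** The partial application [lat x y] is the lattice itself as a predicate, and equality of lattices
    is equality of these predicates. *)
Definition lat (m : nat) (x : int) (y z : 'rV[int]_m) : Prop :=
  exists (l : int) (u : 'rV[int]_m), z = l *: y + x *: u.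

(** Smith normal form of the matrix with rows y and x I, whose rows span the lattice. The rows of N
    express the vectors x e_i in the basis B. *)
Lemma lat_basis (m : nat) (x : int) (y : 'rV[int]_m) : x != 0 ->
  exists (B N : 'M[int]_m) (q : 'rV[int]_m),
    [/\ N *m B = x%:M, forall k : 'rV[int]_m, lat x y (k *m B) & y = q *m B].
Proof.
move=> x0; set M := col_mx y x%:M : 'M[int]_(1 + m, m).
have [L Lu [V Vu [d _ E]]] := int_Smith_normal_form M.
pose S : 'M[int]_(1 + m, m) := \matrix_(i, j) (i == j :> nat)%:R.
pose D : 'M[int]_m := \matrix_(i, j) (d`_i *+ (i == j :> nat)).
pose B := D *m V; exists B, (dsubmx (L *m S)), (usubmx (L *m S)).
have MB : M = L *m S *m B.
  rewrite {1}E /B mulmxA; congr (_ *m _); rewrite -mulmxA; congr (_ *m _).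
  apply/matrixP => i j; rewrite !mxE (bigD1 j) //= big1 => [|l lj]; last first.
    rewrite !mxE; have -> : (l == j :> nat) = false by apply/negbTE; rewrite val_eqE.
    by rewrite mulr0n mulr0.
  by rewrite !mxE eqxx addr0; case: eqP => [->|]; rewrite ?mul1r ?mul0r ?mulr1n ?mulr0n.
have SS : S^T *m S = 1%:M.
  apply/matrixP => i j; have li : (i < 1 + m)%N by rewrite add1n ltnW ?ltnS.
  rewrite !mxE (bigD1 (Ordinal li)) //= big1 => [|l lj]; last first.
    rewrite !mxE; have -> : (l == i :> nat) = false by apply/negbTE; rewrite -(val_eqE l (Ordinal li)) in lj.
    by rewrite mul0r.
  by rewrite !mxE eqxx mul1r addr0.
split.
- by rewrite mul_dsub_mx -MB col_mxKd.
- move=> k; have -> : k *m B = (k *m S^T *m invmx L) *m M.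
    by rewrite MB -!mulmxA (mulKmx Lu) [S^T *m _]mulmxA SS mul1mx.
  set r := k *m _ *m _; exists (lsubmx r ord0 ord0), (rsubmx r).
  rewrite -[r in LHS]hsubmxK mul_row_col mul_mx_scalar; congr (_ + _).
  by rewrite {1}[lsubmx r]mx11_scalar mul_scalar_mx.
- by rewrite mul_usub_mx -MB col_mxKu.
Qed.

Lemma bil_gram (m : nat) (B : 'M[rat]_m) (u : 'rV[rat]_m) :
  bil (B *m B^T) u u = \sum_j (u *m B) ord0 j ^+ 2.
Proof.
rewrite /bil mulmxA -[_ *m B^T *m _]mulmxA -trmx_mul mxE.
by apply: eq_bigr => j _; rewrite [X in _ * X]mxE expr2.
Qed.

(** [short_basis] for the Gram matrix of a lattice basis B. A dual vector multiplied by x is an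
    integral vector w N^T whose product with y is divisible by x, so that the hypothesis bounds the
    dual minimum from below. *)
Lemma lat_short_basis (m : nat) : exists2 C : nat, (0 < C)%N &
  forall (x : int) (y : 'rV[int]_m) (b mu : nat), x != 0 -> (0 < b)%N -> (0 < mu)%N ->
  (forall w : 'rV[int]_m, w != 0 -> (x %| dot w y)%Z ->
     exists i, (C * mu * `|x| < b * `|w ord0 i|)%N) ->
  exists E N : 'M[int]_m, [/\ forall k : 'rV[int]_m, lat x y (k *m E), N *m E = x%:M &
    forall i j, (`|E i j| * mu <= b)%N].
Proof.
have [C C0 short] := short_basis m.
exists (Num.bound C).+1 => // x y b mu x0 b0 mu0 nobad; set K := (Num.bound C).+1 in nobad.
have KC : C <= (K ^ 2)%:R :> rat.
  apply: le_trans (ltW (archi_boundP (ltW C0))) _.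
  by rewrite ler_nat (leq_trans (leqnSn _))// -[X in (X <= _)%N]expn1 leq_pexp2l.
have [B [N [q [NB Blat yq]]]] := lat_basis y x0.
set Bq := map_mx intr B : 'M[rat]_m; set Nq := map_mx intr N : 'M[rat]_m.
have xq : x%:~R != 0 :> rat by rewrite intr_eq0.
have NBq : Nq *m Bq = (x%:~R)%:M by rewrite -map_mxM NB map_scalar_mx.
have Bu : Bq \in unitmx.
  have := congr1 determinant NBq; rewrite det_mulmx det_scalar => H.
  rewrite unitmxE unitfE; apply/eqP => dB; move/eqP: H.
  by rewrite dB mulr0 eq_sym expf_eq0 (negbTE xq) andbF.
have BNq : Bq *m Nq = (x%:~R)%:M.
  apply: (can_inj (mulmxK Bu)); rewrite -mulmxA NBq mul_mx_scalar mul_scalar_mx//.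
have BN : B *m N = x%:M.
  have /matrixP H : map_mx intr (B *m N) = map_mx intr x%:M :> 'M[rat]_m.
    by rewrite map_mxM /= BNq map_scalar_mx.
  by apply/matrixP => i j; have := H i j; rewrite [LHS]mxE [RHS]mxE => /intr_inj.
set G := Bq *m Bq^T.
have Gp : posdef G.
  split=> [|v v0]; first by rewrite /G trmx_mul trmxK.
  rewrite /G bil_gram lt_def sumr_ge0 ?andbT; last by move=> j _; rewrite sqr_ge0.
  apply: contraNneq v0 => /eqP; rewrite psumr_eq0 => [/allP H|j _]; last exact: sqr_ge0.
  rewrite -(mulmxK Bu v); suff -> : v *m Bq = 0 by rewrite mul0mx.
  by apply/rowP => j; have := H j (mem_index_enum _); rewrite sqrf_eq0 [RHS]mxE => /eqP.
(* The square of the lower bound for the dual vectors; C <= K^2 makes C / nu at most (b / mu)^2. *)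
pose nu : rat := (K%:R * mu%:R / b%:R) ^+ 2.
have r0 : 0 < K%:R * mu%:R / b%:R :> rat by rewrite divr_gt0 ?mulr_gt0 ?ltr0n.
have nu0 : 0 < nu by rewrite exprn_gt0.
have [|U Uu HU] := short G nu Gp nu0.
  move=> w w0; set wq := map_mx intr w; set u := wq *m invmx G *m Bq.
  have uE : bil (invmx G) wq wq = \sum_j u ord0 j ^+ 2.
    rewrite -bil_gram -/G -(bil_invmx _ _ Gp) (mulmxKV (posdef_unit Gp)).
    by congr (bil _ _ _).
  set om := w *m N^T.
  have omE : map_mx intr om = x%:~R *: u :> 'rV[rat]_m.
    have -> : u = wq *m (invmx Bq)^T.
      rewrite -[(invmx Bq)^T](mulKmx (posdef_unit Gp)) /u -mulmxA; congr (_ *m (_ *m _)).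
      by rewrite /G -mulmxA -trmx_mul mulVmx// trmx1 mulmx1.
    rewrite /om map_mxM -map_trmx -/Nq.
    have -> : Nq = x%:~R *: invmx Bq.
      by apply: (can_inj (mulmxK Bu)); rewrite NBq -scalemxAl mulVmx// scalemx1.
    by rewrite linearZ -scalemxAr.
  have [||i Hi] := nobad om.
  - apply: contraNneq w0 => om0; have := congr1 (mulmx^~ B^T) om0.
    rewrite /om -mulmxA -trmx_mul BN tr_scalar_mx mul_mx_scalar mul0mx => /rowP H.
    apply/eqP/rowP => j; have := H j; rewrite !mxE => /eqP.
    by rewrite mulf_eq0 (negbTE x0) => /eqP.
  - rewrite /dot /om yq trmx_mul mulmxA -[w *m N^T *m _]mulmxA -trmx_mul BN tr_scalar_mx.
    by rewrite mul_mx_scalar -scalemxAl mxE dvdz_mulr.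
  rewrite uE (bigD1 i) //= ler_wpDr//.
    by rewrite sumr_ge0// => j _; rewrite sqr_ge0.
  rewrite /nu -[leRHS](real_normK (num_real _)) ler_sqr ?nnegrE ?normr_ge0 ?ltW//.
  rewrite ltr_pdivrMr ?ltr0n//.
  have /rowP/(_ i) := omE; rewrite [LHS]mxE [RHS]mxE => oi.
  have : `|(om ord0 i)%:~R| = `|x%:~R| * `|u ord0 i| :> rat by rewrite oi normrM.
  have xp : 0 < `|x%:~R| :> rat by rewrite normr_gt0.
  rewrite -!intr_norm -!abszE => oi'.
  rewrite -(ltr_pM2l xp) -intr_norm -abszE [ltRHS]mulrA -oi'.
  by rewrite -[(`|x|%N)%:~R]/(`|x|%N%:R) -[(`|om ord0 i|%N)%:~R]/(`|om ord0 i|%N%:R) -!natrM ltr_nat mulnC [X in (_ < X)%N]mulnC.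
exists (U *m B), (N *m invmx U); split.
- by move=> k; rewrite mulmxA; apply: Blat.
- by rewrite mulmxA -[N *m _ *m U]mulmxA mulVmx// mulmx1 NB.
move=> i j; rewrite -(ler_nat rat) natrM -ler_pdivlMr ?ltr0n//.
have := HU i; rewrite /G bil_gram -map_mxM -row_mul => H.
have {}H : (`|(U *m B) i j|%N)%:R ^+ 2 <= (b%:R / mu%:R) ^+ 2 :> rat.
  apply: (@le_trans _ _ (C / nu)).
    apply: le_trans H; rewrite (bigD1 j) //= ler_wpDr//.
      by rewrite sumr_ge0// => l _; rewrite sqr_ge0.
    by rewrite !mxE natr_absz intr_norm (real_normK (num_real _)).
  rewrite ler_pdivrMr// /nu -exprMn.
  have -> : b%:R / mu%:R * (K%:R * mu%:R / b%:R) = K%:R :> rat.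
    by field; rewrite !pnatr_eq0 -!lt0n b0 mu0.
  by rewrite -natrX.
by rewrite -ler_sqr ?nnegrE ?divr_ge0.
Qed.

(** * The quadratic form *)

Section QuadraticForm.
Variables (m : nat) (Q0 : {mpoly int[m]}).
Hypothesis Q0_homog : Q0 \is 2.-homog.

(** The matrix of 2 Q0, which is integral, unlike [qf_matrix]. The vector y S, with S this matrix,
    is the gradient of Q0 at y. *)
Definition quad_mx : 'M[int]_m :=
  \matrix_(i, j) (if i == j then 2 * Q0@_(U_(i) + U_(i))%MM else Q0@_(U_(i) + U_(j))%MM).

Lemma quad_mx_sym : quad_mx^T = quad_mx.
Proof.
by apply/matrixP => i j; rewrite !mxE eq_sym; case: eqP => [->//|_]; rewrite addmC.
Qed.

Lemma mnm1D_eq (a b i j : 'I_m) : (U_(a) + U_(b) == U_(i) + U_(j))%MM =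
  ((a == i) && (b == j)) || ((a == j) && (b == i)).
Proof.
apply/eqP/orP => [E|[|]/andP[/eqP-> /eqP->]]; [|by []|exact: addmC].
have [ai|ai] := eqVneq a i.
  left; move: E; rewrite ai => /addmI/eqP.
  by rewrite eq_mnm1.
have [aj|aj] := eqVneq a j.
  right; move: E; rewrite aj [in RHS]addmC => /addmI/eqP.
  by rewrite eq_mnm1.
move/mnmP/(_ a): E; rewrite !mnmDE !mnm1E eqxx.
by rewrite ![_ == a]eq_sym (negbTE ai) (negbTE aj) addn0; case: (a == b).
Qed.

Lemma quad_mxE : Q0 + Q0 = \sum_i \sum_j (quad_mx i j)%:MP * 'X_i * 'X_j.
Proof.
apply/mpolyP => mu; rewrite mcoeffD raddf_sum /=.
under eq_bigr => i _.
  rewrite raddf_sum; under eq_bigr => j _ do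
    rewrite -mulrA -mpolyXD mul_mpolyC /= mcoeffZ mcoeffX.
  over.
have [mu2|mu2] := eqVneq (mdeg mu) 2%N; last first.
  rewrite (dhomog_nemf_coeff Q0_homog mu2) addr0 big1// => i _; rewrite big1// => j _.
  case: eqP => [E|_]; last by rewrite mulr0.
  by move: mu2; rewrite -E mdegD !mdeg1 eqxx.
have [a [b ->]] : exists a b, mu = (U_(a) + U_(b))%MM.
  have /existsP[a mua] : [exists a, mu a != 0%N].
    apply: contraT => /existsPn H; move: mu2; rewrite mdegE big1// => i _.
    by apply/eqP; move: (H i); rewrite negbK.
  have le : (U_(a) <= mu)%MM by rewrite lep1mP.
  have /mdeg1P[b /eqP bE] : mdeg (mu - U_(a))%MM == 1%N.
    by have := mdegD (mu - U_(a))%MM U_(a)%MM; rewrite submK// mu2 mdeg1 addn1 => -[<-].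
  by exists b, a; rewrite -bE submK.
under eq_bigr => i _ do under eq_bigr => j _ do rewrite mnm1D_eq.
rewrite (bigD1 a) //= (bigD1 b) //= !eqxx /= mulr1.
have [ab|ab] := eqVneq a b.
  rewrite -ab mxE eqxx big1 => [|j ja]; last by rewrite (negbTE ja) /= mulr0.
  rewrite addr0 big1 ?addr0 => [|i ia]; first by rewrite mulrDl !mul1r.
  by rewrite big1// => j _; rewrite (negbTE ia) /= mulr0.
rewrite big1 => [|j jb]; last by rewrite (negbTE jb) mulr0.
rewrite (bigD1 b) 1?eq_sym//= (bigD1 a) //= !eqxx orbT mulr1.
rewrite big1 => [|j ja]; last by rewrite (negbTE ja) (negbTE ab) mulr0.
rewrite big1 => [|i /andP[ia ib]]; last first.
  by rewrite big1// => j _; rewrite (negbTE ia) (negbTE ib) mulr0.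
by rewrite !addr0 !mxE [b == a]eq_sym (negbTE ab) [(U_(b) + _)%MM]addmC.
Qed.

Section Values.
Variable R : numDomainType.
Implicit Types v w : 'rV[R]_m.

Definition qval v : R := evz Q0 (v ord0).

Definition bq v w : R := (v *m map_mx intr quad_mx *m w^T) ord0 ord0.

Lemma qval2 v : qval v + qval v = bq v v.
Proof.
set phi : {rmorphism {mpoly int[m]} -> R} := mmap intr (v ord0).
have -> : qval v + qval v = phi (Q0 + Q0) by rewrite rmorphD.
rewrite quad_mxE rmorph_sum /bq -mulmxA mxE; apply: eq_bigr => i _.
rewrite rmorph_sum !mxE mulr_sumr; apply: eq_bigr => j _.
by rewrite !rmorphM /= mmapC !mmapX !mmap1U !mxE; ring.
Qed.

Lemma bqDl u v w : bq (u + v) w = bq u w + bq v w.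
Proof. by rewrite /bq !mulmxDl mxE. Qed.

Lemma bqDr u v w : bq u (v + w) = bq u v + bq u w.
Proof. by rewrite /bq linearD mulmxDr mxE. Qed.

Lemma bqZl c u v : bq (c *: u) v = c * bq u v.
Proof. by rewrite /bq -!scalemxAl mxE. Qed.

Lemma bqZr c u v : bq u (c *: v) = c * bq u v.
Proof. by rewrite /bq linearZ -scalemxAr mxE. Qed.

Lemma bqC u v : bq u v = bq v u.
Proof.
rewrite /bq; set A := map_mx _ _.
have -> : (u *m A *m v^T) ord0 ord0 = (u *m A *m v^T)^T ord0 ord0 by rewrite [RHS]mxE.
by rewrite !trmx_mul trmxK /A map_trmx quad_mx_sym mulmxA.
Qed.

(** Compared after doubling, where everything is expressed by the symmetric matrix; 2 can be
    cancelled in a [numDomainType]. *)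
Lemma qvalD v w : qval (v + w) = qval v + qval w + bq v w.
Proof.
have : (qval (v + w)) *+ 2 = (qval v + qval w + bq v w) *+ 2.
  rewrite !mulr2n qval2 !(bqDl, bqDr) -!qval2 [bq w v]bqC; ring.
by move/eqP; rewrite eqrMn2r //= => /eqP.
Qed.

Lemma qvalZ c v : qval (c *: v) = c ^+ 2 * qval v.
Proof.
rewrite /qval -(evz_homog_scale _ _ Q0_homog); apply: eq_evz => i.
by rewrite mxE.
Qed.

End Values.

Lemma qval_dvd (x : int) (v w : 'rV[int]_m) :
  (forall i, (x %| v ord0 i - w ord0 i)%Z) -> (x %| qval v)%Z = (x %| qval w)%Z.
Proof.
move=> /(evz_dvd Q0) H; rewrite -[qval v](subrK (qval w)).
by rewrite rpredDl.
Qed.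

Lemma qval_bound (X : nat) (v : 'rV[int]_m) : (0 < X)%N ->
  (forall i, (`|v ord0 i| <= X)%N) -> (`|qval v| <= mnorm Q0 * X ^ msize Q0)%N.
Proof. by move=> X0 vX; apply: evz_bound. Qed.

Lemma bq_int (v w : 'rV[int]_m) : bq v w = dot (v *m quad_mx) w.
Proof.
by rewrite /bq /dot; congr ((_ *m _ *m _) _ _); apply/matrixP => i j; rewrite mxE intz.
Qed.

Lemma qf_rankE : qf_rank Q0 = \rank (map_mx intr quad_mx : 'M[rat]_m).
Proof.
have -> : map_mx intr quad_mx = 2 *: qf_matrix Q0 :> 'M[rat]_m.
  apply/matrixP => i j; rewrite !mxE; case: eqP => _; first by rewrite rmorphM.
  by rewrite mulrC divfK.
by rewrite mxrank_scale_nz.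
Qed.

(* w_i0 times the projection along the i0-th axis to the hyperplane w . y = 0. *)
Definition hyp_proj (i0 : 'I_m) (w y : 'rV[int]_m) : 'rV[int]_m :=
  w ord0 i0 *: y - dot w y *: delta_mx ord0 i0.

Definition hyp_poly (i0 : 'I_m) (w : 'rV[int]_m) : {mpoly int[m]} :=
  evz Q0 (fun i => (w ord0 i0)%:MP * 'X_i - (i == i0)%:R * \sum_j (w ord0 j)%:MP * 'X_j).

Lemma hyp_polyE (i0 : 'I_m) (w y : 'rV[int]_m) :
  (hyp_poly i0 w).@[y ord0] = qval (hyp_proj i0 w y).
Proof.
rewrite /hyp_poly /qval (evz_morph (meval (y ord0))); apply: eq_evz => i /=.
rewrite mevalB !mevalM mevalC mevalXU !mxE eqxx /= rmorph_nat rmorph_sum /= mulrC [RHS]addrC.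
rewrite [RHS]addrC mulrC; congr (_ - _); rewrite mulrC; congr (_ * _).
by rewrite /dot mxE; apply: eq_bigr => j _; rewrite mevalM mevalC mevalXU mxE.
Qed.

Lemma msize_hyp_poly (i0 : 'I_m) (w : 'rV[int]_m) : (msize (hyp_poly i0 w) <= (msize Q0).+1)%N.
Proof.
rewrite -[msize Q0]muln1; apply: msize_evz => i.
have lin (c : int) j : (msize (c%:MP * 'X_j : {mpoly int[m]}) <= 2)%N.
  by rewrite mul_mpolyC (leq_trans (mmeasureZ_le _ _ _))// msizeX mdeg1.
apply: leq_trans (mmeasureD_le _ _ _) _; rewrite geq_max lin mmeasureN /=.
rewrite -mpolyC_nat mul_mpolyC (leq_trans (mmeasureZ_le _ _ _))//.
by apply: leq_trans (mmeasure_sum _ _ _ _) _; apply/bigmax_leqP.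
Qed.

Hypothesis Q0_rank : (3 <= qf_rank Q0)%N.

(* A form of rank at least 3 does not vanish identically on a hyperplane. *)
Lemma hyp_poly_neq0 (i0 : 'I_m) (w : 'rV[int]_m) : w ord0 i0 != 0 -> hyp_poly i0 w != 0.
Proof.
move=> w0; apply: contraTneq Q0_rank => P0.
have q0 y : qval (hyp_proj i0 w y) = 0 by rewrite -hyp_polyE P0 meval0.
set S := map_mx intr quad_mx : 'M[rat]_m; set wq := map_mx intr w : 'rV[rat]_m.
set d := delta_mx ord0 i0 : 'rV[rat]_m.
set A := (w ord0 i0)%:~R%:M - wq^T *m d : 'M[rat]_m.
have rowA i : row i A = map_mx intr (hyp_proj i0 w (delta_mx ord0 i)).
  rewrite rowE /A mulmxBr mul_mx_scalar mulmxA /hyp_proj map_mxB !map_mxZ /= !map_delta_mx.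
  congr (_ - _); rewrite [_ *m wq^T]mx11_scalar mul_scalar_mx; congr (_ *: _).
  by rewrite -rowE mxE !mxE /dot trmx_delta -colE !mxE.
have projD y z : hyp_proj i0 w (y + z) = hyp_proj i0 w y + hyp_proj i0 w z.
  rewrite /hyp_proj; have -> : dot w (y + z) = dot w y + dot w z by rewrite /dot [(_ + _)^T]linearD mulmxDr mxE.
  by rewrite scalerDr scalerDl opprD addrACA.
have b0 y z : bq (hyp_proj i0 w y) (hyp_proj i0 w z) = 0.
  by have := q0 (y + z); rewrite projD qvalD !q0 !add0r.
(* If Q0 vanishes on the projections, which are the combinations of the rows of A, so does its polar
   form. As A is a scalar minus a matrix of rank one, w_i0^2 S is then a sum of two matrices of rank
   at most one. *)
have ASA : A *m S *m A^T = 0.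
  apply/matrixP => i j; rewrite [RHS]mxE.
  have -> : (A *m S *m A^T) i j = (row i A *m S *m (row j A)^T) ord0 ord0.
    rewrite tr_row -row_mul [LHS]mxE [RHS]mxE; apply: eq_bigr => k _.
    by rewrite [in RHS]mxE [X in _ = _ * X]mxE.
  rewrite !rowA map_trmx -!map_mxM mxE.
  have := b0 (delta_mx ord0 i) (delta_mx ord0 j); rewrite bq_int /dot => ->.
  by rewrite rmorph0.
have wS : (w ord0 i0)%:~R ^+ 2 *: S = (wq^T *m d *m S) *m ((w ord0 i0)%:~R%:M) + (A *m S *m d^T) *m wq.
  have AE : A + wq^T *m d = (w ord0 i0)%:~R%:M by rewrite subrK.
  have AtE : A^T = (w ord0 i0)%:~R%:M - d^T *m wq.
    by rewrite /A linearB /= tr_scalar_mx trmx_mul trmxK.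
  have : A *m S *m A^T = 0 := ASA.
  rewrite AtE mulmxBr => /eqP; rewrite subr_eq0 => /eqP E.
  rewrite -[A *m S *m d^T *m wq]mulmxA -E -mulmxDl -mulmxDl [_ + A]addrC AE.
  by rewrite mul_scalar_mx mul_mx_scalar scalerA expr2.
have w2 : (w ord0 i0)%:~R ^+ 2 != 0 :> rat by rewrite expf_neq0// intr_eq0.
rewrite -ltnNge ltnS qf_rankE -/S -(mxrank_scale_nz _ w2) wS.
apply: leq_trans (mxrank_add _ _) _; rewrite -[2%N]/(1 + 1)%N leq_add//.
  apply: leq_trans (mxrankM_maxl _ _) _; apply: leq_trans (mxrankM_maxl _ _) _.
  exact: leq_trans (mxrankM_maxl _ _) (rank_leq_col _).
exact: leq_trans (mxrankM_maxr _ _) (rank_leq_row _).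
Qed.

(* Two independent columns of the matrix, in echelon form. *)
Lemma quad_mx_minor : exists (i j : 'I_m) (c : 'rV[int]_m),
  [/\ quad_mx i j != 0, c ord0 i = 0, c != 0 &
      forall (p : int) (y : 'rV[int]_m), (forall l, (p %| (y *m quad_mx) ord0 l)%Z) ->
        (p %| dot y c)%Z].
Proof.
set S := quad_mx.
have [i [j Sij]] : exists i j, S i j != 0.
  apply: contrapT => no; move: Q0_rank; rewrite qf_rankE.
  have -> : map_mx intr quad_mx = 0 :> 'M[rat]_m; last by rewrite mxrank0.
  apply/matrixP => i j; rewrite [LHS]mxE [RHS]mxE; apply/eqP; rewrite intr_eq0.
  by apply/negP => /negP Sij; apply: no; exists i, j.
(* The column l, cleared at the entry i by means of the column j. If all of these vanish, S is up to
   a scalar a column times a row. *)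
pose c l : 'rV[int]_m := \row_k (S i j * S k l - S i l * S k j).
have [[l cl]|no] := pselect (exists l, c l != 0).
  exists i, j, (c l); split=> //; first by rewrite mxE mulrC subrr.
  move=> p y py.
  have -> : dot y (c l) = S i j * (y *m S) ord0 l - S i l * (y *m S) ord0 j.
    rewrite /dot [LHS]mxE [(y *m S) _ l]mxE [(y *m S) _ j]mxE !mulr_sumr -sumrB; apply: eq_bigr => k _.
    rewrite [(c l)^T _ _]mxE [c l _ _]mxE.
    by move: (y _ _) (S i j) (S k l) (S i l) (S k j) => u1 u2 u3 u4 u5; ring.
  by rewrite rpredB// dvdz_mull.
exfalso; move: Q0_rank; rewrite qf_rankE leqNgt => /negP; apply.
have Sq : (S i j)%:~R != 0 :> rat by rewrite intr_eq0.
rewrite -(mxrank_scale_nz _ Sq).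
have -> : (S i j)%:~R *: map_mx intr S = map_mx intr (col j S) *m map_mx intr (row i S) :> 'M[rat]_m.
  rewrite -map_mxM; apply/matrixP => k l; rewrite !mxE big_ord1 !mxE -rmorphM /=.
  have /eqP cl0 : c l == 0 by apply/negP => /negP cl; apply: no; exists l.
  have /rowP/(_ k) := cl0; rewrite /c !mxE => /eqP; rewrite subr_eq0 => /eqP.
  by rewrite -!/(S _ _) => ->; congr intr; rewrite mulrC.
apply: (@leq_ltn_trans 1%N) => //.
exact: leq_trans (mxrankM_maxl _ _) (rank_leq_col _).
Qed.

End QuadraticForm.

(** * Lattices with a short dual vector *)

Lemma atmost_divisors (T : nat) (q : int) : q != 0 -> (size (divisors `|q|) <= T)%N ->
  atmost (fun d : int => (d %| q)%Z) (2 * T%:R).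
Proof.
move=> q0 qT; pose l := map Posz (divisors `|q|) ++ map (fun d => - Posz d) (divisors `|q|).
apply: (atmost_sub _ (@atmost_seq _ l)).
  move=> d dq; rewrite mem_cat; have dd : `|d|%N \in divisors `|q| by rewrite -dvdn_divisors ?absz_gt0.
  apply/orP; have [d0|d0] := leP 0 d; [left|right]; apply/mapP; exists `|d|%N => //; lia.
by rewrite size_cat !size_map -natrM ler_nat; lia.
Qed.

Definition upd (m : nat) (y : 'rV[int]_m) (i : 'I_m) (c : int) : 'rV[int]_m :=
  \row_j (if j == i then c else y ord0 j).

Lemma dotE (m : nat) (v w : 'rV[int]_m) : dot v w = \sum_i v ord0 i * w ord0 i.
Proof. by rewrite /dot mxE; apply: eq_bigr => i _; rewrite mxE. Qed.

Lemma dot_upd (m : nat) (w y : 'rV[int]_m) (i : 'I_m) (c : int) :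
  dot w (upd y i c) = dot w y + w ord0 i * (c - y ord0 i).
Proof.
rewrite !dotE (bigD1 i) //= [in RHS](bigD1 i) //= mxE eqxx.
rewrite (eq_bigr (fun j => w ord0 j * y ord0 j)) => [|j ji]; first by ring.
by rewrite mxE (negbTE ji).
Qed.

(** The projection is along the axis i, so that the entry y_i can be erased or overwritten without
    changing the value of Q0 at the projection. *)
Lemma hyp_proj_upd (m : nat) (i : 'I_m) (w y : 'rV[int]_m) (c : int) :
  hyp_proj i w (upd y i c) = hyp_proj i w y.
Proof.
apply/rowP => j; rewrite /hyp_proj dot_upd !mxE eqxx /=.
by case: eqP => [->|_] /=; ring.
Qed.

Lemma dot_bound (m X b : nat) (w y : 'rV[int]_m) : (forall i, (`|w ord0 i| <= X)%N) ->
  (forall i, (`|y ord0 i| <= b)%N) -> (`|dot w y| <= m * (X * b))%N.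
Proof.
move=> wX yb; rewrite dotE; apply: (@leq_trans (\sum_(i < m) X * b)%N); last first.
  by rewrite sum_nat_const card_ord.
elim/big_rec2 : _ => [//|i s t _ H]; apply: leq_trans (abszD_le _ _) _.
by rewrite leq_add// abszM leq_mul.
Qed.

Lemma prod_two (m : nat) (i0 i1 : 'I_m) (a c e : rat) : i0 != i1 -> e != 0 ->
  \prod_i (if i == i0 then a else if i == i1 then c else e) = a * c * (e ^+ m / e ^+ 2).
Proof.
move=> i01 e0.
rewrite (eq_bigr (fun i => e * ((if i == i0 then a else if i == i1 then c else e) / e))); last first.
  by move=> i _; rewrite mulrCA mulfV// mulr1.
have i10 : i1 != i0 by rewrite eq_sym.
rewrite big_split /= prodr_const card_ord (bigD1 i0) //= eqxx (bigD1 i1 i10) /=.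
rewrite (negbTE i10) eqxx big1 ?mulr1; first by field.
by move=> i /andP[/negbTE -> /negbTE ->]; rewrite mulfV.
Qed.

Lemma box_zeros (m b D : nat) (f : {mpoly int[m]}) : f != 0 -> (msize f <= D)%N ->
  atmost (fun y : 'rV[int]_m => (forall i, (`|y ord0 i| <= b)%N) /\ evz f (y ord0) = 0)
    ((m * D)%:R * (2 * b%:R + 1) ^+ m / (2 * b%:R + 1)).
Proof.
move=> f0 fD; pose A := [seq (Posz k - Posz b) | k <- iota 0 (2 * b).+1].
have uA : uniq A by rewrite map_inj_uniq ?iota_uniq// => k l /addIr[].
have sA : (size A)%:R = 2 * b%:R + 1 :> rat.
  by rewrite size_map size_iota -addn1 natrD natrM.
have A0 : (0 < size A)%N by rewrite size_map size_iota.
have := schwartz_zippel f0 fD uA A0.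
rewrite sA => H; apply: (atmost_sub _ H) => // y [yb y0]; split; last by rewrite evz_meval.
move=> i; apply/mapP; have := yb i; move: (y ord0 i) => a ab.
exists `|(a + b%:Z)%R|%N; last by lia.
by rewrite mem_iota; lia.
Qed.

Section BadCount.
Variables (m : nat) (Q0 : {mpoly int[m]}).
Hypotheses (Q0_homog : Q0 \is 2.-homog) (Q0_rank : (3 <= qf_rank Q0)%N).
Variables (C b mu T Y : nat).
Hypotheses (C_gt0 : (0 < C)%N) (mu_gt0 : (0 < mu)%N) (mu_le : (mu <= b)%N).
Hypothesis T_divisors : forall q, (0 < q <= Y)%N -> (size (divisors q) <= T)%N.

Let X := (C * mu)%N.
Hypothesis Y_X : (m * (X * b) <= Y)%N.
Hypothesis Y_q : (mnorm Q0 * ((2 * m) * (X * b)) ^ msize Q0 <= Y)%N.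

Let D := (msize Q0).+1.
Let BB : rat := 2 * b%:R + 1.
Let BX : rat := 2 * X%:R + 1.
Let b_gt0 : (0 < b)%N. Proof. exact: leq_trans mu_le. Qed.
Let BB_gt0 : 0 < BB. Proof. by rewrite /BB; have : 0 <= b%:R :> rat by []; lra. Qed.
Let BX_gt0 : 0 < BX. Proof. by rewrite /BX; have : 0 <= X%:R :> rat by []; lra. Qed.

Let box (k : nat) (v : 'rV[int]_m) := forall i, (`|v ord0 i| <= k)%N.

Let m3 : (3 <= m)%N.
Proof. by apply: leq_trans Q0_rank _; rewrite qf_rankE; exact: rank_leq_row. Qed.

Let m_gt0 : (0 < m)%N. Proof. exact: leq_trans m3. Qed.

Let T_int (q : int) : q != 0 -> (`|q| <= Y)%N -> atmost (fun d : int => (d %| q)%Z) (2 * T%:R).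
Proof. by move=> q0 qY; apply: atmost_divisors => //; apply: T_divisors; rewrite absz_gt0 q0. Qed.

Let hyp_zeros (i0 : 'I_m) (w : 'rV[int]_m) : w ord0 i0 != 0 ->
  atmost (fun y => box b y /\ qval Q0 (hyp_proj i0 w y) = 0) ((m * D)%:R * BB ^+ m / BB).
Proof.
move=> w0; have := @box_zeros _ b _ _ (hyp_poly_neq0 Q0_homog Q0_rank w0) (msize_hyp_poly Q0 i0 w).
by move=> H; apply: (atmost_sub _ H) => // y [yb y0]; split=> //; rewrite -evz_meval hyp_polyE.
Qed.

Let hyp_bound (i0 : 'I_m) (w y : 'rV[int]_m) : box X w -> box b y ->
  (`|qval Q0 (hyp_proj i0 w y)| <= Y)%N.
Proof.
move=> wX yb; apply: leq_trans Y_q; apply: qval_bound; first by rewrite !muln_gt0 m_gt0 C_gt0 mu_gt0 b_gt0.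
move=> i; rewrite /hyp_proj !mxE.
apply: leq_trans (abszD_le _ _) _; rewrite abszN !abszM.
rewrite mul2n -addnn mulnDl leq_add//.
  by apply: (@leq_trans (X * b)); [exact: leq_mul|exact: leq_pmull].
apply: (@leq_trans (m * (X * b) * 1)); last by rewrite muln1.
by rewrite leq_mul ?dot_bound//; case: (_ && _).
Qed.

(* The lattice Z y + x Z^m has a dual vector w / x of size at most C mu / b: this
   is what prevents it from having a basis of vectors of size b / mu. *)
Definition bad_pair (t : int * 'rV[int]_m) : Prop :=
  [/\ t.1 != 0, (`|t.1| <= b)%N, forall i, (`|t.2 ord0 i| <= b)%N, (t.1 %| qval Q0 t.2)%Z &
  exists w : 'rV[int]_m, [/\ w != 0, (t.1 %| dot w t.2)%Z &
    forall i, (b * `|w ord0 i| <= C * mu * `|t.1|)%N]].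

(** [bad_pair] with a fixed witness w whose largest entry is at i0. The bound X for the entries of w
    comes from |x| <= b. *)
Let wbase (i0 : 'I_m) (w : 'rV[int]_m) (t : int * 'rV[int]_m) : Prop :=
  [/\ w ord0 i0 != 0, box X w, t.1 != 0, (`|t.1| <= b)%N &
    [/\ box b t.2, (t.1 %| qval Q0 t.2)%Z, (t.1 %| dot w t.2)%Z,
      (b * `|w ord0 i0| <= C * mu * `|t.1|)%N &
      forall i, (`|w ord0 i| <= `|w ord0 i0|)%N]].

(** As x divides w . y, the projection is congruent to w_i0 y modulo x. *)
Let hyp_dvd (i0 : 'I_m) (w : 'rV[int]_m) t : wbase i0 w t ->
  (t.1 %| qval Q0 (hyp_proj i0 w t.2))%Z.
Proof.
move=> [_ _ _ _ [_ tq tw _ _]]; rewrite (@qval_dvd _ _ _ _ (w ord0 i0 *: t.2)).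
  by rewrite qvalZ// dvdz_mull.
move=> i; rewrite /hyp_proj [X in (X - _)]mxE addrAC subrr add0r.
by rewrite !mxE rpredN dvdz_mulr.
Qed.

(** Here y is a zero of [hyp_poly] and x one of the divisors of the nonzero integer w . y. *)
Let T1a_count (i0 : 'I_m) (w : 'rV[int]_m) :
  atmost (fun t => [/\ wbase i0 w t, qval Q0 (hyp_proj i0 w t.2) = 0 & dot w t.2 != 0])
    ((m * D)%:R * BB ^+ m / BB * (2 * T%:R)).
Proof.
have [w0|w0] := eqVneq (w ord0 i0) 0.
  apply: (atmost_sub _ (@atmost0 _ (fun=> False) (fun=> id))); first by case=> ? ? [[]]; rewrite w0.
  by rewrite !mulr_ge0 ?exprn_ge0 ?invr_ge0// ltW.
apply: (@atmost_rel (int * 'rV[int]_m)%type 'rV[int]_m _ _ (fun t y => t.2 = y /\ ([/\ wbase i0 w t, qval Q0 (hyp_proj i0 w t.2) = 0 & dot w t.2 != 0])) _ _ _ (hyp_zeros w0)).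
- by move=> t H; exists t.2 => //; case: H => -[_ _ _ _ [? _ _ _]].
- move=> y _; have [[t0 [ty [[w0' wX _ _ [yb _ _ _ _]] _ dw]]]|no] := pselect (exists t, t.2 = y /\ ([/\ wbase i0 w t, qval Q0 (hyp_proj i0 w t.2) = 0 & dot w t.2 != 0])).
    apply: (@atmost_inj _ int _ (fun d => (d %| dot w y)%Z) fst).
    + by move=> t [_ [<- [[_ _ _ _ [_ _ ? _ _]] _ _]]].
    + by move=> [a y1] [a' y2] [_ [/= -> _]] [_ [/= -> _]] /= ->.
    + by apply: T_int; rewrite -?ty//; apply: leq_trans Y_X; exact: dot_bound.
  apply: (atmost_sub _ (@atmost0 _ (fun=> False) (fun=> id))); last by rewrite mulr_ge0.
  by move=> t [_ H]; apply: no; exists t.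
- by rewrite mulr_ge0.
Qed.

(** When w . y = 0 the entry y_i0 is determined by the others, so its place can store x. The pair
    becomes a single vector, which is still a zero of [hyp_poly]. *)
Let T1b_count (i0 : 'I_m) (w : 'rV[int]_m) :
  atmost (fun t => [/\ wbase i0 w t, qval Q0 (hyp_proj i0 w t.2) = 0 & dot w t.2 = 0])
    ((m * D)%:R * BB ^+ m / BB).
Proof.
have [w0|w0] := eqVneq (w ord0 i0) 0.
  apply: (atmost_sub _ (@atmost0 _ (fun=> False) (fun=> id))); first by case=> ? ? [[]]; rewrite w0.
  by rewrite !mulr_ge0 ?exprn_ge0 ?invr_ge0// ltW.
apply: (@atmost_inj _ 'rV[int]_m _ _ (fun t => upd t.2 i0 t.1) _ _ _ (hyp_zeros w0)).
  move=> t [[_ _ _ tb [yb _ _ _ _]] q0 _]; split; last by rewrite hyp_proj_upd.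
  by move=> i; rewrite mxE; case: ifP.
move=> [x y] [x' y'] [_ _ /= dy] [_ _ /= dy'] /rowP E.
have xx : x = x' by have := E i0; rewrite !mxE eqxx.
have yy j : j != i0 -> y ord0 j = y' ord0 j by move=> ji; have := E j; rewrite !mxE (negbTE ji).
congr pair => //; apply/rowP => j; have [->|/yy//] := eqVneq j i0.
move: dy'; rewrite -dy !dotE (bigD1 i0) //= [in RHS](bigD1 i0) //=.
rewrite (eq_bigr (fun j => w ord0 j * y ord0 j)) => [/addIr/(mulfI w0)//|k ki].
by rewrite yy.
Qed.

Section Fiber.
Variables (i0 i1 : 'I_m) (w : 'rV[int]_m) (d : nat).
Hypotheses (i01 : i0 != i1) (w0 : w ord0 i0 != 0) (wX : box X w) (dw : (d %| `|w ord0 i0|)%N).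
Let g := gcdn d `|w ord0 i1|.
Let d_gt0 : (0 < d)%N. Proof. by apply: dvdn_gt0 dw; rewrite absz_gt0. Qed.
Let d_le : (d <= X)%N.
Proof. by apply: leq_trans (wX i0); apply: dvdn_leq => //; rewrite absz_gt0. Qed.
Let g_gt0 : (0 < g)%N. Proof. by rewrite gcdn_gt0 d_gt0. Qed.

(** These are the vectors y with the entry i0 erased. Since d divides both x and w_i0, the erased
    vector still satisfies d | w . y, which confines y_i1 to a class modulo d / g; the additional 1
    is absorbed by d <= C b. *)
Let slices : atmost (fun y => [/\ box b y, y ord0 i0 = 0 & (d%:Z %| dot w y)%Z])
  (BB ^+ m / BB ^+ 2 * ((2 + C%:R) * b%:R * g%:R / d%:R)).
Proof.
apply: (@atmost_rel 'rV[int]_m 'rV[int]_m _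
   (fun z => forall i, if i == i0 then z ord0 i = 0 else if i == i1 then z ord0 i = 0 else (`|z ord0 i| <= b)%N)
   (fun y z => upd y i1 0 = z)).
- move=> y [yb y0 _]; exists (upd y i1 0) => // i; rewrite mxE.
  by case: eqP => [->|_]; [rewrite (negbTE i01)|case: eqP].
- rewrite -[X in atmost _ X]mul1r -[1]mulr1 -(prod_two _ _ i01) ?lt0r_neq0//.
  apply: (@atmost_row int m (fun i a => if i == i0 then a = 0 else if i == i1 then a = 0 else (`|a| <= b)%N)).
  move=> i; case: eqP => _; first by apply: atmost1 => ? ? -> ->.
  by case: eqP => _; [apply: atmost1 => ? ? -> ->|exact: atmost_int].
- move=> z _; set c := dot w z.
  apply: (@atmost_inj 'rV[int]_m int _ (fun a => (`|a| <= b)%N /\ (d%:Z %| w ord0 i1 * a + c)%Z) (fun y => y ord0 i1)).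
  + move=> y [[yb _ ydw] yz]; split=> //; rewrite /c -yz dot_upd sub0r mulrN addrC subrK.
    exact: ydw.
  + move=> y y' [_ yz] [_ y'z] yy'; apply/rowP => j; have [->//|ji] := eqVneq j i1.
    by move: yz; rewrite -y'z => /rowP/(_ j); rewrite !mxE (negbTE ji).
  + apply: (atmost_sub _ (@atmost_int_lin b d (w ord0 i1) c d_gt0)) => //.
    have -> : (2 + C%:R) * b%:R * g%:R / d%:R = 2 * b%:R * g%:R / d%:R + C%:R * b%:R * g%:R / d%:R :> rat by ring.
    rewrite -/g lerD2l.
    rewrite ler_pdivlMr ?ltr0n// mul1r -!natrM ler_nat.
    apply: leq_trans d_le _; rewrite -[X in (X <= _)%N]muln1 leq_mul//.
    by rewrite /X leq_mul2l mu_le orbT.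
- by rewrite !mulr_ge0// ?invr_ge0 ?addr_ge0.
Qed.

(** With the entry i0 erased, x is a divisor of a nonzero integer, and y_i0 lies in a class modulo x
    / d. Since |x| >= b |w_i0| / (C mu), this class has at most 3 C mu d / |w_i0| elements in the
    box. *)
Lemma bad_fiber : atmost (fun t => [/\ wbase i0 w t, qval Q0 (hyp_proj i0 w t.2) != 0 &
    gcdn `|t.1| `|w ord0 i0| = d])
  (BB ^+ m / BB ^+ 2 * ((2 + C%:R) * b%:R * g%:R / d%:R) *
    (2 * T%:R * (3 * C%:R * mu%:R * d%:R / `|w ord0 i0|%N%:R))).
Proof.
have w0R : 0 < `|w ord0 i0|%N%:R :> rat by rewrite ltr0n absz_gt0.
apply: (@atmost_rel (int * 'rV[int]_m)%type 'rV[int]_m _ _ (fun t z => upd t.2 i0 0 = z) _ _ _ slices).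
- move=> [x y] [[_ _ x0 xb [/= yb _ xw _ _]] _ gd]; exists (upd y i0 0) => //; split.
  + by move=> i; rewrite mxE; case: eqP.
  + by rewrite mxE eqxx.
  + rewrite dot_upd rpredD//.
      by apply: dvdz_trans xw; rewrite dvdzE /= -gd dvdn_gcdl.
    by apply: dvdz_mulr; rewrite dvdzE.
- move=> z [zb z0 _].
  apply: (@atmost_rel (int * 'rV[int]_m)%type int _ (fun x => [/\ (x %| qval Q0 (hyp_proj i0 w z))%Z, qval Q0 (hyp_proj i0 w z) != 0,
      x != 0, gcdn `|x| `|w ord0 i0| = d & (b * `|w ord0 i0| <= C * mu * `|x|)%N]) (fun t x => t.1 = x)).
  + move=> t [[tb q0 gd] tz]; exists t.1; last by [].
    case: (tb) => _ _ t0 _ [_ _ _ tB _]; rewrite -tz hyp_proj_upd.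
    by split; [exact: hyp_dvd|exact: q0|exact: t0|exact: gd|exact: tB].
  + have /orP[/eqP q0|q0] := orbN (qval Q0 (hyp_proj i0 w z) == 0).
      apply: (atmost_sub _ (@atmost0 _ (fun=> False) (fun=> id))); last by rewrite mulr_ge0.
      by move=> x [_]; rewrite q0 eqxx.
    apply: (atmost_sub _ (T_int q0 (hyp_bound i0 wX zb))) => //.
    by move=> x [].
  + move=> x [_ _ x0 gd xb]; have x0N : (0 < `|x|)%N by rewrite absz_gt0.
    apply: (@atmost_inj (int * 'rV[int]_m)%type int _ (fun a => (`|a| <= b)%N /\ (`|x|%:Z %| w ord0 i0 * a + dot w z)%Z) (fun t => t.2 ord0 i0)).
    * move=> [x' y] [[[[_ _ _ _ [/= yb _ xw _ _]] _ _] yz] /= xx']; split=> //.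
      rewrite -yz dot_upd sub0r mulrN addrC subrK dvdzE /= -dvdzE -xx'.
      exact: xw.
    * move=> [x1 y1] [x2 y2] [[_ /= yz] /= ->] [[_ /= y'z] /= ->] yy'; congr pair.
      apply/rowP => j; have [->//|ji] := eqVneq j i0.
      by move: yz; rewrite -y'z => /rowP/(_ j); rewrite !mxE (negbTE ji).
    * apply: (atmost_sub _ (@atmost_int_lin b `|x| (w ord0 i0) (dot w z) x0N)) => //.
      rewrite gd; have xR : 0 < `|x|%N%:R :> rat by rewrite ltr0n.
      have h1 : b%:R / `|x|%N%:R <= C%:R * mu%:R / `|w ord0 i0|%N%:R :> rat.
        rewrite ler_pdivrMr// mulrAC ler_pdivlMr// -!natrM ler_nat//.
      have h2 : 1 <= C%:R * mu%:R / `|w ord0 i0|%N%:R * d%:R :> rat.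
        have dR : 1 <= d%:R :> rat by rewrite ler1n.
        apply: le_trans dR _; rewrite ler_peMl// ler_pdivlMr// mul1r -natrM ler_nat.
        exact: wX.
      have h3 : 2 * b%:R * d%:R / `|x|%N%:R <= 2 * (C%:R * mu%:R / `|w ord0 i0|%N%:R * d%:R) :> rat.
        have -> : 2 * b%:R * d%:R / `|x|%N%:R = 2 * (b%:R / `|x|%N%:R * d%:R) :> rat by ring.
        by rewrite ler_pM2l// ler_wpM2r.
      have -> : 3 * C%:R * mu%:R * d%:R / `|w ord0 i0|%N%:R =
        3 * (C%:R * mu%:R / `|w ord0 i0|%N%:R * d%:R) :> rat by ring.
      by move: h2 h3; lra.
  + by rewrite !mulr_ge0// invr_ge0.
- by rewrite !mulr_ge0// invr_ge0.
Qed.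

End Fiber.

(** Sorting by w_i0, by d = gcd(x, w_i0) and by g = gcd(d, w_i1) makes the losses cancel: about
    |w_i0| / g values of w_i1, b g / d of y_i1 and mu d / |w_i0| of y_i0, whose product is b mu. *)
Let T2_count (i0 i1 : 'I_m) : i0 != i1 ->
  atmost (fun t => exists w, wbase i0 w t /\ qval Q0 (hyp_proj i0 w t.2) != 0)
    (BX * (T%:R * (T%:R * (BX ^+ m / BX ^+ 2 * (BB ^+ m / BB ^+ 2) *
       (18 * (2 + C%:R) * C%:R * T%:R * b%:R * mu%:R))))).
Proof.
move=> i01; set K := _ * (18 * _ * _ * _ * _ * _).
have QX : 0 <= BX ^+ m / BX ^+ 2 by rewrite divr_ge0// exprn_ge0// ltW.
have QB : 0 <= BB ^+ m / BB ^+ 2 by rewrite divr_ge0// exprn_ge0// ltW.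
have C2 : 0 <= 2 + C%:R :> rat by rewrite addr_ge0.
have K0 : 0 <= K.
  by apply: mulr_ge0; [exact: mulr_ge0|do 4!(apply: mulr_ge0; last exact: ler0n); exact: mulr_ge0 (ler0n _ _) C2].
have XY : (X <= Y)%N.
  apply: leq_trans Y_X; apply: (@leq_trans (1 * (X * 1))); first by rewrite mul1n muln1.
  by rewrite !leq_mul.
have TT (om : int) : om != 0 -> (`|om| <= X)%N ->
    atmost (fun d => d \in divisors `|om|) T%:R.
  move=> om0 omX; apply: (atmost_sub _ (@atmost_seq _ (divisors `|om|))) => //.
  by rewrite ler_nat T_divisors// absz_gt0 om0 (leq_trans omX).
apply: (@atmost_rel (int * 'rV[int]_m)%type int _ (fun om => om != 0 /\ (`|om| <= X)%N)
  (fun t om => exists w : 'rV[int]_m, [/\ w ord0 i0 = om, wbase i0 w t & qval Q0 (hyp_proj i0 w t.2) != 0])).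
- move=> t [w [tw q0]]; case: (tw) => w0 wX _ _ _.
  by exists (w ord0 i0) => //; exists w.
- by apply: (atmost_sub _ (@atmost_int X)) => // om [].
- move=> om [om0 omX]; apply: (@atmost_rel (int * 'rV[int]_m)%type nat _ (fun d => d \in divisors `|om|)
    (fun t d => exists w : 'rV[int]_m, [/\ w ord0 i0 = om, wbase i0 w t, qval Q0 (hyp_proj i0 w t.2) != 0 & gcdn `|t.1| `|om| = d])).
  + move=> t [_ [w [wi tw q0]]]; exists (gcdn `|t.1| `|om|); last by exists w.
    by rewrite -dvdn_divisors ?absz_gt0// dvdn_gcdr.
  + exact: TT.
  + move=> d dom; have {}dom : (d %| `|om|)%N by rewrite dvdn_divisors// absz_gt0.
    have d0 : (0 < d)%N by apply: dvdn_gt0 dom; rewrite absz_gt0.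
    apply: (@atmost_rel (int * 'rV[int]_m)%type nat _ (fun g => g \in divisors `|om|)
      (fun t g => exists w : 'rV[int]_m, [/\ w ord0 i0 = om, wbase i0 w t, qval Q0 (hyp_proj i0 w t.2) != 0,
         gcdn `|t.1| `|om| = d & gcdn d `|w ord0 i1| = g])).
    * move=> t [_ [w [wi tw q0 gd]]]; exists (gcdn d `|w ord0 i1|); last by exists w.
      rewrite -dvdn_divisors ?absz_gt0//; apply: dvdn_trans dom; exact: dvdn_gcdl.
    * exact: TT.
    * move=> g gom; have {}gom : (g %| `|om|)%N by rewrite dvdn_divisors// absz_gt0.
      have g0 : (0 < g)%N by apply: dvdn_gt0 gom; rewrite absz_gt0.
      have omR : 0 < `|om|%N%:R :> rat by rewrite ltr0n absz_gt0.
      have gR : 0 < g%:R :> rat by rewrite ltr0n.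
      have dR : 0 < d%:R :> rat by rewrite ltr0n.
      have -> : K = (1 * (3 * `|om|%N%:R / g%:R) * (BX ^+ m / BX ^+ 2)) *
         (BB ^+ m / BB ^+ 2 * ((2 + C%:R) * b%:R * g%:R / d%:R) *
           (2 * T%:R * (3 * C%:R * mu%:R * d%:R / `|om|%N%:R))).
        rewrite /K; set P := _ / BX ^+ 2; set P' := _ / BB ^+ 2.
        by field; rewrite !gt_eqF.
      apply: (@atmost_rel (int * 'rV[int]_m)%type 'rV[int]_m _
        (fun w => [/\ w ord0 i0 = om, box X w, (`|w ord0 i1| <= `|om|)%N & gcdn d `|w ord0 i1| = g])
        (fun t w => [/\ wbase i0 w t, qval Q0 (hyp_proj i0 w t.2) != 0 & gcdn `|t.1| `|w ord0 i0| = d])).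
      -- move=> t [_ [w [wi tw q0 gd gg]]]; exists w; last by rewrite wi.
         by case: tw => _ wX _ _ [_ _ _ _ wi1]; split=> //; rewrite -wi.
      -- rewrite -(prod_two _ _ i01) ?lt0r_neq0//.
         apply: (atmost_sub _ (@atmost_row int m (fun i a => if i == i0 then a = om
             else if i == i1 then (`|a| <= `|om|)%N /\ (g%:Z %| a - 0)%Z else (`|a| <= X)%N)
             (fun i => if i == i0 then 1 else if i == i1 then 3 * `|om|%N%:R / g%:R else BX) _)) => //.
           move=> w [wi wX wi1 gg] i; case: eqP => [->//|_]; case: eqP => [->|//].
           by split=> //; rewrite subr0 dvdzE /= -gg dvdn_gcdr.
         move=> i; case: eqP => _; first by apply: atmost1 => ? ? -> ->.
         case: eqP => _; last exact: atmost_int.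
         apply: (atmost_sub _ (@atmost_int_mod `|om| g 0 g0)) => //.
         have : 1 <= `|om|%N%:R / g%:R :> rat.
           by rewrite ler_pdivlMr// mul1r ler_nat dvdn_leq// absz_gt0.
         by rewrite -!mulrA; lra.
      -- move=> w [wi wX _ gg]; apply: (@atmost_sub _ _ (fun t => [/\ wbase i0 w t, qval Q0 (hyp_proj i0 w t.2) != 0 &
            gcdn `|t.1| `|w ord0 i0| = d])); [by move=> t []| |exact: lexx].
         by rewrite -gg -wi; apply: bad_fiber; rewrite ?wi.
      -- apply: mulr_ge0; [apply: (mulr_ge0 QB)|apply: mulr_ge0; first exact: mulr_ge0 (ler0n _ _) (ler0n _ _)].
           apply: divr_ge0; last exact: ler0n.
           by do 2!(apply: mulr_ge0; last exact: ler0n).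
         apply: divr_ge0; last exact: ler0n.
         by do 3!(apply: mulr_ge0; last exact: ler0n); exact: ler0n.
    * exact: K0.
  + exact: mulr_ge0 (ler0n _ _) K0.
- by do 2!apply: (mulr_ge0 (ler0n _ _)).
Qed.

Lemma bad_count : atmost bad_pair (m%:R * (BX ^+ m * ((m * D)%:R * BB ^+ m / BB * (2 * T%:R + 1)) +
  BX * (T%:R * (T%:R * (BX ^+ m / BX ^+ 2 * (BB ^+ m / BB ^+ 2) *
       (18 * (2 + C%:R) * C%:R * T%:R * b%:R * mu%:R)))))).
Proof.
have N0 : 0 <= (m * D)%:R * BB ^+ m / BB * (2 * T%:R + 1).
  by rewrite !mulr_ge0// ?exprn_ge0 ?invr_ge0 ?addr_ge0 ?mulr_ge0// ltW.
apply: (@atmost_rel (int * 'rV[int]_m)%type 'I_m _ (fun=> True) (fun t i0 => exists w, wbase i0 w t)).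
- move=> [x y] [/= x0 xb yb xq [w [w0 xw wb]]].
  have wX i : (`|w ord0 i| <= X)%N.
    rewrite -(leq_pmul2l b_gt0) (leq_trans (wb i))// /X mulnC leq_mul2r.
    by rewrite xb orbT.
  pose i0 := [arg max_(i > Ordinal m_gt0) `|w ord0 i|%N].
  have i0P i : (`|w ord0 i| <= `|w ord0 i0|)%N by rewrite /i0; case: arg_maxnP => // j _; apply.
  exists i0 => //; exists w; split=> //.
  apply: contraNneq w0 => wi0; apply/eqP/rowP => i; rewrite mxE.
  by apply/eqP; rewrite -absz_eq0 -leqn0 (leq_trans (i0P i))// wi0.
- apply: (atmost_sub _ (@atmost_seq _ (enum 'I_m))); first by move=> i _; rewrite mem_enum.
  by rewrite size_enum_ord.
- move=> i0 _; have [i1 i01] : exists i1, i0 != i1.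
    have m1 : (1 < m)%N by apply: leq_trans m3.
    have [->|i00] := eqVneq i0 (Ordinal m_gt0); last by exists (Ordinal m_gt0).
    by exists (Ordinal m1); rewrite -val_eqE.
  apply: (@atmost_sub _ _ (fun t => (exists w, wbase i0 w t /\ qval Q0 (hyp_proj i0 w t.2) = 0) \/
     (exists w, wbase i0 w t /\ qval Q0 (hyp_proj i0 w t.2) != 0))); [|apply: atmost_or|exact: lexx].
  + move=> t [_ [w tw]]; have [q0|q0] := eqVneq (qval Q0 (hyp_proj i0 w t.2)) 0; [left|right]; by exists w.
  + apply: (@atmost_rel (int * 'rV[int]_m)%type 'rV[int]_m _ (box X)
      (fun t w => wbase i0 w t /\ qval Q0 (hyp_proj i0 w t.2) = 0)).
    * by move=> t [w [tw q0]]; exists w => //; case: tw.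
    * exact: atmost_box.
    * move=> w _; rewrite mulrDr mulr1.
      apply: (@atmost_sub _ _ _ _ _ _ (atmost_or (@T1a_count i0 w) (@T1b_count i0 w))); last exact: lexx.
      by move=> t [_ [tw q0]]; have [dw|dw] := eqVneq (dot w t.2) 0; [right|left].
    * exact: N0.
  + exact: T2_count i01.
- have QX : 0 <= BX ^+ m / BX ^+ 2 by rewrite divr_ge0// exprn_ge0// ltW.
  have QB : 0 <= BB ^+ m / BB ^+ 2 by rewrite divr_ge0// exprn_ge0// ltW.
  have C2 : 0 <= 2 + C%:R :> rat by rewrite addr_ge0.
  have P2 := mulr_ge0 QX QB; apply: addr_ge0; first by rewrite mulr_ge0// exprn_ge0// ltW.
  apply: mulr_ge0; first exact: ltW.
  do 2!apply: (mulr_ge0 (ler0n _ _)); apply: (mulr_ge0 P2).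
  by do 4!(apply: mulr_ge0; last exact: ler0n); exact: mulr_ge0 (ler0n _ _) C2.
Qed.

End BadCount.

(** * Affine substitutions and lattice generators *)

Definition pt (R : Type) (m : nat) (x : R) (y : 'rV[R]_m) (i : 'I_(1 + m)) : R :=
  match fintype.split i with inl _ => x | inr j => y ord0 j end.

Lemma pt_l (R : Type) (m : nat) (x : R) (y : 'rV[R]_m) (i : 'I_1) : pt x y (lshift m i) = x.
Proof. by rewrite /pt -[lshift _ _]/(unsplit (inl i)) unsplitK. Qed.

Lemma pt_r (R : Type) (m : nat) (x : R) (y : 'rV[R]_m) (j : 'I_m) : pt x y (rshift 1 j) = y ord0 j.
Proof. by rewrite /pt -[rshift _ _]/(unsplit (inr j)) unsplitK. Qed.

Lemma pt_line (R : comNzRingType) (m : nat) (x : R) (v e : 'rV[R]_m) (t : R) :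
  (fun i => pt x v i + pt 0 e i * t) =1 pt x (v + t *: e).
Proof.
move=> i; case: (split_ordP i) => j ->; rewrite !(pt_l, pt_r) ?mul0r ?addr0//.
by rewrite !mxE mulrC.
Qed.

Section AffineSubstitution.
Variable m : nat.

(** The point y + s E for a generic row s, its coordinates being polynomials in s. *)
Definition aff (y : 'rV[int]_m) (E : 'M[int]_m) : 'rV[{mpoly int[m]}]_m :=
  \row_i ((y ord0 i)%:MP + \sum_l (E l i)%:MP * 'X_l).

Lemma evz_aff (R : comNzRingType) (y : 'rV[int]_m) (E : 'M[int]_m) (s : 'rV[R]_m) i :
  evz (aff y E ord0 i) (s ord0) = (map_mx intr y + s *m map_mx intr E) ord0 i.
Proof.
rewrite !mxE; set phi : {rmorphism {mpoly int[m]} -> R} := mmap intr (s ord0).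
rewrite -[LHS]/(phi _) rmorphD rmorph_sum /= mmapC; congr (_ + _).
apply: eq_bigr => l _; rewrite -[LHS]/(phi _) rmorphM /= mmapC mmapX mmap1U mxE mulrC.
by [].
Qed.

Lemma msize_aff (y : 'rV[int]_m) (E : 'M[int]_m) i : (msize (aff y E ord0 i) <= 2)%N.
Proof.
rewrite mxE; apply: leq_trans (mmeasureD_le _ _ _) _; rewrite geq_max mmeasureC.
rewrite (leq_trans (leq_b1 _))//=; apply: leq_trans (mmeasure_sum _ _ _ _) _.
apply/bigmax_leqP => l _; rewrite mul_mpolyC (leq_trans (mmeasureZ_le _ _ _))//.
by rewrite msizeX mdeg1.
Qed.

Lemma evz_subst (R : comNzRingType) (n : nat) (f : {mpoly int[n]})
    (h : 'I_n -> {mpoly int[m]}) (v : 'I_m -> R) :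
  evz (evz f h) v = evz f (fun i => evz (h i) v).
Proof.
set phi : {rmorphism {mpoly int[m]} -> R} := mmap intr v.
by rewrite -[LHS]/(phi _) evz_morph.
Qed.

End AffineSubstitution.

Lemma intz_map (m n : nat) (A : 'M[int]_(m, n)) : map_mx intr A = A.
Proof. by apply/matrixP => i j; rewrite mxE intz. Qed.

Lemma unit_of_mul_scalar (K : numFieldType) (m : nat) (E N : 'M[int]_m) (x : int) :
  x != 0 -> N *m E = x%:M -> map_mx intr E \in @unitmx K m.
Proof.
move=> x0 NE; have /(congr1 determinant) : map_mx intr N *m map_mx intr E = (x%:~R)%:M :> 'M[K]_m.
  by rewrite -map_mxM NE map_scalar_mx.
rewrite det_mulmx det_scalar => H; rewrite unitmxE unitfE.
apply/eqP => dE; move/eqP: H.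
by rewrite dE mulr0 eq_sym expf_eq0 intr_eq0 (negbTE x0) andbF.
Qed.

Lemma iota_int_uniq (k : nat) : uniq [seq Posz j | j <- iota 0 k].
Proof. by rewrite map_inj_uniq ?iota_uniq// => a b []. Qed.

Lemma int_grid_nonvanishing (m : nat) (P : {mpoly int[m]}) : P != 0 ->
  exists v : 'rV[int]_m, P.@[v ord0] != 0.
Proof.
move=> P0; have [|v _ Pv] := @mpoly_nonvanishing _ m P [seq Posz j | j <- iota 0 (m * msize P).+1] P0 (iota_int_uniq _).
  by rewrite size_map size_iota.
by exists v.
Qed.

(** N E = x I makes s -> y + s E invertible over the rationals, so that f remains nonzero after the
    substitution and the grid bound applies. *)
Lemma affine_zeros (m D : nat) (f : {mpoly int[m]}) (y : 'rV[int]_m) (E N : 'M[int]_m) (x : int) (mu : nat) :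
  f != 0 -> (msize f < D)%N -> x != 0 -> N *m E = x%:M -> (0 < mu)%N ->
  atmost (fun s : 'rV[int]_m => (forall i, s ord0 i \in [seq Posz j | j <- iota 0 mu]) /\
      evz f ((y + s *m E) ord0) = 0) ((m * D)%:R * mu%:R ^+ m / mu%:R).
Proof.
move=> f0 fD x0 NE mu0; set g := evz f (aff y E ord0).
have gE (R : comNzRingType) (s : 'rV[R]_m) :
    evz g (s ord0) = evz f ((map_mx intr y + s *m map_mx intr E) ord0).
  by rewrite /g evz_subst; apply: eq_evz => i; rewrite evz_aff.
have g0 : g != 0.
  have [v fv] := int_grid_nonvanishing f0; apply: contraNneq fv => g0.
  have Eu := @unit_of_mul_scalar rat _ _ _ _ x0 NE.
  have := gE rat ((map_mx intr v - map_mx intr y) *m invmx (map_mx intr E)).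
  rewrite mulmxKV// [_ + (_ - _)]addrC subrK g0 /evz mmap0 -/(evz f _) => /esym H.
  rewrite evz_meval -(intr_eq0 rat) -[_%:~R]/(intr (evz f _)) (evz_morph intr); apply/eqP.
  by rewrite -[RHS]H; apply: eq_evz => i; rewrite mxE.
have := @schwartz_zippel _ m D g [seq Posz j | j <- iota 0 mu] g0 _ (iota_int_uniq _).
rewrite size_map size_iota => H.
apply: (atmost_sub _ (H _ mu0)); last exact: lexx.
  by move=> s [sA fs]; split=> //; rewrite evz_meval gE !intz_map.
by apply: leq_trans (msize_evz _ (msize_aff y E)) _; rewrite muln1.
Qed.

(* The generators of the lattice Z y + x Z^m are its vectors l y + x u with
   l prime to x: Jacobsthal's bound gives one close to any vector. *)
Lemma lat_generator_shift (m : nat) (Q0 : {mpoly int[m]}) (x : int) (y z : 'rV[int]_m) (J : nat) :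
  Q0 \is 2.-homog -> x != 0 -> (4 * size (divisors `|x|) ^ 2 <= J)%N ->
  lat x y z -> qval Q0 z != 0 ->
  exists j : nat, [/\ (j < J)%N, lat x (z + j%:Z *: y) = lat x y & qval Q0 (z + j%:Z *: y) != 0].
Proof.
move=> Q0h x0 xJ [l [u zE]] qz.
have xN : (0 < `|x|)%N by rewrite absz_gt0.
have x1 : `|x|%N%:Z != 0 by rewrite eqz_nat -lt0n.
(* The shift will be j = c - a with c prime to x in the window that starts at a; then l + j is
   congruent to c modulo x. *)
set a := absz (l %% `|x|%N)%Z.
have aE : (a%:Z = l %[mod x])%Z by rewrite /a gez0_abs ?modz_ge0// modz_abs modz_mod.
have J3 := jacobsthal a xN xJ.
(* Q0(z + j y) as a polynomial in j. It is nonzero of degree at most 2, so that one of three values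
   of j is not a root. *)
pose P : {poly int} := (qval Q0 y) *: 'X^2 + (bq Q0 z y) *: 'X + (qval Q0 z)%:P.
have PE (j : nat) : P.[j%:Z] = qval Q0 (z + j%:Z *: y).
  rewrite qvalD// qvalZ// bqZr /P 2!hornerD !hornerZ hornerXn hornerX hornerC; ring.
have P0 : P != 0.
  apply: contraNneq qz => P0; have := PE 0%N; rewrite P0 horner0 scale0r addr0 => <-.
  exact: eqxx.
have sP : (size P <= 3)%N.
  rewrite /P (leq_trans (size_polyD _ _))// geq_max (leq_trans (size_polyD _ _))/=.
    by rewrite (leq_trans (size_polyC_leq1 _)).
  by rewrite geq_max !(leq_trans (size_scale_leq _ _))// ?size_polyXn ?size_polyX.
have /hasP[c] : has (fun c => coprime c `|x| && (qval Q0 (z + (c - a)%N%:Z *: y) != 0)) (iota a J).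
  apply/negP => /negP; rewrite -all_predC => /allP H.
  pose s := [seq Posz (c - a) | c <- [seq c <- iota a J | coprime c `|x|]].
  have : (size s < size P)%N.
    apply: max_poly_roots => //.
      apply/allP => _ /mapP[c + ->]; rewrite mem_filter => /andP[cx ci].
      by have := H c ci; rewrite /= cx negbK rootE PE.
    rewrite map_inj_in_uniq ?filter_uniq ?iota_uniq// => c c'.
    rewrite !mem_filter !mem_iota => /andP[_ /andP[h1 _]] /andP[_ /andP[h2 _]] [] /eqP.
    by lia.
  by rewrite size_map size_filter ltnNge (leq_trans sP).
rewrite mem_iota => /andP[ac cJ] /andP[cx qc].
exists (c - a)%N; split=> //; first by rewrite ltn_subLR.
have lc : (l + (c - a)%N%:Z = c%:Z %[mod x])%Z.
  by rewrite -modzDml -aE modzDml -PoszD subnKC.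
have [[v w] /= vw] : exists vw : int * int, vw.1 * (l + (c - a)%N%:Z) + vw.2 * x = 1.
  have : coprimez (l + (c - a)%N%:Z) x.
    by rewrite /coprimez -gcdz_modl lc gcdz_modl; exact: cx.
  by move/coprimezP => [[v w] /= vw]; exists (v, w).
have z'E : z + (c - a)%N%:Z *: y = (l + (c - a)%N%:Z) *: y + x *: u.
  by rewrite zE scalerDl addrAC.
(* Since v inverts l' modulo x, the vector y is recovered from l' y + x u, and the two lattices
   coincide. *)
rewrite z'E; set l' := l + _ in vw *; apply/predeqP => t; split=> -[k [q ->]].
  exists (k * l'), (k *: u + q); rewrite !scalerDr !scalerA addrA [k * x]mulrC.
  by [].
exists (k * v), ((k * w) *: y - (k * v) *: u + q).
have -> : k *: y = (k * v * l') *: y + (k * w * x) *: y.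
  by rewrite -scalerDl -!mulrA -mulrDr vw mulr1.
rewrite !scalerDr scalerN !scalerA; apply/rowP => i; rewrite !mxE; ring.
Qed.

Lemma lat_sub (m : nat) (x : int) (y z z' : 'rV[int]_m) : lat x y z -> lat x y z' -> lat x y (z + z').
Proof.
move=> [l [u ->]] [l' [u' ->]]; exists (l + l'), (u + u').
by rewrite scalerDl scalerDr addrACA.
Qed.

Lemma lat_refl (m : nat) (x : int) (y : 'rV[int]_m) : lat x y y.
Proof. by exists 1, 0; rewrite scale1r scaler0 addr0. Qed.

Lemma lat_qval (m : nat) (Q0 : {mpoly int[m]}) (x : int) (y z : 'rV[int]_m) :
  Q0 \is 2.-homog -> (x %| qval Q0 y)%Z -> lat x y z -> (x %| qval Q0 z)%Z.
Proof.
move=> Q0h xy [l [u ->]]; rewrite (@qval_dvd _ _ _ _ (l *: y)).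
  by rewrite qvalZ// dvdz_mull.
by move=> i; rewrite !mxE addrAC subrr add0r dvdz_mulr.
Qed.

Lemma Fp_intr_eq0 (p : nat) (a : int) : prime p -> (a%:~R == 0 :> 'F_p) = (p%:Z %| a)%Z.
Proof. by move=> pp; rewrite (dvdz_pcharf (pchar_Fp pp)). Qed.

(* Modulo p the matrix E is invertible, so that a nonzero polynomial takes a
   nonzero value at a small combination of the rows of E. *)
Lemma small_direction (m : nat) (A : {mpoly int[m]}) (E N : 'M[int]_m) (x : int) (p : nat) :
  prime p -> (mnorm A < p)%N -> (m * (msize A).+1 < p)%N -> A != 0 -> ~~ (p%:Z %| x)%Z ->
  N *m E = x%:M ->
  exists2 s : 'rV[int]_m, (forall i, s ord0 i \in [seq Posz j | j <- iota 0 (m * (msize A).+1).+1]) &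
    ~~ (p%:Z %| evz A ((s *m E) ord0))%Z.
Proof.
move=> pp Ap mp A0 px NE; set K := (m * (msize A).+1)%N in mp *.
pose L := [seq (Posz j)%:~R : 'F_p | j <- iota 0 K.+1].
have uL : uniq L.
  rewrite map_inj_in_uniq ?iota_uniq// => i j; rewrite !mem_iota !add0n !ltnS => iK jK.
  move/eqP; rewrite -subr_eq0 -rmorphB /= Fp_intr_eq0// dvdzE /= => ij.
  apply/eqP; rewrite -eqz_nat -subr_eq0 -absz_eq0; apply: contraTT ij => ij0.
  by rewrite gtnNdvd ?lt0n//; lia.
have sL : size L = K.+1 by rewrite size_map size_iota.
pose Ap' : {mpoly 'F_p[m]} := map_mpoly intr A.
(* The leading coefficient is less than p in absolute value and survives modulo p. *)
have Ap0 : Ap' != 0.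
  have := mleadc_eq0 A; rewrite (negbTE A0) => /negbT A1.
  apply/eqP => /(congr1 (mcoeff (mlead A))); rewrite mcoeff_map_mpoly mcoeff0 => /eqP.
  apply/negP; rewrite /= Fp_intr_eq0// dvdzE /= gtnNdvd ?absz_gt0//.
  apply: leq_trans Ap; rewrite ltnS /mnorm (bigD1_seq (mlead A)) ?msupp_uniq ?mlead_supp//=.
  exact: leq_addr.
have Ap_size : (msize Ap' <= msize A)%N.
  apply/bigmax_leqP_seq => mu; rewrite mcoeff_msupp mcoeff_map_mpoly => H _.
  apply: msize_mdeg_lt; rewrite mcoeff_msupp; apply: contraNneq H => ->.
  by rewrite /= rmorph0.
have [|v _ Av] := mpoly_nonvanishing Ap0 uL.
  by rewrite sL ltnS /K leq_mul2l (leq_trans Ap_size) ?orbT.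
pose Ep : 'M['F_p]_m := map_mx intr E.
have Eu : Ep \in unitmx.
  have /(congr1 determinant) : map_mx intr N *m Ep = (x%:~R)%:M by rewrite -map_mxM NE map_scalar_mx.
  rewrite det_mulmx det_scalar => H; rewrite unitmxE unitfE; apply/eqP => dE; move/eqP: H.
  by rewrite dE mulr0 eq_sym expf_eq0 Fp_intr_eq0// (negbTE px) andbF.
pose B := map_mpoly intr (evz A (aff 0 E ord0)) : {mpoly 'F_p[m]}.
have BE (s : 'rV['F_p]_m) : B.@[s ord0] = evz A ((s *m Ep) ord0).
  rewrite /B evz_map evz_subst; apply: eq_evz => i; rewrite evz_aff.
  by rewrite raddf0 add0r.
have B0 : B != 0.
  apply: contraNneq Av => B0; have := BE (v *m invmx Ep).
  by rewrite mulmxKV// B0 meval0 /Ap' evz_map => <-.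
have B_size : (msize B <= (msize A).+1)%N.
  apply: (@leq_trans (msize (evz A (aff 0 E ord0)))); last first.
    by apply: leq_trans (msize_evz _ (msize_aff 0 E)) _; rewrite muln1.
  apply/bigmax_leqP_seq => mu; rewrite mcoeff_msupp mcoeff_map_mpoly => H _.
  apply: msize_mdeg_lt; rewrite mcoeff_msupp; apply: contraNneq H => ->.
  by rewrite /= rmorph0.
have [|s sL' Bs] := mpoly_nonvanishing B0 uL.
  by rewrite sL ltnS /K leq_mul2l B_size orbT.
have /choice[c cP] : forall i, exists c : nat, (c < K.+1)%N /\ s ord0 i = (Posz c)%:~R.
  by move=> i; have /mapP[c + sc] := sL' i; rewrite mem_iota add0n => cK; exists c.
exists (\row_i Posz (c i)).
  by move=> i; rewrite mxE map_f// mem_iota add0n (cP i).1.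
rewrite -Fp_intr_eq0// -[_%:~R]/(intr (evz A _)) (evz_morph intr).
apply: contraNneq Bs => H; rewrite BE -[X in _ == X]H; apply/eqP/eq_evz => i /=.
rewrite !mxE rmorph_sum; apply: eq_bigr => l _.
by rewrite rmorphM !mxE (cP l).2.
Qed.

(** * Elimination along lines *)

Definition nats (n : nat) : seq int := [seq Posz j | j <- iota 0 n].

Lemma size_nats n : size (nats n) = n.
Proof. by rewrite size_map size_iota. Qed.

Lemma mem_nats n a : (a \in nats n) = (0 <= a) && (`|a| < n)%N.
Proof.
apply/mapP/andP => [[j + ->]|[a0 an]]; first by rewrite mem_iota add0n.
by exists `|a|%N; [rewrite mem_iota add0n|rewrite gez0_abs].
Qed.

Definition grid (m n : nat) (v : 'rV[int]_m) : Prop := forall i, v ord0 i \in nats n.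

Lemma atmost_grid (m n : nat) : atmost (@grid m n) (n%:R ^+ m).
Proof.
have := @atmost_row int m (fun=> fun a => a \in nats n) (fun=> n%:R).
rewrite prodr_const card_ord; apply=> i.
by have := @atmost_seq _ (nats n); rewrite size_nats.
Qed.

Lemma grid_seq (m n : nat) : exists S : seq 'rV[int]_m, [/\ uniq S, size S = (n ^ m)%N &
  forall v, v \in S -> grid n v].
Proof.
exists [seq (\row_i Posz (tnth t i) : 'rV[int]_m) | t : m.-tuple 'I_n]; split.
- rewrite map_inj_uniq ?enum_uniq// => t t' /rowP tt; apply/eq_from_tnth => i.
  by have := tt i; rewrite !mxE => -[] /val_inj.
- by rewrite size_image card_tuple card_ord.
- by move=> v /mapP[t _ ->] i; rewrite mxE mem_nats /= ltn_ord.
Qed.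

Lemma mulmx_bound (m X e : nat) (s : 'rV[int]_m) (E : 'M[int]_m) j :
  (forall i, (`|s ord0 i| <= X)%N) -> (forall i j, (`|E i j| <= e)%N) ->
  (`|(s *m E) ord0 j| <= m * (X * e))%N.
Proof.
move=> sX Ee; rewrite mxE; apply: (@leq_trans (\sum_(i < m) X * e)%N); last first.
  by rewrite sum_nat_const card_ord.
elim/big_rec2 : _ => [//|i a c _ H]; apply: leq_trans (abszD_le _ _) _.
by rewrite leq_add// abszM leq_mul.
Qed.

Lemma four_term_bound (a b c d : int) (A B C D : nat) : (`|a| <= A)%N -> (`|b| <= B)%N ->
  (`|c| <= C)%N -> (`|d| <= D)%N -> (`|(a + b - c + d)%R| <= A + B + C + D)%N.
Proof. lia. Qed.

Lemma three_term_bound (a b c : int) (A B C : nat) : (`|a| <= A)%N -> (`|b| <= B)%N ->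
  (`|c| <= C)%N -> (`|(a - b - c)%R| <= A + B + C)%N.
Proof. lia. Qed.

Lemma add_le_linear (m j u : nat) : (m + j <= 1 + 2 * m + u + 2 * j)%N.
Proof. lia. Qed.

Lemma absz_sub_lt (a b : int) (n : nat) : 0 <= a -> (`|a| < n)%N -> 0 <= b -> (`|b| < n)%N ->
  (`|(a - b)%R| < n)%N.
Proof. lia. Qed.

Lemma shift_inv (V : zmodType) (t u v w z : V) : z = t + u - v + w -> t = z - w - u + v.
Proof. by move=> ->; rewrite addrK [t + u - v]addrAC addrK subrK. Qed.

(** * Translation by short lattice vectors *)

Section MainCount.
Variables (m : nat) (Q0 : {mpoly int[m]}).
Hypotheses (Q0_homog : Q0 \is 2.-homog) (Q0_neq0 : Q0 != 0).
Variables (r k : nat) (f0 : {mpoly int[1 + m]}) (F : 'I_r -> {mpoly int[1 + m]}).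
Hypotheses (f0_homog : f0 \is k.-homog) (k_gt0 : (0 < k)%N).

(** The restriction of f0 to x = 0. It is also the coefficient of degree k of f0 along the lines of
    direction (0, e), independent of the base point. *)
Definition top_form : {mpoly int[m]} := evz f0 (pt 0 (\row_i 'X_i)).

Lemma evz_top_form (R : comNzRingType) (e : 'rV[R]_m) :
  evz top_form (e ord0) = evz f0 (pt 0 e).
Proof.
rewrite evz_subst; apply: eq_evz => i; case: (split_ordP i) => j ->.
  by rewrite !pt_l /evz mmap0.
by rewrite !pt_r mxE /evz mmapX mmap1U.
Qed.

Hypothesis top_form_neq0 : top_form != 0.
Hypothesis no_common_root : forall (x : int) (e : 'rV[int]_m), x != 0 ->
  evz top_form (e ord0) != 0 -> exists v : 'rV[algC]_m, forall t : algC,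
    evz f0 (pt x%:~R (v + t *: map_mx intr e)) = 0 ->
    exists j, evz (F j) (pt x%:~R (v + t *: map_mx intr e)) != 0.

Let Phi c : {mpoly int[(1 + m) + (1 + m)]} := line_res f0 (power_comb F c).

(* As a polynomial in s, the resultant along the line of direction e through the
   point (x, z - s E). *)
Definition line_res_at (x : int) (z e : 'rV[int]_m) (E : 'M[int]_m) (c : nat) : {mpoly int[m]} :=
  evz (Phi c) (pair_val (pt x%:MP (aff z (- E))) (pt 0 (map_mx (@mpolyC m int) e))).

Lemma evz_line_res_at (R : comNzRingType) x z e E c (s : 'rV[R]_m) :
  evz (line_res_at x z e E c) (s ord0) =
  evz (Phi c) (pair_val (pt x%:~R (map_mx intr z - s *m map_mx intr E)) (pt 0 (map_mx intr e))).
Proof.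
rewrite /line_res_at evz_subst; apply: eq_evz => i; rewrite /pair_val.
case: (fintype.split i) => j; case: (split_ordP j) => l ->; rewrite ?(pt_l, pt_r).
- by rewrite /evz mmapC.
- by rewrite evz_aff raddfN /= mulmxN.
- by rewrite /evz mmap0.
- by rewrite !mxE /evz mmapC.
Qed.

Lemma msize_line_res_at x z e E c : (msize (line_res_at x z e E c) <= (msize (Phi c)).+1)%N.
Proof.
rewrite -[msize (Phi c)]muln1; apply: msize_evz => i; rewrite /pair_val.
have CC (a : int) : (msize (a%:MP : {mpoly int[m]}) <= 2)%N.
  by rewrite mmeasureC (leq_trans (leq_b1 _)).
case: (fintype.split i) => j; case: (split_ordP j) => l ->; rewrite ?(pt_l, pt_r).
- exact: CC.
- exact: msize_aff.
- by rewrite mmeasure0.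
- by rewrite mxE; exact: CC.
Qed.

(** If all kr + 1 resultants vanished identically in s, one could solve z - s E = v over the
    algebraic numbers, where the line through v has no common root, against [common_root]. *)
Lemma line_res_at_neq0 (x : int) (z e : 'rV[int]_m) (E N : 'M[int]_m) : x != 0 -> N *m E = x%:M -> evz top_form (e ord0) != 0 ->
  exists2 c, (c <= k * r)%N & line_res_at x z e E c != 0.
Proof.
move=> x0 NE Ae; apply: contrapT => no.
have res0 c : (c <= k * r)%N -> line_res_at x z e E c = 0.
  by move=> ck; apply/eqP; apply: contrapT => H; apply: no; exists c => //; apply/negP.
have [v vP] := no_common_root x0 Ae.
have Eu := @unit_of_mul_scalar algC _ _ _ _ x0 NE.
have fe : evz f0 (pt 0 (map_mx intr e : 'rV[algC]_m)) != 0.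
  rewrite -evz_top_form; apply: contraNneq Ae => H.
  rewrite -(intr_eq0 algC) -[_%:~R]/(intr (evz _ _)) (evz_morph intr).
  by rewrite -[X in _ == X]H; apply/eqP/eq_evz => i; rewrite mxE.
have [c ck|t [ft Ft]] := common_root (a := pt x%:~R v) f0_homog fe (F := F).
  have := evz_line_res_at x z e E c ((map_mx intr z - v) *m invmx (map_mx intr E)).
  by rewrite (mulmxKV Eu) subKr (res0 c ck) {1}/evz mmap0 => /esym.
have {}ft : evz f0 (pt x%:~R (v + t *: map_mx intr e)) = 0.
  by rewrite -[RHS]ft; apply: eq_evz => i; rewrite pt_line.
have [j /eqP] := vP t ft; apply; rewrite -[RHS](Ft j).
by apply: eq_evz => i; rewrite pt_line.
Qed.

Let K := (m * (msize top_form).+1)%N.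
Variable C : nat.
Hypothesis C_spec : forall (x : int) (y : 'rV[int]_m) (b mu : nat), x != 0 -> (0 < b)%N -> (0 < mu)%N ->
  (forall w : 'rV[int]_m, w != 0 -> (x %| dot w y)%Z ->
     exists i, (C * mu * `|x| < b * `|w ord0 i|)%N) ->
  exists E N : 'M[int]_m, [/\ forall k : 'rV[int]_m, lat x y (k *m E), N *m E = x%:M &
    forall i j, (`|E i j| * mu <= b)%N].

Variables (b mu T Y : nat).
Let D2 := (msize Q0).+1.
Let J := (4 * T ^ 2)%N.
(** Covers b for y, m b for s E, m K b for the multiple of the direction and J b for the added
    multiple of the generator. Translating back leads to points of size at most 2 b3. *)
Let b3 := ((1 + 2 * m + m * K + 2 * J) * b)%N.
Hypotheses (mu_gt0 : (0 < mu)%N) (mu_le : (mu <= b)%N).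
Hypothesis T_divisors : forall q, (0 < q <= Y)%N -> (size (divisors q) <= T)%N.
Hypotheses (mu_A : (mnorm top_form <= mu)%N) (mu_K : (K <= mu)%N) (mu_D2 : (2 * (m * D2) <= mu)%N).
Hypotheses (Y_b : (b <= Y)%N) (Y_q : (mnorm Q0 * b3 ^ msize Q0 <= Y)%N).
Hypothesis Y_res : forall c, (c <= k * r)%N -> (mnorm (Phi c) * (2 * b3) ^ msize (Phi c) <= Y)%N.
Variable D3 : nat.
Hypothesis D3_res : forall c, (c <= k * r)%N -> ((msize (Phi c)).+1 < D3)%N.

Let b_gt0 : (0 < b)%N. Proof. exact: leq_trans mu_le. Qed.
Let box (X : nat) (v : 'rV[int]_m) := forall i, (`|v ord0 i| <= X)%N.

Let prime_cond (x : int) (y : 'rV[int]_m) (p : nat) : Prop :=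
  [/\ prime p, (mu < p)%N, ~~ (p%:Z %| x)%Z, (p%:Z %| evz f0 (pt x y))%Z &
    forall j, (p%:Z %| evz (F j) (pt x y))%Z].

Definition main_pair (t : int * 'rV[int]_m) : Prop :=
  [/\ t.1 != 0, (`|t.1| <= b)%N, box b t.2, (t.1 %| qval Q0 t.2)%Z &
    ~ bad_pair Q0 C b mu t /\ exists p, prime_cond t.1 t.2 p].

Let good_basis (x : int) (L : 'rV[int]_m -> Prop) (E : 'M[int]_m) : Prop :=
  [/\ forall q : 'rV[int]_m, L (q *m E), exists N, N *m E = x%:M & forall i j, (`|E i j| * mu <= b)%N].

(** The basis [Eof] and the generator [yof] are functions of x and of the lattice, not of y: any
    other generator of the same lattice gives them back. *)
Let Eof (x : int) (L : 'rV[int]_m -> Prop) : 'M[int]_m :=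
  xget 0 (good_basis x L : set 'M[int]_m).

Let yof (x : int) (L : 'rV[int]_m -> Prop) : 'rV[int]_m :=
  xget 0 ((fun y => lat x y = L /\ box b y) : set 'rV[int]_m).

Let main_basis (t : int * 'rV[int]_m) : main_pair t ->
  good_basis t.1 (lat t.1 t.2) (Eof t.1 (lat t.1 t.2)).
Proof.
move=> [x0 xb yb xq [nbad _]].
apply: (@xgetPex _ 0 (good_basis t.1 (lat t.1 t.2) : set 'M[int]_m)).
have [w w0 xw|E [N [h1 h2 h3]]] := @C_spec t.1 t.2 b mu x0 b_gt0 mu_gt0.
  2: by exists E; split=> //; exists N.
apply: contrapT => no; apply: nbad; split=> //; exists w; split=> // i.
by rewrite leqNgt; apply/negP => H; apply: no; exists i.
Qed.

Let main_gen (t : int * 'rV[int]_m) : main_pair t ->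
  lat t.1 (yof t.1 (lat t.1 t.2)) = lat t.1 t.2 /\ box b (yof t.1 (lat t.1 t.2)).
Proof.
by move=> [x0 xb yb xq _]; apply: (@xgetPex _ 0 ((fun y => lat t.1 y = lat t.1 t.2 /\ box b y) : set 'rV[int]_m)); exists t.2.
Qed.

(* The translate y + s E - a (sigma E), where E is the short basis, (s, a) ranges
   over mu^(m+1) values and top_form does not vanish modulo p at sigma E. *)
Let shifted (t : int * 'rV[int]_m) (g : 'rV[int]_m * ('rV[int]_m * int)) : 'rV[int]_m :=
  let E := Eof t.1 (lat t.1 t.2) in t.2 + g.2.1 *m E - g.2.2 *: (g.1 *m E).

Let shift_cond (tg : (int * 'rV[int]_m) * ('rV[int]_m * ('rV[int]_m * int))) : Prop :=
  let: (t, g) := tg in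
  [/\ main_pair t, grid K.+1 g.1, grid mu g.2.1, g.2.2 \in nats mu &
    qval Q0 (shifted t g) != 0 /\
    exists p, prime_cond t.1 t.2 p /\
      ~~ (p%:Z %| evz top_form ((g.1 *m Eof t.1 (lat t.1 t.2)) ord0))%Z].

Let muR : 0 < mu%:R :> rat. Proof. by rewrite ltr0n. Qed.

(** Since 2 m D2 <= mu, at most half of the mu^(m+1) shifts lead to a zero of Q0. *)
Let many_shifts (t : int * 'rV[int]_m) : main_pair t ->
  exists l : seq ('rV[int]_m * ('rV[int]_m * int)),
    [/\ uniq l, mu%:R ^+ m * mu%:R / 2 <= (size l)%:R :> rat &
        forall g, g \in l -> shift_cond (t, g)].
Proof.
move=> tm; have [Lq [N NE] Eb] := main_basis tm; set E := Eof _ _ in Lq NE Eb.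
case: (tm) => x0 _ _ _ [_ [p pc]]; case: (pc) => pp mup px _ _.
have [s sK sp] := small_direction pp (leq_ltn_trans mu_A mup) (leq_ltn_trans mu_K mup) top_form_neq0 px NE.
have [S [uS sS Sg]] := grid_seq m mu.
pose sh (g : 'rV[int]_m * int) := t.2 + g.1 *m E - g.2 *: (s *m E).
pose l := [seq g <- [seq (v, a) | v <- S, a <- nats mu] | qval Q0 (sh g) != 0].
have ul0 : uniq [seq (v, a) | v <- S, a <- nats mu].
  by apply: allpairs_uniq => //; [exact: iota_int_uniq|move=> [? ?] [? ?]].
exists [seq (s, g) | g <- l]; split.
- by rewrite map_inj_uniq ?filter_uniq// => g g' [].
- rewrite size_map.
  have : (size [seq g <- [seq (v, a) | v <- S, a <- nats mu] | ~~ (qval Q0 (sh g) != 0)])%:R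
      <= mu%:R * ((m * D2)%:R * mu%:R ^+ m / mu%:R) :> rat.
    have H : atmost (fun g : 'rV[int]_m * int => [/\ grid mu g.1, g.2 \in nats mu & qval Q0 (sh g) = 0])
        (mu%:R * ((m * D2)%:R * mu%:R ^+ m / mu%:R)).
      apply: (@atmost_rel ('rV[int]_m * int)%type int _ (fun a => a \in nats mu) (fun g a => g.2 = a)).
      + by move=> g [_ ga _]; exists g.2.
      + by have := @atmost_seq _ (nats mu); rewrite size_nats.
      + move=> a _; apply: (@atmost_inj ('rV[int]_m * int)%type 'rV[int]_m _ _ fst _ _ _
          (@affine_zeros m D2 Q0 (t.2 - a *: (s *m E)) E N t.1 mu Q0_neq0 (leqnn _) x0 NE mu_gt0)).
          move=> g [[gs _ qg] ga]; split=> //; rewrite -[RHS]qg /sh ga addrAC.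
          by [].
        by move=> [v1 a1] [v2 a2] [_ /= ->] [_ /= ->] /= ->.
      + by rewrite divr_ge0// mulr_ge0// exprn_ge0.
    apply: H; first by rewrite filter_uniq.
    move=> g; rewrite mem_filter negbK => /andP[/eqP qg /allpairsP[[v a] /= [vS aM gE]]].
    by split=> //; rewrite gE //=; exact: Sg.
  have : (size l + size [seq g <- [seq (v, a) | v <- S, a <- nats mu] | ~~ (qval Q0 (sh g) != 0)])%N
      = (mu ^ m * mu)%N.
    by rewrite /l !size_filter count_predC size_allpairs sS size_nats.
  move=> /(congr1 (fun n => n%:R : rat)); rewrite natrD natrM natrX => E1.
  have mm : 0 <= mu%:R ^+ m :> rat by rewrite exprn_ge0.
  have -> : mu%:R * ((m * D2)%:R * mu%:R ^+ m / mu%:R) = (m * D2)%:R * mu%:R ^+ m :> rat.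
    by field; rewrite gt_eqF.
  have : 2 * (m * D2)%:R * mu%:R ^+ m <= mu%:R * mu%:R ^+ m :> rat.
    by rewrite ler_wpM2r// -natrM ler_nat.
  move: E1; set P := mu%:R ^+ m * mu%:R; rewrite [mu%:R * mu%:R ^+ m]mulrC -/P.
  by rewrite -mulrA; set Z := _ * mu%:R ^+ m; lra.
- move=> _ /mapP[[v a] + ->]; rewrite mem_filter => /andP[qg /allpairsP[[v' a'] /= [vS aM vE]]].
  case: vE qg => -> -> qg.
  split; [exact: tm|exact: sK|exact: Sg|exact: aM|split; [exact: qg|by exists p]].
Qed.

(** Up to T and constants both terms are mu^m, a factor mu below the number of shifts. *)
Let fiber_bound : rat := mu%:R * ((m * D3)%:R * mu%:R ^+ m / mu%:R) + mu%:R ^+ m * (T%:R * k%:R).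

(** Modulo p the restriction of f0 to the line has degree exactly k, its top coefficient being the
    value of [top_form] at e. The parameters are below mu < p and stay distinct. *)
Let root_count (x : int) (v e : 'rV[int]_m) (p : nat) : prime p -> (mu < p)%N ->
  ~~ (p%:Z %| evz top_form (e ord0))%Z ->
  atmost (fun t => t \in nats mu /\ (p%:Z %| evz f0 (pt x (v + t *: e)))%Z) k%:R.
Proof.
move=> pp mup pe s us st; rewrite ler_nat -ltnS.
pose a i := (pt x v i)%:~R : 'F_p; pose d i := (pt 0 e i)%:~R : 'F_p.
have fd : evz f0 d != 0.
  move: pe; rewrite -Fp_intr_eq0// evz_top_form -[_%:~R]/(intr (evz _ _)) (evz_morph intr).
  by move=> pe.
rewrite -(size_line_polyE f0_homog a fd) -(size_map (intr : int -> 'F_p)).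
have p0 : line_poly f0 a d != 0 by rewrite -size_poly_gt0 (size_line_polyE f0_homog a fd).
apply: max_poly_roots => //.
  apply/allP => _ /mapP[t /st[_ ft] ->]; apply/rootP; rewrite horner_line_poly.
  move: ft; rewrite -Fp_intr_eq0// -[_%:~R]/(intr (evz _ _)) (evz_morph intr) => /eqP ft.
  by rewrite -[RHS]ft; apply: eq_evz => i; rewrite /= -pt_line rmorphD rmorphM.
rewrite map_inj_in_uniq// => t t' /st[+ _] /st[+ _].
rewrite !mem_nats => /andP[t0 tm] /andP[t0' tm'] tt.
have : (p%:Z %| t - t')%Z by rewrite -Fp_intr_eq0// rmorphB /= tt subrr.
rewrite dvdzE /= => H; apply/eqP; rewrite -subr_eq0 -absz_eq0.
apply: contraLR (H); rewrite -lt0n => H0; rewrite gtnNdvd//.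
by apply: leq_trans mup; rewrite ltnS ltnW // absz_sub_lt.
Qed.

(** The entries are ((x, z'), (j, s0)), where z' = z + j y0 generates the lattice of y. They
    determine the lattice, hence E and y0, and then z and the direction e = s0 E. *)
Let shift_key : eqType := ((int * 'rV[int]_m) * (int * 'rV[int]_m))%type.

Let key_ok (u : shift_key) : Prop :=
  [/\ [/\ (`|u.1.1| <= b)%N, box b3 u.1.2, qval Q0 u.1.2 != 0 & (u.1.1 %| qval Q0 u.1.2)%Z],
      u.2.1 \in nats J & grid K.+1 u.2.2].

Let key_rel (tg : (int * 'rV[int]_m) * ('rV[int]_m * ('rV[int]_m * int))) (u : shift_key) : Prop :=
  [/\ u.1.1 = tg.1.1, u.2.2 = tg.2.1,
      u.1.2 = shifted tg.1 tg.2 + u.2.1 *: yof tg.1.1 (lat tg.1.1 tg.1.2) &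
      lat u.1.1 u.1.2 = lat tg.1.1 tg.1.2].

Let basis_entry (t : int * 'rV[int]_m) : main_pair t ->
  forall i j, (`|Eof t.1 (lat t.1 t.2) i j| <= b %/ mu)%N.
Proof. by move=> /main_basis[_ [N _ H]] i j; rewrite leq_divRL. Qed.

Let mu_div (X : nat) : (X <= mu)%N -> (X * (b %/ mu) <= b)%N.
Proof. by move=> Xm; apply: leq_trans (leq_divM b mu); rewrite mulnC leq_mul2l Xm orbT. Qed.

Let shift_key_exists tg : shift_cond tg -> exists2 u, key_ok u & key_rel tg u.
Proof.
case: tg => t [s0 [s a]] [tm /= gs0 gs ga [qz _]].
have [Lq [N NE _]] := main_basis tm; have [Ly yb] := main_gen tm.
have En := basis_entry tm; case: (tm) => x0 xb tb tq _.
set E := Eof _ _ in Lq NE En *; set y0 := yof _ _ in Ly yb.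
have [||j [jJ Lj qj]] := @lat_generator_shift m Q0 t.1 y0 (shifted t (s0, (s, a))) J Q0_homog x0 _ _ qz.
- rewrite leq_mul2l leq_exp2r//=; apply: T_divisors.
  by rewrite absz_gt0 x0 (leq_trans xb).
- rewrite Ly /shifted /= -/E; apply: lat_sub; first by apply: lat_sub (Lq _); exact: lat_refl.
  by rewrite (_ : - (a *: (s0 *m E)) = (- a *: s0) *m E) // scaleNr mulNmx scalemxAl.
exists ((t.1, shifted t (s0, (s, a)) + j%:Z *: y0), (j%:Z, s0)); last by split=> //=; rewrite Lj.
split=> //=; last by rewrite mem_nats.
split=> //.
- move=> i.
  have -> : (shifted t (s0, (s, a)) + j%:Z *: y0) ord0 i =
      t.2 ord0 i + (s *m E) ord0 i - a * (s0 *m E) ord0 i + j%:Z * y0 ord0 i.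
    by rewrite /shifted /= -/E; move: (s *m E) (s0 *m E) => u v; rewrite !mxE.
  have h1 : (`|(s *m E) ord0 i| <= m * b)%N.
    apply: (@leq_trans (m * (mu * (b %/ mu)))%N); last by rewrite leq_mul2l mu_div ?orbT.
    by apply: mulmx_bound En => l; move: (gs l); rewrite mem_nats => /andP[_ /ltnW].
  have h2 : (`|(s0 *m E) ord0 i| <= m * (K * (b %/ mu)))%N.
    by apply: mulmx_bound En => l; move: (gs0 l); rewrite mem_nats => /andP[_].
  have h3 : (`|(a * (s0 *m E) ord0 i)%R| <= m * K * b)%N.
    move: ga; rewrite mem_nats => /andP[_ /ltnW am]; rewrite abszM.
    apply: leq_trans (leq_mul am h2) _; rewrite mulnCA [(mu * (K * _))%N]mulnCA !mulnA -mulnA.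
    by rewrite leq_mul2l mu_div ?orbT.
  have h4 : (`|(j%:Z * y0 ord0 i)%R| <= J * b)%N by rewrite abszM leq_mul// ltnW.
  apply: leq_trans (four_term_bound (tb i) h1 h3 h4) _.
  rewrite /b3 -{1}[b]mul1n -!mulnDl leq_mul2r; apply/orP; right.
  by rewrite leq_add ?leq_pmull// leq_add2r leq_add2l leq_pmull.
- by apply: (lat_qval (y := y0)) => //; [apply: (lat_qval Q0_homog tq); rewrite -Ly; exact: lat_refl|rewrite -Lj; exact: lat_refl].
Qed.

Let key_count : atmost key_ok ((2 * b3%:R + 1) ^+ m * (2 * T%:R * (J%:R * K.+1%:R ^+ m))).
Proof.
have c0 : 0 <= J%:R * K.+1%:R ^+ m :> rat by rewrite mulr_ge0 ?exprn_ge0 ?ler0n.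
apply: (@atmost_rel shift_key 'rV[int]_m _ (box b3) (fun u z => u.1.2 = z)).
- by move=> u [[_ ub _ _] _ _]; exists u.1.2.
- exact: atmost_box.
- move=> z zb; have [qz|qz] := boolP (qval Q0 z == 0).
    move=> [|u us] _ sA; first by rewrite mulr_ge0 // mulr_ge0 ?ler0n.
    by have [[[_ _ uq _] _ _] uz] := sA u (mem_head _ _); move: uq; rewrite uz qz.
  apply: (@atmost_rel shift_key int _ (fun x => (x %| qval Q0 z)%Z) (fun u x => u.1.1 = x)).
  + by move=> u [[[_ _ _ uq] _ _] uz]; exists u.1.1; rewrite // -uz.
  + apply: atmost_divisors => //; apply: T_divisors; rewrite absz_gt0 qz /=.
    by apply: leq_trans (qval_bound _ _ zb) Y_q; rewrite /b3 muln_gt0 b_gt0 andbT -addnA -addnA.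
  + move=> x _.
    apply: (@atmost_rel shift_key int _ (fun j => j \in nats J) (fun u j => u.2.1 = j)).
    * by move=> u [[[_ uj _] _] _]; exists u.2.1.
    * by have := @atmost_seq _ (nats J); rewrite size_nats.
    * move=> j _; apply: (@atmost_inj shift_key 'rV[int]_m _ (@grid m K.+1) (fun u => u.2.2)).
      - by move=> u [[[[_ _ us] _] _] _].
      - by move=> [[x1 z1] [j1 s1]] [[x2 z2] [j2 s2]] [[[_ /= ->] /= ->] /= ->]
          [[[_ /= ->] /= ->] /= ->] /= ->.
      - exact: atmost_grid.
    * by rewrite exprn_ge0 ?ler0n.
  + exact: c0.
- by rewrite mulr_ge0 // mulr_ge0 ?ler0n.
Qed.

Let fiber_bound_ge0 : 0 <= fiber_bound.
Proof.
have mu0 := ltW muR; rewrite addr_ge0 //; last by rewrite mulr_ge0 ?exprn_ge0 // mulr_ge0 ?ler0n.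
by rewrite mulr_ge0 // divr_ge0 // mulr_ge0 ?exprn_ge0 ?ler0n.
Qed.

(* Given z, the unknown y lies on a line of direction e through z - s E: either s is a
   zero of the resultant, or p divides its value and y is one of at most k points. *)
Let key_fiber (u : shift_key) : key_ok u ->
  atmost (fun tg => shift_cond tg /\ key_rel tg u) fiber_bound.
Proof.
case: u => -[x z'] [j s0] [[/= xb z'b qz' xq] jJ gs0].
have [[[t0 g0] [sc0 kr0]]|no] := pselect (exists tg, shift_cond tg /\ key_rel tg ((x, z'), (j, s0))); last first.
  by move=> [|tg l] _ sA //; case: no; exists tg; apply: sA; exact: mem_head.
set L := lat x z'; set E := Eof x L; set y0 := yof x L.
have [tm [_ _ _ _ [_ [p0 [[p0p _ _ _ _] p0e]]]]] : main_pair t0 /\ shift_cond (t0, g0) by case: sc0.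
have [/= xt st zt Lt] := kr0.
have [_ [N NE] _] := main_basis tm; have [_ yb] := main_gen tm; have En := basis_entry tm.
rewrite -Lt -xt -/L -/E -/y0 -?st in NE yb En p0e.
have x0 : x != 0 by case: (tm); rewrite xt.
set e := s0 *m E in p0e; set z := z' - j *: y0.
have te : evz top_form (e ord0) != 0 by apply: contraNneq p0e => ->; exact: dvdz0.
have [c ck Pn] := line_res_at_neq0 z x0 NE te; set P := line_res_at x z e E c in Pn.
(* Since y = z - s E + a e, only the pair (s, a) remains to be counted. *)
pose G (h : 'rV[int]_m * int) : Prop := [/\ grid mu h.1, h.2 \in nats mu &
  exists p, prime_cond x (z - h.1 *m E + h.2 *: e) p /\ ~~ (p%:Z %| evz top_form (e ord0))%Z].
apply: (@atmost_inj ((int * 'rV[int]_m) * ('rV[int]_m * ('rV[int]_m * int)))%type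
   ('rV[int]_m * int)%type _ G (fun tg => tg.2.2)).
- move=> [[t1 t2] [g1 [s a]]] [[/= tm' _ gs ga [_ [p [pc pe]]]] [/= tx gE zE tL]].
  subst t1 g1; rewrite /shifted /= -tL -/L -/E -/y0 -/e in zE pe.
  split=> //=; exists p; split=> //.
  by rewrite /z -(shift_inv zE).
- move=> [[t1 t2] [g1 [s a]]] [[t1' t2'] [g1' [s' a']]] [_ [/= tx gE zE tL]] [_ [/= tx' gE' zE' tL']].
  case=> ss aa; subst s' a' t1 t1' g1 g1'; congr ((_, _), _).
  move: zE zE'; rewrite /shifted /= -tL -tL' => /shift_inv -> /shift_inv ->.
  by [].
have H1 : atmost (fun h => G h /\ evz P (h.1 ord0) = 0) (mu%:R * ((m * D3)%:R * mu%:R ^+ m / mu%:R)).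
  apply: (@atmost_rel ('rV[int]_m * int)%type int _ (fun a => a \in nats mu) (fun g a => g.2 = a)).
  + by move=> g [[_ ga _] _]; exists g.2.
  + by have := @atmost_seq _ (nats mu); rewrite size_nats.
  + move=> a _; apply: (@atmost_inj ('rV[int]_m * int)%type 'rV[int]_m _ _ fst _ _ _
          (@affine_zeros m D3 P 0 1%:M 1%:M 1 mu Pn (leq_ltn_trans (msize_line_res_at _ _ _ _ _) (D3_res ck)) isT (mulmx1 _) mu_gt0)).
      by move=> g [[[gs _ _] Pg] _]; split=> //; rewrite mulmx1 add0r.
    by move=> [v1 a1] [v2 a2] [_ /= ->] [_ /= ->] /= ->.
  + by rewrite divr_ge0 ?ler0n // mulr_ge0 ?exprn_ge0 ?ler0n.
have H2 : atmost (fun h => G h /\ evz P (h.1 ord0) != 0) (mu%:R ^+ m * (T%:R * k%:R)).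
  have Tk0 : 0 <= T%:R * k%:R :> rat by rewrite mulr_ge0 ?ler0n.
  apply: (@atmost_rel ('rV[int]_m * int)%type 'rV[int]_m _ (@grid m mu) (fun g a => g.1 = a)).
  + by move=> g [[gs _ _] _]; exists g.1.
  + exact: atmost_grid.
  + move=> s gs; have [Ps|Ps] := boolP (evz P (s ord0) == 0).
      move=> [|h l] _ sA //; have [[_ +] hs] := sA h (mem_head _ _).
      by rewrite hs Ps.
    have PsE : evz P (s ord0) = evz (Phi c) (pair_val (pt x (z - s *m E)) (pt 0 e)).
      by rewrite evz_line_res_at !intz_map intz.
    have PsY : (`|evz P (s ord0)| <= Y)%N.
      rewrite PsE; apply: leq_trans (Y_res ck).
      have b3p : (b <= b3)%N by apply: leq_pmull; rewrite -addnA -addnA.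
      apply: evz_bound; first by apply: leq_trans b_gt0 (leq_trans b3p _); exact: leq_pmull.
      have eb l : (`|e ord0 l| <= m * b)%N.
        apply: (@leq_trans (m * (K * (b %/ mu)))%N); last by rewrite leq_mul2l mu_div ?orbT.
        by apply: mulmx_bound En => l'; move: (gs0 l'); rewrite mem_nats => /andP[_].
      have sb l : (`|(s *m E) ord0 l| <= m * b)%N.
        apply: (@leq_trans (m * (mu * (b %/ mu)))%N); last by rewrite leq_mul2l mu_div ?orbT.
        by apply: mulmx_bound En => l'; move: (gs l'); rewrite mem_nats => /andP[_ /ltnW].
      have mb3 : (m * b + J * b <= b3)%N.
        by rewrite -mulnDl leq_mul2r add_le_linear orbT.
      move=> i; rewrite /pair_val; case: (fintype.split i) => l; case: (split_ordP l) => l' ->; rewrite ?(pt_l, pt_r).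
      - by apply: leq_trans xb _; rewrite (leq_trans b3p)// leq_pmull.
      - rewrite (_ : (z - s *m E) ord0 l' = z' ord0 l' - j * y0 ord0 l' - (s *m E) ord0 l').
          have jb : (`|(j * y0 ord0 l')%R| <= J * b)%N.
            by move: jJ; rewrite mem_nats abszM => /andP[_ /ltnW H]; rewrite leq_mul.
          apply: leq_trans (three_term_bound (z'b l') jb (sb l')) _.
          by rewrite mul2n -addnn -addnA leq_add2l addnC.
        by rewrite /z; move: (s *m E) => u; rewrite !mxE.
      - by [].
      - apply: leq_trans (eb _) (leq_trans (leq_addr (J * b) _) (leq_trans mb3 _)).
        exact: leq_pmull.
    pose Bp p := [/\ p \in divisors `|evz P (s ord0)|, prime p, (mu < p)%N & ~~ (p%:Z %| evz top_form (e ord0))%Z].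
    apply: (@atmost_rel ('rV[int]_m * int)%type nat _ Bp (fun g p =>
        (p%:Z %| evz f0 (pt x (z - s *m E + g.2 *: e)))%Z)).
    * move=> h [[[_ ha [p [[pp mup px pf pF] pe]]] _] hs].
      exists p; last by rewrite -hs.
      split=> //; rewrite -dvdn_divisors ?absz_gt0 // -[(p %| _)%N]/(p%:Z %| evz P (s ord0))%Z PsE.
      apply: (@line_res_dvd _ _ _ f0_homog k_gt0 _ _ _ h.2).
      - by move: te; rewrite evz_top_form.
      - by rewrite hs in pf; rewrite (eq_evz _ (pt_line _ _ _ _)).
      - rewrite (eq_evz _ (pt_line _ _ _ _)) evz_power_comb; apply: rpred_sum => l _.
        by rewrite dvdz_mull // -hs.
    * apply: (atmost_sub _ (atmost_seq (l := divisors `|evz P (s ord0)|))) => [p []//|].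
      by rewrite ler_nat; apply: T_divisors; rewrite absz_gt0 Ps.
    * move=> p [_ pp mup pe].
      have RC := @root_count x (z - s *m E) e p pp mup pe.
      apply: (@atmost_inj ('rV[int]_m * int)%type int _ _ (fun h => h.2) _ _ _ RC).
        by move=> h [[[[_ ha _] _] _] hp].
      by move=> [v1 a1] [v2 a2] [[_ /= ->] _] [[_ /= ->] _] /= ->.
    * exact: ler0n.
  + exact: Tk0.
apply: (atmost_sub _ (atmost_or H1 H2)) => // h Gh.
by have /orP[/eqP q0|q0] := orbN (evz P (h.1 ord0) == 0); [left|right].
Qed.

Lemma main_count : atmost main_pair
  ((2 * b3%:R + 1) ^+ m * (2 * T%:R * (J%:R * K.+1%:R ^+ m)) * fiber_bound / (mu%:R ^+ m * mu%:R / 2)).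
Proof.
apply: (atmost_div _ many_shifts).
  by rewrite divr_gt0 // mulr_gt0 // exprn_gt0.
apply: (@atmost_rel _ shift_key _ key_ok key_rel).
- exact: shift_key_exists.
- exact: key_count.
- exact: key_fiber.
- exact: fiber_bound_ge0.
Qed.

End MainCount.

(** * Codimension and algebraic independence *)

(** From any index on, go to a place where the least value is attained, then restart behind it. *)
Lemma nondecreasing_subsequence (a : nat -> nat) :
  exists2 phi : nat -> nat, forall i, (phi i < phi i.+1)%N & forall i, (a (phi i) <= a (phi i.+1))%N.
Proof.
have /choice[nxt nxtP] : forall N, exists i, (N <= i)%N /\ forall j, (N <= j)%N -> (a i <= a j)%N.
  move=> N; have ex : exists v, `[< exists i, (N <= i)%N /\ a i = v >].
    by exists (a N); apply/asboolP; exists N.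
  case: (ex_minnP ex) => v /asboolP[i [Ni <-]] vmin; exists i; split=> // j Nj.
  by apply: vmin; apply/asboolP; exists j.
exists (fun i => iter i (fun c => nxt c.+1) (nxt 0)) => i /=; first exact: (nxtP _).1.
case: i => [|i] /=; first exact: (nxtP 0).2.
by apply: (nxtP _).2; apply: leq_trans _ (nxtP _).1; apply: leqW; exact: (nxtP _).1.
Qed.

(** Pass to subsequences that are nondecreasing in one more exponent at a time. *)
Lemma dickson (k : nat) (f : nat -> 'X_{1..k}) : exists i j, (i < j)%N /\ (f i <= f j)%MM.
Proof.
suff /(_ k (leqnn k))[phi phi_lt phiP] : forall l, (l <= k)%N ->
    exists2 phi : nat -> nat, forall i, (phi i < phi i.+1)%N &
      forall i (c : 'I_k), (c < l)%N -> (f (phi i) c <= f (phi i.+1) c)%N.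
  exists (phi 0), (phi 1); split=> //; apply/mnm_lepP => c; exact: phiP.
elim=> [|l IH] lk; first by exists id.
have [phi phi_lt phiP] := IH (ltnW lk).
have [psi psi_lt psiP] := nondecreasing_subsequence (fun i => f (phi i) (Ordinal lk)).
have phi_mono : {homo phi : i j / (i < j)%N} by apply: homo_ltn => //; exact: ltn_trans.
exists (phi \o psi) => [i|i c] /=; first exact: phi_mono.
rewrite ltnS leq_eqVlt => /orP[/eqP cl|cl].
  by have := psiP i; rewrite (_ : Ordinal lk = c)//; apply: val_inj.
apply: (@homo_leq nat (fun i => f (phi i) c) leq) => //; [exact: leq_trans|by move=> j; exact: phiP|].
exact/ltnW.
Qed.

Lemma min_mlead (K : nzRingType) (N : nat) (P : {mpoly K[N]} -> Prop) : (exists p, P p) ->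
  exists2 p, P p & forall q, P q -> ~~ (mlead q < mlead p)%O.
Proof.
move=> [p0]; move: {2}(mlead p0) (erefl (mlead p0)) => M.
elim/(well_founded_ind (@ltom_wf N)): M p0 => M IH p pM Pp.
have [[q [Pq qp]]|no] := pselect (exists q, P q /\ (mlead q < mlead p)%O).
  by apply: (IH (mlead q)) Pq => //; rewrite -pM.
by exists p => // q Pq; apply/negP => qp; apply: no; exists q.
Qed.

Section Vanishing.
Variables (K : fieldType) (N : nat).
Implicit Types (Y : set 'rV[K]_N) (p q h : {mpoly K[N]}).

Definition vanishes Y p : Prop := forall v, Y v -> p.@[v ord0] = 0.

(** The Noetherian property. Take at each step a witness with minimal leading monomial. By Dickson's
    lemma one of these monomials divides a later one, and subtracting a multiple of the earlier
    witness makes the later one smaller. *)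
Lemma no_infinite_descent (Y : nat -> set 'rV[K]_N) : (forall i, (Y i.+1 `<=` Y i)%classic) ->
  ~ forall i, exists p, vanishes (Y i.+1) p /\ ~ vanishes (Y i) p.
Proof.
move=> dec ex; have {ex}/choice[p pP] : forall i, exists p, (vanishes (Y i.+1) p /\ ~ vanishes (Y i) p)
    /\ forall q, vanishes (Y i.+1) q /\ ~ vanishes (Y i) q -> ~~ (mlead q < mlead p)%O.
  by move=> i; have [p] := min_mlead (ex i); exists p.
have [i [j [ij le]]] := dickson (fun i => mlead (p i)).
have pn l : p l != 0.
  by apply/eqP => pl; apply: (pP l).1.2 => v _; rewrite pl meval0.
have YY : (Y j `<=` Y i.+1)%classic.
  by elim: j ij {le} => // j IH; rewrite ltnS leq_eqVlt => /orP[/eqP -> //|ij] v /dec; exact: IH.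
have [d mj] : exists d, mlead (p j) = (mlead (p i) + d)%MM.
  by exists (mlead (p j) - mlead (p i))%MM; rewrite addmC submK.
pose q := p j - (mleadc (p j) / mleadc (p i)) *: (p i * 'X_[d]).
have piv v : Y j v -> (p i).@[v ord0] = 0 by move=> /YY; exact: (pP i).1.1.
have qE v : Y j v -> q.@[v ord0] = (p j).@[v ord0].
  by move=> Yv; rewrite /q mevalB mevalZ mevalM piv// mul0r mulr0 subr0.
have qP : vanishes (Y j.+1) q /\ ~ vanishes (Y j) q.
  split=> [v Yv|H]; first by rewrite qE ?(pP j).1.1//; exact: dec.
  by apply: (pP j).1.2 => v Yv; rewrite -qE// H.
have := (pP j).2 q qP; apply/negP; rewrite negbK.
have q0 : q != 0 by apply/eqP => q0; apply: qP.2 => v _; rewrite q0 meval0.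
have qc : q@_(mlead (p j)) = 0.
  have piE : (p i * 'X_[d])@_(mlead (p j)) = mleadc (p i) by rewrite mj addmC mcoeffMX.
  by rewrite /q mcoeffB mcoeffZ piE divfK ?subrr// mleadc_eq0.
rewrite lt_neqAle; apply/andP; split.
  by apply: contra_neq q0 => qm; apply/eqP; rewrite -mleadc_eq0 qm qc.
apply: le_trans (mleadB_le _ _) _; rewrite leUx lexx /=.
apply: le_trans (mleadZ_le _ _) _; apply: le_trans (mleadM_le _ _) _.
by rewrite mleadXm mj.
Qed.

End Vanishing.

Lemma msize_exp_bound (K : nzRingType) (n d j : nat) (p : {mpoly K[n]}) :
  (msize p <= d.+1)%N -> (msize (p ^+ j) <= (j * d).+1)%N.
Proof.
move=> pd; elim: j => [|j IHj]; first by rewrite expr0 msize1.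
by rewrite exprS mulSn; apply: msizeM_bound.
Qed.

Lemma row_kernel (K : fieldType) (a b : nat) (A : 'M[K]_(a, b)) : (b < a)%N ->
  exists2 u : 'rV[K]_a, u != 0 & u *m A = 0.
Proof.
move=> ba; have : kermx A != 0.
  by rewrite -mxrank_eq0 mxrank_ker -lt0n subn_gt0 (leq_ltn_trans (rank_leq_col A)).
by move=> /rowV0Pn[u /sub_kermxP uA u0]; exists u.
Qed.

(* Compare the D ^ (N + 1) monomials of R with the at most E ^ N monomials
   that can occur in R(g). *)
Lemma algebraic_dependence (K : fieldType) (N : nat) (g : 'I_N.+1 -> {mpoly K[N]}) :
  exists2 R : {mpoly K[N.+1]}, R != 0 & mmap (@mpolyC N K) g R = 0.
Proof.
pose d := \max_i msize (g i); pose e := (N.+1 * d)%N.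
have gd i : (msize (g i) <= d.+1)%N by apply: leqW; exact: leq_bigmax.
pose D := (e.+1 ^ N).+1; pose E := (e.+1 * D)%N.
pose T1 := {ffun 'I_N.+1 -> 'I_D}; pose T2 := {ffun 'I_N -> 'I_E}.
pose mon1 (f : T1) := [multinom (f i : nat) | i < N.+1].
pose mon2 (f : T2) := [multinom (f i : nat) | i < N].
have T12 : (#|T2| < #|T1|)%N.
  rewrite !card_ffun !card_ord /E expnMn expnS ltn_pmul2r; first exact: ltnSn.
  by rewrite expn_gt0.
have [u u0 uA] := row_kernel
  (\matrix_(i < #|T1|, j < #|T2|) (mmap1 g (mon1 (enum_val i)))@_(mon2 (enum_val j))) T12.
exists (\sum_i u ord0 i *: 'X_[mon1 (enum_val i)]).
  have /existsP[i ui] : [exists i, u ord0 i != 0].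
    apply: contraNT u0 => /existsPn H; apply/eqP/rowP => i; rewrite mxE.
    by have := H i; rewrite negbK => /eqP.
  apply: contraNneq ui => /(congr1 (mcoeff (mon1 (enum_val i)))).
  rewrite mcoeff0 raddf_sum /= (bigD1 i)//= big1 => [|j ji].
    by rewrite addr0 mcoeffZ mcoeffX eqxx mulr1 => ->.
  rewrite mcoeffZ mcoeffX (_ : _ == _ = false) ?mulr0//.
  apply: contra_neqF ji => /eqP /mnmP H; apply: enum_val_inj; apply/ffunP => l.
  by apply: val_inj; have := H l; rewrite !mnmE.
set phi : {rmorphism {mpoly K[N.+1]} -> {mpoly K[N]}} := mmap (@mpolyC N K) g.
rewrite -[LHS]/(phi _) rmorph_sum; apply/mpolyP => M; rewrite mcoeff0 raddf_sum /=.
under eq_bigr do rewrite -mul_mpolyC rmorphM /= mmapC mmapX mcoeffCM.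
have [small|large] := boolP [forall l, (M l < E)%N]; last first.
  apply: big1 => i _; rewrite memN_msupp_eq0 ?mulr0//.
  apply: contra large => Mg; apply/forallP => l.
  have Ml : (M l <= mdeg M)%N by rewrite mdegE (bigD1 l)//= leq_addr.
  have : (msize (mmap1 g (mon1 (enum_val i))) <= (e * D).+1)%N.
    apply: (@leq_trans (mdeg (mon1 (enum_val i)) * d).+1).
      rewrite mdegE big_distrl /= /mmap1.
      elim/big_rec2 : _ => [|j y p _ H1]; first by rewrite msize1.
      by apply: msizeM_bound => //; exact: msize_exp_bound.
    rewrite ltnS /e mulnAC leq_mul2r mdegE; apply/orP; right.
    apply: (@leq_trans (\sum_(j < N.+1) D)%N); last by rewrite sum_nat_const card_ord.
    by apply: leq_sum => j _; rewrite mnmE ltnW.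
  move=> /(leq_trans (msize_mdeg_lt Mg)); rewrite ltnS => H.
  by apply: leq_ltn_trans (leq_trans Ml H) _; rewrite /E mulSn; lia.
pose f : T2 := [ffun l => Ordinal (forallP small l)].
have := congr1 (fun v : 'rV_#|T2| => v ord0 (enum_rank f)) uA; rewrite !mxE => H.
rewrite -[RHS]H; apply: eq_bigr => i _; rewrite mxE enum_rankK; congr (_ * mcoeff _ _).
by apply/mnmP => l; rewrite mnmE ffunE.
Qed.

Lemma meval_mmap (K : comNzRingType) (k N : nat) (g : 'I_k -> {mpoly K[N]}) (R : {mpoly K[k]}) v :
  (mmap (@mpolyC N K) g R).@[v] = R.@[fun i => (g i).@[v]].
Proof.
rewrite [mmap _ _ _]/mmap raddf_sum /= mevalE; apply: eq_bigr => M _.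
rewrite mevalM mevalC /mmap1 rmorph_prod /=; congr (_ * _).
by apply: eq_bigr => i _; rewrite rmorphXn.
Qed.

Lemma muni_eq0 (K : idomainType) (k : nat) (R : {mpoly K[k.+1]}) : muni R = 0 -> R = 0.
Proof.
move=> R0; apply/mpolyP => M; rewrite mcoeff0.
pose M' := [multinom M (widen_ord (leqnSn k) i) | i < k].
have := coef_muni (M ord_max) R M'; rewrite R0 coef0 mcoeff0 => ->; congr mcoeff.
apply/mnmP => i; rewrite mnmE; case: unliftP => [j ->|->//].
by rewrite mnmE; congr (M _); apply: val_inj; rewrite /= /bump leqNgt ltn_ord.
Qed.

Section Chains.
Variables (K : numClosedFieldType) (n : nat).
Implicit Types (Y C : set 'rV[K]_n.+1) (p q h : {mpoly K[n.+1]}).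

(** No algebraic relation holds between the restrictions of the g_i to Y. On the empty set every
    relation holds, so that independence forces Y to be nonempty. *)
Definition independent Y (k : nat) (g : 'I_k -> {mpoly K[n.+1]}) : Prop :=
  forall R : {mpoly K[k]},
    (forall v, Y v -> R.@[fun i => (g i).@[v ord0]] = 0) -> R = 0.

Lemma meval_homog_scale (d : nat) p (v : 'rV[K]_n.+1) (c : K) :
  p \is d.-homog -> p.@[(c *: v) ord0] = c ^+ d * p.@[v ord0].
Proof.
move=> /dhomogP pd; rewrite !mevalE mulr_sumr big_seq [RHS]big_seq.
apply: eq_bigr => M Mp; rewrite mulrCA; congr (_ * _).
under eq_bigr do rewrite mxE exprMn; rewrite big_split /=; congr (_ * _).
by rewrite prodrXr -mdegE (pd M Mp).
Qed.

Lemma closed_scale Y v (c : K) : proj_closed Y -> c != 0 -> Y v -> Y (c *: v).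
Proof.
move=> [S Sform ->] c0 [v0 Sv]; split; first by rewrite scaler_eq0 negb_or c0.
by move=> p Sp; have [d pd] := Sform p Sp; rewrite (meval_homog_scale _ _ pd) Sv// mulr0.
Qed.

Lemma closed_neq0 Y v : proj_closed Y -> Y v -> v != 0.
Proof. by move=> [S _ ->] []. Qed.

(** As a polynomial in c, q(c v) has the homogeneous parts at v as coefficients. Its degree is below
    [msize q], and it vanishes at 1, ..., [msize q]. *)
Lemma homog_part_zero q (v : 'rV[K]_n.+1) d :
  (forall c : K, c != 0 -> q.@[(c *: v) ord0] = 0) -> (pihomog mdeg d q).@[v ord0] = 0.
Proof.
move=> qv; have [dk|dk] := ltnP d (msize q); last first.
  rewrite pihomogE big_seq_cond big1 ?meval0// => M /andP[Mq /eqP Md].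
  by have := msize_mdeg_lt Mq; rewrite Md ltnNge dk.
pose P := \poly_(i < msize q) (pihomog mdeg i q).@[v ord0].
suff P0 : P = 0 by have := coef_poly (msize q) (fun i => (pihomog mdeg i q).@[v ord0]) d; rewrite dk -/P P0 coef0.
apply/eqP; apply: contraT => P0.
pose rs := [seq i.+1%:R : K | i <- iota 0 (msize q)].
have := max_poly_roots P0 (rs := rs); rewrite size_map size_iota => H.
suff : (msize q < size P)%N by rewrite ltnNge size_poly.
apply: H; last by rewrite map_inj_uniq ?iota_uniq// => i j /eqP; rewrite eqr_nat => /eqP[].
apply/allP => _ /mapP[i _ ->]; apply/rootP; rewrite horner_poly.
have := qv i.+1%:R; rewrite pnatr_eq0 => /(_ isT) qz; rewrite -[RHS]qz.
rewrite [in RHS](pihomog_partitionE (leqnn (msize q))) raddf_sum /=; apply: eq_bigr => j _.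
by rewrite (meval_homog_scale _ _ (pihomogP _ _ _)) mulrC.
Qed.

(* The zeros of h cover no dense part of C, and q is replaced by its homogeneous
   components, which vanish wherever q vanishes on the whole line through a point. *)
Lemma vanishes_mul C h q : proj_closed C -> proj_irreducible C -> is_form h ->
  ~ vanishes C h -> vanishes C (h * q) -> vanishes C q.
Proof.
move=> Ccl [_ Cirr] hform nCh Chq.
have [d hd] := hform.
have [||v Cv|H|H v Cv] := Cirr (proj_zeros [set h]%classic) (proj_zeros (range (fun d => pihomog mdeg d q))).
- by exists [set h]%classic => // p ->.
- by exists (range (fun d => pihomog mdeg d q)) => // _ [i _ <-]; exists i; exact: pihomogP.
- have v0 := closed_neq0 Ccl Cv.
  have [hv|hv] := boolP (h.@[v ord0] == 0); [left|right]; split=> //.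
    by move=> p ->; apply/eqP.
  move=> _ [i _ <-]; apply: homog_part_zero => c c0.
  have := Chq _ (closed_scale Ccl c0 Cv); rewrite mevalM => /eqP.
  rewrite mulf_eq0 (meval_homog_scale _ _ hd) mulf_eq0 expf_eq0 (negbTE c0) andbF /=.
  by rewrite (negbTE hv) => /eqP.
- by case: nCh => v /H[_]; apply.
- have [_ qv] := H v Cv; rewrite (pihomog_partitionE (leqnn (msize q))) raddf_sum /=.
  by apply: big1 => i _; apply: qv; exists i.
Qed.

(** A form h that vanishes on C0 but not on C1 is added. In a relation on C1 the term free of h
    vanishes on C0, hence is zero; then h can be cancelled on the irreducible C1, and the degree in
    h drops. *)
Lemma independent_step C0 C1 k (g : 'I_k -> {mpoly K[n.+1]}) :
  proj_closed C0 -> proj_closed C1 -> proj_irreducible C1 -> (C0 `<` C1)%classic ->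
  independent C0 g -> exists g' : 'I_k.+1 -> {mpoly K[n.+1]}, independent C1 g'.
Proof.
move=> C0cl C1cl C1irr [C01 C10] indg.
have [h [hform C0h nC1h]] : exists h, [/\ is_form h, vanishes C0 h & ~ vanishes C1 h].
  case: (C0cl) => S Sform SE; apply: contrapT => no; apply: C10 => v Cv.
  rewrite SE; split; first exact: closed_neq0 Cv.
  move=> p Sp; apply: contrapT => pv; apply: no; exists p; split; first exact: Sform.
    by move=> w; rewrite SE => -[_]; apply.
  by move=> /(_ v Cv).
pose g' (i : 'I_k.+1) := if unlift ord_max i is Some j then g j else h.
exists g' => R R0; apply: muni_eq0.
have {R0} : forall v, C1 v -> (map_poly (meval (fun i => (g i).@[v ord0])) (muni R)).[h.@[v ord0]] = 0.
  move=> v /R0; rewrite meval_muni /g' unlift_none => H; rewrite -[RHS]H; congr _.[_].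
  apply: eq_map_poly => p; apply: meval_eq => i.
  by have -> : widen_ord (leqnSn k) i = lift ord_max i by [apply: val_inj; rewrite /= /bump leqNgt ltn_ord]; rewrite liftK.
elim/poly_ind: (muni R) => // P c IH Pc.
have c0 : c = 0.
  apply: indg => v C0v; have := Pc v (C01 v C0v).
  by rewrite (C0h v C0v) rmorphD rmorphM /= map_polyX map_polyC hornerD hornerMX mulr0 add0r hornerC.
rewrite c0 addr0 in Pc *; rewrite IH ?mul0r//.
pose q := (map_poly (mmap (@mpolyC n.+1 K) g) P).[h].
have qE v : q.@[v ord0] = (map_poly (meval (fun i => (g i).@[v ord0])) P).[h.@[v ord0]].
  rewrite /q -horner_map /= -map_poly_comp; congr _.[_]; apply: eq_map_poly => p.
  exact: meval_mmap.
have : vanishes C1 q.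
  apply: (vanishes_mul C1cl C1irr hform nC1h) => v C1v.
  by have := Pc v C1v; rewrite mevalM qE rmorphM /= map_polyX hornerMX mulrC.
by move=> H v C1v; rewrite -qE H.
Qed.

(* A minimal closed subset of Z on which g is independent is irreducible; a
   chain of length k above it adds k algebraically independent polynomials. *)
Lemma codim_dependent (k m : nat) Z (g : 'I_m -> {mpoly K[n.+1]}) :
  proj_closed Z -> codim_ge k Z -> (n.+1 < k + m)%N -> ~ independent Z g.
Proof.
move=> Zcl Zk nkm indZ.
pose P Y := [/\ proj_closed Y, (Y `<=` Z)%classic & independent Y g].
have [Y [Ycl YZ indY] Ymin] : exists2 Y, P Y & forall Y', P Y' -> (Y' `<=` Y)%classic -> (Y `<=` Y')%classic.
  apply: contrapT => no.
  have /choice[nxt nxtP] : forall Y : {Y | P Y}, exists Y' : {Y | P Y},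
      (sval Y' `<=` sval Y)%classic /\ ~ (sval Y `<=` sval Y')%classic.
    move=> [Y PY] /=; apply: contrapT => H; apply: no; exists Y => // Y' PY' Y'Y.
    by apply: contrapT => YY'; apply: H; exists (exist _ Y' PY').
  pose Ys i := iter i nxt (exist _ Z (And3 Zcl (@subset_refl _ Z) indZ)).
  apply: (@no_infinite_descent K n.+1 (fun i => sval (Ys i))) => i /=; first exact: (nxtP _).1.
  have [[S Sform SE] _ _] := svalP (nxt (Ys i)).
  apply: contrapT => H; apply: (nxtP (Ys i)).2 => v Yv; rewrite SE; split.
    by apply: closed_neq0 Yv; have [] := svalP (Ys i).
  move=> p Sp; apply: contrapT => pv; apply: H; exists p; split.
    by move=> w; rewrite SE => -[_]; apply.
  by move=> /(_ v Yv).
have Yirr : proj_irreducible Y.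
  split.
    apply: contrapT => Y0; suff /eqP : (1 : {mpoly K[m]}) = 0 by rewrite oner_eq0.
    by apply: indY => v Yv; case: Y0; exists v.
  move=> A1 A2 A1cl A2cl YA; apply: contrapT => /not_orP[nA1 nA2].
  have dep A : proj_closed A -> ~ (Y `<=` A)%classic -> exists2 R : {mpoly K[m]}, R != 0 &
      forall v, Y v -> A v -> R.@[fun i => (g i).@[v ord0]] = 0.
    move=> Acl nA; apply: contrapT => no; apply: nA.
    suff : (Y `<=` Y `&` A)%classic by move=> H v /H[].
    apply: Ymin; last by move=> v [].
    split; [|by move=> v [/YZ]|].
      case: (Ycl) => S Sform ->; case: (Acl) => S' S'form ->.
      exists (S `|` S')%classic; first by move=> p [/Sform|/S'form].
      apply/seteqP; split=> v.
        by move=> [[v0 Sv] [_ S'v]]; split=> // p [/Sv|/S'v].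
      by move=> [v0 SSv]; split; split=> // p Sp; apply: SSv; [left|right].
    move=> R R0; apply: contrapT => /eqP Rn; apply: no; exists R => // v Yv Av.
    exact: R0.
  have [R1 R10 R1v] := dep A1 A1cl nA1; have [R2 R20 R2v] := dep A2 A2cl nA2.
  have : R1 * R2 = 0.
    by apply: indY => v Yv; rewrite mevalM; case: (YA v Yv) => [/R1v|/R2v] ->; rewrite ?mul0r ?mulr0.
  by apply/eqP; rewrite mulf_neq0.
have [C [C0 Ccl Clt]] := Zk Y Ycl Yirr YZ.
have indC : forall i, (i <= k)%N -> exists g' : 'I_(i + m) -> {mpoly K[n.+1]}, independent (C i) g'.
  elim=> [|i IH] ik; first by rewrite C0; exists g.
  have [g' g'ind] := IH (ltnW ik).
  have [Ci _] := Ccl i (ltnW ik); have [Ci1 Ci1irr] := Ccl i.+1 ik.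
  exact: (independent_step Ci Ci1 Ci1irr (Clt i ik) g'ind).
have [g' g'ind] := indC k (leqnn k).
have [R R0 Rg] := algebraic_dependence (fun i : 'I_n.+2 => g' (widen_ord nkm i)).
move: R0; apply/negP; rewrite negbK; apply/eqP.
(* The relation read in all k + m variables. That this is nonzero is seen by setting the surplus
   variables to 0. *)
pose R' := mmap (@mpolyC (k + m) K) (fun i : 'I_n.+2 => 'X_(widen_ord nkm i)) R.
have R'0 : R' = 0.
  apply: g'ind => v _; have := congr1 (meval (v ord0)) Rg; rewrite meval0 meval_mmap => H.
  by rewrite -[RHS]H meval_mmap; apply: meval_eq => i; rewrite mevalXU.
apply/eqP; apply: contraT => R0.
have [||v _] := @mpoly_nonvanishing K _ R [seq i%:R : K | i <- iota 0 (n.+2 * msize R).+1] R0.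
- by rewrite map_inj_uniq ?iota_uniq// => i j /eqP; rewrite eqr_nat => /eqP.
- by rewrite size_map size_iota.
have := congr1 (meval (fun i : 'I_(k + m) => if insub (val i) is Some j then v ord0 j else 0)) R'0.
rewrite meval0 meval_mmap => H.
move=> /eqP[]; rewrite -[RHS]H; apply: meval_eq => i; rewrite mevalXU.
by case: insubP => [j _ /val_inj -> //|]; rewrite /= ltn_ord.
Qed.

End Chains.

(** * Isometries of the quadric *)

Lemma evz_homog (n k d e : nat) (f : {mpoly int[n]}) (h : 'I_n -> {mpoly int[k]}) :
  f \is d.-homog -> (forall i, h i \is e.-homog) -> evz f h \is (d * e).-homog.
Proof.
move=> /dhomogP fd he; rewrite evzE big_seq; apply: rpred_sum => M Mf.
rewrite -(rmorph_int (@mpolyC k int)) mul_mpolyC; apply: dhomogZ.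
rewrite -(fd M Mf : mdeg M = d) mdegE big_distrl /=.
elim/big_rec2 : _ => [|i q c _ H]; first exact: dhomog1.
by apply: dhomogM => //; rewrite mulnC; apply: dhomogMn.
Qed.

Lemma evz_comp (R : comNzRingType) (n k : nat) (f : {mpoly int[n]}) (h : n.-tuple {mpoly int[k]}) (v : 'I_k -> R) :
  evz (f \mPo h) v = evz f (fun i => evz (tnth h i) v).
Proof.
set phi : {rmorphism {mpoly int[k]} -> R} := mmap intr v.
rewrite -[LHS]/(phi _) comp_mpolyE rmorph_sum [RHS]evzE; apply: eq_bigr => M _.
rewrite -mul_mpolyC rmorphM /= mmapC rmorph_prod; congr (_ * _).
by apply: eq_bigr => i _; rewrite rmorphXn (tnth_nth 0).
Qed.

(** The flag tells whether x0 is put second among the coordinates instead of first, so that one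
    argument serves for both of the symmetric variables. *)
Definition pt3 (R : Type) (m : nat) (b : bool) (x0 x1 : R) (y : 'rV[R]_m) : 'I_(1 + (1 + m)) -> R :=
  pt (if b then x1 else x0) (\row_j pt (if b then x0 else x1) y j).

Lemma pt_map (R S : Type) (phi : R -> S) (m : nat) (x : R) (y : 'rV[R]_m) i :
  phi (pt x y i) = pt (phi x) (map_mx phi y) i.
Proof. by case: (split_ordP i) => j ->; rewrite ?(pt_l, pt_r) ?mxE. Qed.

Lemma pt3_map (R S : Type) (phi : R -> S) (m : nat) b (x0 x1 : R) (y : 'rV[R]_m) i :
  phi (pt3 b x0 x1 y i) = pt3 b (phi x0) (phi x1) (map_mx phi y) i.
Proof.
rewrite /pt3 (pt_map phi); congr (pt _ _ i); first by case: b.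
by apply/rowP => j; rewrite !mxE (pt_map phi); congr (pt _ _ j); case: b.
Qed.

Definition ix0 (m : nat) (b : bool) : 'I_(1 + (1 + m)) :=
  if b then rshift 1 (lshift m ord0) else lshift (1 + m) ord0.
Definition ixy (m : nat) (j : 'I_m) : 'I_(1 + (1 + m)) := rshift 1 (rshift 1 j).

Lemma pt3_x0 (R : Type) (m : nat) b (x0 x1 : R) (y : 'rV[R]_m) : pt3 b x0 x1 y (ix0 m b) = x0.
Proof. by case: b; rewrite /pt3 /ix0 ?(pt_l, pt_r) ?mxE ?pt_l. Qed.

Lemma pt3_x1 (R : Type) (m : nat) b (x0 x1 : R) (y : 'rV[R]_m) : pt3 b x0 x1 y (ix0 m (~~ b)) = x1.
Proof. by case: b; rewrite /pt3 /ix0 ?(pt_l, pt_r) ?mxE ?pt_l. Qed.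

Lemma pt3_y (R : Type) (m : nat) b (x0 x1 : R) (y : 'rV[R]_m) j : pt3 b x0 x1 y (ixy j) = y ord0 j.
Proof. by rewrite /pt3 /ixy pt_r mxE pt_r. Qed.

Lemma pt3P (m : nat) b (i : 'I_(1 + (1 + m))) :
  [\/ i = ix0 m b, i = ix0 m (~~ b) | exists j, i = ixy j].
Proof.
case: (split_ordP i) => [j ->|k ->]; first by rewrite (ord1 j); case: b; [apply: Or32|apply: Or31].
case: (split_ordP k) => [j ->|j ->]; last by apply: Or33; exists j.
by rewrite (ord1 j); case: b; [apply: Or31|apply: Or32].
Qed.

Section Fibers.
Variables (m : nat) (Q0 : {mpoly int[m]}).
Hypothesis Q0_homog : Q0 \is 2.-homog.

Definition quadric : {mpoly int[1 + (1 + m)]} := @hyperbolic_form m.+1 Q0.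

Lemma evz_quadric (R : comNzRingType) b (x0 x1 : R) (y : 'rV[R]_m) :
  evz quadric (pt3 b x0 x1 y) = x0 * x1 - evz Q0 (y ord0).
Proof.
set phi : {rmorphism {mpoly int[1 + (1 + m)]} -> R} := mmap intr (pt3 b x0 x1 y).
rewrite /quadric /hyperbolic_form -[LHS]/(phi _) rmorphB rmorphM /= !mmapX !mmap1U.
congr (_ - _).
  have -> : inord 0 = ix0 m false by apply: val_inj; rewrite /= inordK.
  have -> : inord 1 = ix0 m true by apply: val_inj; rewrite /= inordK.
  by case: b {phi}; rewrite ?(pt3_x0, pt3_x1 true, pt3_x1 false) // mulrC ?(pt3_x0, pt3_x1 true).
rewrite -[LHS]/(evz _ _) evz_comp; apply: eq_evz => i; rewrite tnth_mktuple /evz mmapX mmap1U.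
rewrite -(pt3_y b x0 x1 y i); congr pt3.
by apply: val_inj; rewrite /= inordK // !ltnS.
Qed.

(* The isometry (x0, x1, y) |-> (x0, x1 + b(y, w) + x0 Q0(w), y + x0 w) of
   the quadric, inverted where the new coordinates are (x, v), so that x0 is
   Q0(v) / x, and then multiplied by x. *)
Definition fiber_param (b : bool) (w : 'rV[int]_m) : 'I_(1 + (1 + m)) -> {mpoly int[1 + m]} :=
  let X := 'X_(lshift m ord0) in let Y i := 'X_(rshift 1 i) in
  let A := evz Q0 Y in
  pt3 b A
    (X ^+ 2 - X * (\sum_i ((quad_mx Q0 *m w^T) i ord0)%:MP * Y i) + A * (qval Q0 w)%:MP)
    (\row_i (X * Y i - A * (w ord0 i)%:MP)).

Lemma evz_fiber_param (R : numDomainType) b w (x : R) (v : 'rV[R]_m) i :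
  evz (fiber_param b w i) (pt x v) =
  pt3 b (qval Q0 v) (x ^+ 2 - x * bq Q0 v (map_mx intr w) + qval Q0 v * (qval Q0 w)%:~R)
    (x *: v - qval Q0 v *: map_mx intr w) i.
Proof.
set phi : {rmorphism {mpoly int[1 + m]} -> R} := mmap intr (pt x v).
have phiX : phi 'X_(lshift m ord0) = x by rewrite /= mmapX mmap1U pt_l.
have phiY j : phi 'X_(rshift 1 j) = v ord0 j by rewrite /= mmapX mmap1U pt_r.
have phiA : phi (evz Q0 (fun i => 'X_(rshift 1 i))) = qval Q0 v.
  by rewrite -[LHS]/(evz _ _) evz_subst; apply: eq_evz => j; rewrite -[LHS]/(phi _) phiY.
rewrite -[LHS]/(phi _) (pt3_map phi) phiA; congr (pt3 _ _ _ _ _).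
  rewrite rmorphD rmorphB rmorphXn !rmorphM phiA phiX /= mmapC; congr (_ - _ * _ + _).
  rewrite -[LHS]/(phi _) rmorph_sum /bq -mulmxA mxE; apply: eq_bigr => j _.
  rewrite rmorphM phiY /= mmapC mulrC; congr (_ * _).
  by rewrite map_trmx -map_mxM [RHS]mxE.
apply/rowP => j; rewrite !mxE rmorphB !rmorphM phiA phiX phiY /= mmapC.
by [].
Qed.

Lemma fiber_param_homog b w i : fiber_param b w i \is 2.-homog.
Proof.
have X1 j : 'X_j \is [in int[1 + m], 1.-homog] by rewrite dhomogX; apply/eqP; exact: mdeg1.
have A2 : evz Q0 (fun i => 'X_(rshift 1 i)) \is [in int[1 + m], 2.-homog].
  exact: (@evz_homog _ _ 2 1).
have C2 (p : {mpoly int[1 + m]}) c : p \is 2.-homog -> p * c%:MP \is 2.-homog.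
  by move=> p2; rewrite mulrC mul_mpolyC; apply: dhomogZ.
case: (pt3P b i) => [->|->|[j ->]]; rewrite /fiber_param ?(pt3_x0, pt3_x1, pt3_y) //.
- rewrite dhomogD ?C2// dhomogD//; first exact: (@dhomogM _ _ _ 1 _ 1).
  rewrite dhomogN; apply: (@dhomogM _ _ _ 1 _ 1) => //; apply: rpred_sum => j _.
  by rewrite mul_mpolyC; apply: dhomogZ.
- by rewrite mxE dhomogD ?dhomogN ?C2//; apply: (@dhomogM _ _ _ 1 _ 1).
Qed.

Variables (r : nat) (F : 'I_r -> {mpoly int[1 + (1 + m)]}).
Hypothesis F_form : forall j, is_form (F j).
Hypothesis Z_codim : @codim_ge algC m.+1 3 (variety quadric F).

Definition fiber_form b w j : {mpoly int[1 + m]} := evz (F j) (fiber_param b w).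

Lemma fiber_form_homog b w j : is_form (fiber_form b w j).
Proof.
by have [d Fd] := F_form j; exists (d * 2)%N; apply: evz_homog => // i; exact: fiber_param_homog.
Qed.

Lemma evz_fiber_form (R : numDomainType) b w j (x : R) (v : 'rV[R]_m) :
  evz (fiber_form b w j) (pt x v) = evz (F j)
    (pt3 b (qval Q0 v) (x ^+ 2 - x * bq Q0 v (map_mx intr w) + qval Q0 v * (qval Q0 w)%:~R)
    (x *: v - qval Q0 v *: map_mx intr w)).
Proof. by rewrite evz_subst; apply: eq_evz => i; rewrite evz_fiber_param. Qed.

Lemma qval_map (R : numDomainType) (w : 'rV[int]_m) : qval Q0 (map_mx intr w : 'rV[R]_m) = (qval Q0 w)%:~R.
Proof.
rewrite /qval -[RHS]/(intr (evz _ _)) (evz_morph intr).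
by apply: eq_evz => i; rewrite mxE.
Qed.

(** The parametrized point is the image under an isometry of the point (Q0(v), x^2, x v), which is
    visibly on the quadric. *)
Lemma fiber_on_quadric (R : numDomainType) (w : 'rV[int]_m) (x : R) (v : 'rV[R]_m) :
  qval Q0 v * (x ^+ 2 - x * bq Q0 v (map_mx intr w) + qval Q0 v * (qval Q0 w)%:~R) =
  qval Q0 (x *: v - qval Q0 v *: map_mx intr w).
Proof.
rewrite -scaleNr qvalD// !qvalZ// bqZl bqZr qval_map; ring.
Qed.

Lemma bq_lincomb (R : numDomainType) (x a : R) (u v w : 'rV[R]_m) :
  bq Q0 (x *: u + a *: v) w = x * bq Q0 u w + a * bq Q0 v w.
Proof. by rewrite bqDl !bqZl. Qed.

Lemma proj_closed_variety : proj_closed (@variety m.+1 r quadric F).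
Proof.
exists [set map_mpoly intr p | p in [set quadric] `|` range F]%classic => //.
have map_form (p : {mpoly int[1 + (1 + m)]}) : is_form p -> is_form (map_mpoly (intr : int -> algC) p).
  move=> [d /dhomogP pd]; exists d; apply/dhomogP => M; rewrite mcoeff_msupp mcoeff_map_mpoly => H.
  by apply: pd; rewrite mcoeff_msupp; apply: contraNneq H => ->; rewrite /= mulr0z.
move=> _ [p [->|[j _ <-]] <-]; apply: map_form => //.
exists 2%N; rewrite /quadric /hyperbolic_form dhomogD//.
  by apply: (@dhomogM _ _ _ 1 _ 1); rewrite dhomogX; apply/eqP; exact: mdeg1.
rewrite dhomogN comp_mpolyE; rewrite big_seq; apply: rpred_sum => M MQ.
apply: dhomogZ; rewrite -(dhomog_mf Q0_homog MQ : mdeg M = 2%N) mdegE.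
elim/big_rec2 : _ => [|i q c _ H]; first exact: dhomog1.
apply: dhomogM => //; rewrite (tnth_nth 0) -[X in X.-homog]mul1n; apply: dhomogMn.
by rewrite -tnth_nth tnth_mktuple dhomogX; apply/eqP; exact: mdeg1.
Qed.

(* On the fiber through (x, v + t e) the new coordinate x and the vector
   e_i0 v_i - e_i v_i0 do not depend on t, hence they would be independent on Z. *)
Lemma fiber_no_common_root b w (x : int) (e : 'rV[int]_m) : x != 0 -> e != 0 ->
  exists v : 'rV[algC]_m, forall t : algC,
    exists j, evz (fiber_form b w j) (pt x%:~R (v + t *: map_mx intr e)) != 0.
Proof.
move=> x0 e0; apply: contrapT => no.
have {no} root (v : 'rV[algC]_m) : exists t, forall j, evz (fiber_form b w j) (pt x%:~R (v + t *: map_mx intr e)) = 0.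
  apply: contrapT => no'; apply: no; exists v => t; apply: contrapT => no''; apply: no'; exists t => j.
  by apply/eqP; apply: contrapT => H; apply: no''; exists j; apply/negP.
have /existsP[i0 ei0] : [exists i, e ord0 i != 0].
  apply: contraNT e0 => /existsPn H; apply/eqP/rowP => i; rewrite mxE.
  by have := H i; rewrite negbK => /eqP.
pose X0 : {mpoly algC[m.+2]} := 'X_(ix0 m b); pose X1 : {mpoly algC[m.+2]} := 'X_(ix0 m (~~ b)).
pose Y (i : 'I_m) : {mpoly algC[m.+2]} := 'X_(ixy i).
pose Y' i := Y i + (w ord0 i)%:~R * X0.
(* The combination e_i0 v_i - e_i v_i0 is zero for i = i0; this slot receives the new coordinate x,
   which makes m polynomials. *)
pose g (i : 'I_m) : {mpoly algC[m.+2]} := if i == i0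
  then X1 + \sum_l ((quad_mx Q0 *m w^T) l ord0)%:~R * Y l + (qval Q0 w)%:~R * X0
  else (e ord0 i0)%:~R * Y' i - (e ord0 i)%:~R * Y' i0.
apply: (@codim_dependent _ _ 3 m _ g proj_closed_variety Z_codim (leqnn _)) => R Rg.
apply/eqP; apply: contraT => R0.
(* The extra factor provides z_i0 != 0, which the scaling by c = z_i0 / x^2 needs. *)
have RX : R * 'X_i0 != 0.
  rewrite mulf_neq0 //; apply/eqP => /(congr1 (mcoeff U_(i0)%MM)) /eqP.
  by rewrite mcoeffX eqxx mcoeff0 oner_eq0.
have [||z _] := @mpoly_nonvanishing algC _ _ [seq i%:R : algC | i <- iota 0 (m * msize (R * 'X_i0)).+1] RX.
- by rewrite map_inj_uniq ?iota_uniq// => i j /eqP; rewrite eqr_nat => /eqP.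
- by rewrite size_map size_iota.
rewrite mevalM mevalXU mulf_eq0 negb_or => /andP[Rz z0].
have xC : x%:~R != 0 :> algC by rewrite intr_eq0.
have eC : (e ord0 i0)%:~R != 0 :> algC by rewrite intr_eq0.
(* The parametrized point has the new coordinates x^2 and x V. After scaling by c, and with v_i0 =
   0, the values of g at the point are exactly the entries of z. *)
pose c := z ord0 i0 / x%:~R ^+ 2.
have c0 : c != 0 by rewrite mulf_neq0 // invr_eq0 expf_eq0.
pose v : 'rV[algC]_m := \row_i (if i == i0 then 0 else z ord0 i / (c * x%:~R * (e ord0 i0)%:~R)).
have [t vt] := root v; set V := v + t *: map_mx intr e in vt.
pose A := qval Q0 V; pose B := x%:~R ^+ 2 - x%:~R * bq Q0 V (map_mx intr w) + A * (qval Q0 w)%:~R.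
pose th : 'rV[algC]_m.+2 := \row_i (c * pt3 b A B (x%:~R *: V - A *: map_mx intr w) i).
have th0 : th ord0 (ix0 m b) = c * A by rewrite mxE pt3_x0.
have th1 : th ord0 (ix0 m (~~ b)) = c * B by rewrite mxE pt3_x1.
have thy l : th ord0 (ixy l) = c * (x%:~R *: V - A *: map_mx intr w) ord0 l by rewrite mxE pt3_y.
have mevalz (k : int) : (k%:~R : {mpoly algC[m.+2]}).@[th ord0] = k%:~R.
  by rewrite -(rmorph_int (@mpolyC m.+2 algC)) mevalC.
have gth i : (g i).@[th ord0] = z ord0 i.
  rewrite /g; case: ifP => [/eqP ->|/negbT ii0].
    rewrite !mevalD mevalM !mevalXU mevalz th0 th1 raddf_sum /=.
    have -> : \sum_l (((quad_mx Q0 *m w^T) l ord0)%:~R * Y l).@[th ord0]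
      = c * bq Q0 (x%:~R *: V - A *: map_mx intr w) (map_mx intr w).
      rewrite /bq -mulmxA [in RHS]mxE mulr_sumr; apply: eq_bigr => l _.
      rewrite mevalM mevalz mevalXU thy map_trmx -map_mxM mulrCA; congr (_ * _).
      by rewrite mulrC; congr (_ * _); rewrite [RHS]mxE.
    rewrite -scaleNr bq_lincomb /B.
    have -> : bq Q0 (map_mx intr w) (map_mx intr w) = 2 * (qval Q0 w)%:~R :> algC.
      by rewrite -qval2// qval_map mulr_natl mulr2n.
    rewrite /c; field; exact: xC.
  rewrite mevalB !mevalM !mevalD !mevalM !mevalXU !mevalz th0 !thy !mxE (negbTE ii0) eqxx.
  field; rewrite c0 xC eC.
  by [].
have thZ : variety quadric F th.
  split.
    apply: contraNneq z0 => thz; rewrite -gth thz /g eqxx !mevalD mevalM !mevalXU !mxE mulr0 raddf_sum /=.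
    rewrite big1 ?addr0 // => l _.
    by rewrite mevalM mevalXU [(0 : 'rV[algC]_m.+2) _ _]mxE mulr0.
  have eval_th (p : {mpoly int[1 + (1 + m)]}) d : p \is d.-homog ->
      (map_mpoly intr p).@[th ord0] = c ^+ d * evz p (pt3 b A B (x%:~R *: V - A *: map_mx intr w)).
    by move=> pd; rewrite evz_map -evz_homog_scale//; apply: eq_evz => i; rewrite mxE.
  move=> _ [p [->|[j _ <-]] <-].
    have -> : (map_mpoly intr quadric).@[th ord0] = evz quadric (pt3 b (c * A) (c * B) (c *: (x%:~R *: V - A *: map_mx intr w))).
      rewrite evz_map; apply: eq_evz => i; rewrite mxE (pt3_map (fun a => c * a)).
      by congr (pt3 _ _ _ _ _); apply/rowP => l; rewrite !mxE.
    rewrite evz_quadric -[evz _ _]/(qval Q0 _) qvalZ// -fiber_on_quadric -/A -/B; ring.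
  have [d Fd] := F_form j; rewrite (eval_th _ _ Fd).
  by have := vt j; rewrite evz_fiber_form -/A -/B => ->; rewrite mulr0.
have := Rg th thZ; rewrite (meval_eq _ gth) => /eqP.
by rewrite (negbTE Rz).
Qed.

End Fibers.

(** * Assembling the count *)

Lemma prod_pt (R : comNzRingType) (m : nat) (x : R) (v : 'rV[R]_m) (M : 'X_{1..1 + m}) :
  \prod_i pt x v i ^+ M i = x ^+ M (lshift m ord0) * \prod_(i < m) v ord0 i ^+ M (rshift 1 i).
Proof.
rewrite big_split_ord big_ord_recl big_ord0 /= mulr1 pt_l; congr (_ * _).
by apply: eq_bigr => i _; rewrite pt_r.
Qed.

(** A monomial of f free of the first variable would survive in the top form. *)
Lemma top_form_eq0 (m k : nat) (f : {mpoly int[1 + m]}) : top_form f = 0 -> f \is k.-homog ->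
  exists2 f', f = 'X_(lshift m ord0) * f' & f' \is k.-1.-homog.
Proof.
set o := lshift m ord0 => f0 fk.
have Mo M : M \in msupp f -> (0 < M o)%N.
  move=> Mf; rewrite lt0n; apply/eqP => M0; move: Mf; rewrite mcoeff_msupp => /eqP; apply.
  have := congr1 (mcoeff [multinom M (rshift 1 i) | i < m]) f0; rewrite mcoeff0 => <-.
  rewrite /top_form evzE raddf_sum /=.
  have E (N : 'X_{1..1 + m}) : ((f@_N)%:~R * \prod_i pt 0 (\row_i 'X_i) i ^+ N i : {mpoly int[m]})@_[multinom M (rshift 1 i) | i < m]
     = f@_N * (N == M)%:R.
    rewrite -(rmorph_int (@mpolyC m int)) mcoeffCM intz prod_pt; congr (_ * _).
    have -> : \prod_(i < m) (\row_i 'X_i : 'rV[{mpoly int[m]}]_m) ord0 i ^+ N (rshift 1 i) = 'X_[[multinom N (rshift 1 i) | i < m]].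
      by rewrite [RHS]mpolyXE_id; apply: eq_bigr => i _; rewrite mxE mnmE.
    have [NM|NM] := eqVneq N M; first by rewrite NM M0 expr0 mul1r mcoeffX eqxx.
    rewrite -/o; case: (posnP (N o)) => [N0|N0]; last by rewrite expr0n gtn_eqF// mul0r mcoeff0.
    rewrite N0 expr0 mul1r mcoeffX; case: eqP => // H; case/eqP: NM; apply/mnmP => i.
    case: (split_ordP i) => j ->; first by rewrite (ord1 j) -/o N0 M0.
    by have /mnmP/(_ j) := H; rewrite !mnmE.
  under eq_bigr do rewrite E.
  have [MF|MF] := boolP (M \in msupp f).
    rewrite (bigD1_seq M)//= eqxx mulr1 big1 ?addr0// => N /negbTE ->; exact: mulr0.
  rewrite (memN_msupp_eq0 MF) big_seq big1// => N NF.
  by have [NM|] := eqVneq N M; rewrite ?mulr0//; rewrite NM (negbTE MF) in NF.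
exists (\sum_(M <- msupp f) f@_M *: 'X_[M - U_(o)]).
  rewrite mulr_sumr {1}[f]mpolyE big_seq [RHS]big_seq; apply: eq_bigr => M Mf.
  rewrite -scalerAr -mpolyXD; congr (_ *: 'X_[_]); rewrite addmC submK//.
  by apply/mnm_lepP => i; rewrite mnm1E; case: eqP => // <-; exact: Mo.
rewrite big_seq; apply: rpred_sum => M Mf; apply: dhomogZ; rewrite dhomogX /=; apply/eqP.
have Mk : mdeg M = k by exact: (dhomog_mf fk Mf).
suff -> : k = (mdeg (M - U_(o)) + 1)%N by rewrite addn1.
have <- : (mdeg (M - U_(o)) + mdeg U_(o))%N = (mdeg (M - U_(o)) + 1)%N by rewrite mdeg1.
rewrite -Mk -mdegD submK//.
by apply/mnm_lepP => i; rewrite mnm1E; case: eqP => // <-; exact: Mo.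
Qed.

(** The removed power of the first variable is harmless wherever p does not divide x. *)
Lemma first_variable_part (m k : nat) (f : {mpoly int[1 + m]}) : f != 0 -> f \is k.-homog ->
  exists a k' f0, [/\ f = 'X_(lshift m ord0) ^+ a * f0, f0 \is k'.-homog & top_form f0 != 0].
Proof.
elim: (msize f) {-2}f (leqnn (msize f)) k => [|s IH] {}f fs k f0 fk.
  by move: fs; rewrite leqn0 msize_poly_eq0 (negbTE f0).
have [tf|/eqP tf] := pselect (top_form f = 0); last first.
  by exists 0, k, f; split; [rewrite expr0 mul1r|exact: fk|exact: tf].
have [f' fE f'k] := top_form_eq0 tf fk.
have f'0 : f' != 0 by apply: contraNneq f0 => H; rewrite fE H mulr0.
have [] := IH f' _ _ f'0 f'k.
  rewrite -ltnS; apply: leq_trans fs; rewrite fE msizeM//.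
    by rewrite msizeX mdeg1.
  by apply/eqP => /(congr1 (mcoeff U_(lshift m ord0)%MM)) /eqP; rewrite mcoeffX eqxx mcoeff0 oner_eq0.
by move=> a [k' [f1 [f'E f1k f1t]]]; exists a.+1, k', f1; rewrite fE f'E exprS mulrA.
Qed.

Lemma expn_mono (a b c : nat) : (a <= b)%N -> (a ^ c <= b ^ c)%N.
Proof. by case: c => // c ab; rewrite leq_exp2r. Qed.

(* T bounds the number of divisors of the integers up to a fixed power of b. *)
Definition bounded (X : eqType) (m : nat) (S : nat -> nat -> X -> Prop) : Prop :=
  exists c : nat, forall b mu T : nat, (c <= mu)%N -> (mu ^ m.+1 <= b)%N -> (T ^ 2 <= b)%N ->
    (0 < T)%N -> (0 < mu)%N -> (forall q, (0 < q <= b ^ c)%N -> (size (divisors q) <= T)%N) ->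
    atmost (S b mu) ((c * b ^ m * T ^ c)%N%:R / mu%:R).

Section Bounded.
Variables (X : eqType) (m : nat).
Implicit Types S : nat -> nat -> X -> Prop.

Lemma bounded_ge S c c' : (c <= c')%N ->
  (forall b mu T : nat, (c <= mu)%N -> (mu ^ m.+1 <= b)%N -> (T ^ 2 <= b)%N ->
    (0 < T)%N -> (0 < mu)%N -> (forall q, (0 < q <= b ^ c)%N -> (size (divisors q) <= T)%N) ->
    atmost (S b mu) ((c * b ^ m * T ^ c)%N%:R / mu%:R)) ->
  (forall b mu T : nat, (c' <= mu)%N -> (mu ^ m.+1 <= b)%N -> (T ^ 2 <= b)%N ->
    (0 < T)%N -> (0 < mu)%N -> (forall q, (0 < q <= b ^ c')%N -> (size (divisors q) <= T)%N) ->
    atmost (S b mu) ((c' * b ^ m * T ^ c')%N%:R / mu%:R)).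
Proof.
move=> cc H b mu T cmu mub Tb T0 mu0 Td.
have b0 : (0 < b)%N by apply: leq_trans mub; rewrite expn_gt0 mu0.
apply: (atmost_sub _ (H b mu T _ mub Tb T0 mu0 _)) => //; first exact: leq_trans cmu.
- by move=> q /andP[q0 qb]; apply: Td; rewrite q0 (leq_trans qb) ?leq_pexp2l.
- rewrite ler_wpM2r ?invr_ge0 ?ler0n // ler_nat leq_mul //; first by rewrite leq_mul2r cc orbT.
  by rewrite leq_pexp2l.
Qed.

Lemma bounded_or S1 S2 : bounded m S1 -> bounded m S2 -> bounded m (fun b mu t => S1 b mu t \/ S2 b mu t).
Proof.
move=> [c1 H1] [c2 H2]; exists (c1 + c2)%N => b mu T cmu mub Tb T0 mu0 Td.
have b0 : (0 < b)%N by apply: leq_trans mub; rewrite expn_gt0 mu0.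
have K1 : atmost (S1 b mu) ((c1 * b ^ m * T ^ (c1 + c2))%N%:R / mu%:R).
  apply: (atmost_sub _ (H1 b mu T _ mub Tb T0 mu0 _)) => //; first exact: leq_trans (leq_addr _ _) cmu.
    by move=> q /andP[q0 qb]; apply: Td; rewrite q0 (leq_trans qb) ?leq_pexp2l ?leq_addr.
  by rewrite ler_wpM2r ?invr_ge0 ?ler0n // ler_nat leq_mul // leq_pexp2l ?leq_addr.
have K2 : atmost (S2 b mu) ((c2 * b ^ m * T ^ (c1 + c2))%N%:R / mu%:R).
  apply: (atmost_sub _ (H2 b mu T _ mub Tb T0 mu0 _)) => //; first exact: leq_trans (leq_addl _ _) cmu.
    by move=> q /andP[q0 qb]; apply: Td; rewrite q0 (leq_trans qb) ?leq_pexp2l ?leq_addl.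
  by rewrite ler_wpM2r ?invr_ge0 ?ler0n // ler_nat leq_mul // leq_pexp2l ?leq_addl.
apply: (atmost_sub _ (atmost_or K1 K2)) => //.
by rewrite -mulrDl -natrD -!mulnDl.
Qed.

Lemma bounded_sub S1 S2 : (exists c, forall b mu t, (c <= mu)%N -> (0 < mu)%N -> (mu ^ m.+1 <= b)%N -> S1 b mu t -> S2 b mu t) ->
  bounded m S2 -> bounded m S1.
Proof.
move=> [c S12] [c2 H2]; exists (c + c2)%N => b mu T cmu mub Tb T0 mu0 Td.
apply: (atmost_sub _ (@bounded_ge S2 c2 (c + c2) (leq_addl _ _) H2 b mu T cmu mub Tb T0 mu0 Td)) => // t.
by apply: S12 => //; exact: leq_trans (leq_addr _ _) cmu.
Qed.

Lemma bounded_seq (I : eqType) (l : seq I) (S : I -> nat -> nat -> X -> Prop) :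
  (forall i, i \in l -> bounded m (S i)) -> bounded m (fun b mu t => exists2 i, i \in l & S i b mu t).
Proof.
elim: l => [|i l IH] Sl.
  exists 0 => b mu T _ _ _ _ _ _ [|t s] //= _ st; last by have [] := st t (mem_head _ _).
  by rewrite divr_ge0 ?ler0n.
have [|c H] := bounded_or (Sl i (mem_head _ _)) (IH _).
  by move=> j jl; apply: Sl; rewrite inE jl orbT.
apply: bounded_sub (ex_intro _ c H); exists 0 => b mu t _ _ _ [j].
by rewrite inE => /orP[/eqP ->|jl] Sj; [left|right; exists j].
Qed.

(** As C enters the new constant, C <= mu <= b, so that (C b)^c is at most b^(2c). *)
Lemma bounded_dilate S C : (0 < C)%N -> bounded m S -> bounded m (fun b mu t => S (C * b)%N mu t).
Proof.
move=> C0 [c H]; exists (2 * c + C + c * C ^ m)%N => b mu T cmu mub Tb T0 mu0 Td.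
have mu1 : (mu <= b)%N by apply: leq_trans mub; rewrite -[X in (X <= _)%N]expn1 leq_pexp2l.
have b0 : (0 < b)%N by apply: leq_trans mu1.
have Cb : (C <= b)%N by apply: leq_trans (leq_trans cmu mu1); rewrite addnAC leq_addl.
have bCb : (b <= C * b)%N by rewrite leq_pmull.
apply: (atmost_sub _ (H (C * b)%N mu T _ (leq_trans mub bCb) (leq_trans Tb bCb) T0 mu0 _)) => //.
- by apply: leq_trans cmu; rewrite mul2n -addnn -!addnA leq_addr.
- move=> q /andP[q0 qb]; apply: Td; rewrite q0 (leq_trans qb) //.
  apply: (@leq_trans (b ^ (2 * c))); first by rewrite mul2n -addnn expnD expnMn leq_mul ?expn_mono.
  by rewrite leq_pexp2l // -addnA leq_addr.
- rewrite ler_wpM2r ?invr_ge0 ?ler0n // ler_nat expnMn mulnA leq_mul //.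
    by rewrite leq_mul2r leq_addl orbT.
  by rewrite leq_pexp2l // mul2n -addnn -!addnA leq_addr.
Qed.

End Bounded.

Lemma expf_div (K : fieldType) (x : K) (p q : nat) : x != 0 -> x ^+ (p + q) / x ^+ q = x ^+ p.
Proof. by move=> x0; rewrite exprD mulfK// expf_neq0. Qed.

(** For m = p + 2 the count is about mu^m b^(m-1). Multiplied by mu it is at most b^m because
    mu^(m+1) <= b, which is the origin of this condition in [bounded]. *)
Lemma bad_bound (a c2 c3 p b mu T X B : nat) : (X <= a * mu)%N -> (B <= 3 * b)%N -> (0 < T)%N ->
  (mu ^ p.+3 <= b)%N ->
  ((X ^ p.+2 * (c2 * B ^ p.+1 * (2 * T + 1)) + X * (T * (T * (X ^ p * B ^ p * (c3 * T * b * mu))))) * mu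
   <= (a ^ p.+2 * c2 * 3 ^ p.+2 + a ^ p.+1 * 3 ^ p * c3) * b ^ p.+2 * T ^ 3)%N.
Proof.
move=> Xa Bb T0 mub.
have X1 k : (X ^ k <= a ^ k * mu ^ k)%N by rewrite -expnMn expn_mono.
have B1 k : (B ^ k <= 3 ^ k * b ^ k)%N by rewrite -expnMn expn_mono.
have T3 : (T <= T ^ 3)%N by rewrite -[X in (X <= _)%N]expn1 leq_pexp2l.
rewrite mulnDl mulnDl mulnDl; apply: leq_add.
  apply: (@leq_trans (a ^ p.+2 * mu ^ p.+2 * (c2 * (3 ^ p.+1 * b ^ p.+1) * (3 * T ^ 3)) * mu)).
    rewrite leq_mul2r leq_mul ?orbT // leq_mul ?leq_mul //; move: T0 T3; lia.
  have -> : (a ^ p.+2 * mu ^ p.+2 * (c2 * (3 ^ p.+1 * b ^ p.+1) * (3 * T ^ 3)) * mu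
      = mu ^ p.+3 * (a ^ p.+2 * c2 * 3 ^ p.+2 * b ^ p.+1 * T ^ 3))%N.
    rewrite [(mu ^ p.+3)%N]expnSr [(3 ^ p.+2)%N]expnS.
    by move: (mu ^ p.+2)%N (a ^ p.+2)%N (3 ^ p.+1)%N (b ^ p.+1)%N (T ^ 3)%N => u1 u2 u3 u4 u5; ring.
  have -> : (a ^ p.+2 * c2 * 3 ^ p.+2 * b ^ p.+2 * T ^ 3 = b * (a ^ p.+2 * c2 * 3 ^ p.+2 * b ^ p.+1 * T ^ 3))%N.
    rewrite [(b ^ p.+2)%N]expnS.
    by move: (a ^ p.+2)%N (3 ^ p.+2)%N (b ^ p.+1)%N (T ^ 3)%N => u2 u3 u4 u5; ring.
  by rewrite leq_mul2r mub orbT.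
apply: (@leq_trans (a * mu * (T * (T * (a ^ p * mu ^ p * (3 ^ p * b ^ p) * (c3 * T * b * mu)))) * mu)).
  by rewrite leq_mul2r leq_mul ?orbT // !leq_mul.
have -> : (a * mu * (T * (T * (a ^ p * mu ^ p * (3 ^ p * b ^ p) * (c3 * T * b * mu)))) * mu
    = mu ^ p.+3 * (a ^ p.+1 * 3 ^ p * c3 * b ^ p.+1 * T ^ 3))%N.
  rewrite !expnSr !expn0; move: (mu ^ p)%N (a ^ p)%N (3 ^ p)%N (b ^ p)%N => u1 u2 u3 u4; ring.
have -> : (a ^ p.+1 * 3 ^ p * c3 * b ^ p.+2 * T ^ 3 = b * (a ^ p.+1 * 3 ^ p * c3 * b ^ p.+1 * T ^ 3))%N.
  rewrite [(b ^ p.+2)%N]expnS.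
  by move: (a ^ p.+1)%N (3 ^ p)%N (b ^ p.+1)%N (T ^ 3)%N => u2 u3 u4 u5; ring.
by rewrite leq_mul2r mub orbT.
Qed.

Lemma natr_odd (k : nat) : 2 * k%:R + 1 = (2 * k + 1)%N%:R :> rat.
Proof. by rewrite natrD natrM. Qed.

Lemma bounded_bad (m : nat) (Q0 : {mpoly int[m]}) (C : nat) : Q0 \is 2.-homog -> (2 < qf_rank Q0)%N ->
  (0 < C)%N -> bounded m (fun b mu => bad_pair Q0 C b mu).
Proof.
case: m Q0 => [|[|p]] Q0 Q0h Q0r C0.
- by have := leq_trans Q0r (rank_leq_col _).
- by have := leq_trans Q0r (rank_leq_col _).
set m := p.+2 in Q0 Q0h Q0r *.
pose s := msize Q0; pose a := (2 * C + 1)%N; pose c2 := (m * s.+1)%N; pose c3 := (18 * (2 + C) * C)%N.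
pose K := (m * (a ^ p.+2 * c2 * 3 ^ p.+2 + a ^ p.+1 * 3 ^ p * c3))%N.
exists (3 + 2 * m * C + mnorm Q0 + (3 * s + 1) + K)%N => b mu T cmu mub Tb T0 mu0 Td.
set c := (_ + K)%N in cmu Td *.
have mu1 : (mu <= b)%N by apply: leq_trans mub; rewrite -[X in (X <= _)%N]expn1 leq_pexp2l.
have b0 : (0 < b)%N by apply: leq_trans mu1.
have cb : (c <= b)%N by apply: leq_trans mu1.
have mCb : (2 * m * C <= b)%N by apply: leq_trans cb; rewrite /c; lia.
have Y1 : (m * (C * mu * b) <= b ^ c)%N.
  apply: (@leq_trans (b ^ 3)); last by rewrite leq_pexp2l // /c -!addnA leq_addr.
  have -> : (m * (C * mu * b) = m * C * (mu * b))%N by ring.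
  rewrite !expnS expn0 muln1 leq_mul // ?leq_mul //; move: mCb; lia.
have Y2 : (mnorm Q0 * ((2 * m) * (C * mu * b)) ^ msize Q0 <= b ^ c)%N.
  apply: (@leq_trans (b * (b ^ 3) ^ s)).
    apply: leq_mul; first by apply: leq_trans cb; rewrite /c; lia.
    apply: expn_mono; have -> : (2 * m * (C * mu * b) = 2 * m * C * (mu * b))%N by ring.
    by rewrite !expnS expn0 muln1 leq_mul // leq_mul.
  by rewrite -expnM -expnS leq_pexp2l // /c; lia.
have := bad_count Q0h Q0r C0 mu0 mu1 Td Y1 Y2.
move=> H; apply: (atmost_sub _ H) => //.
rewrite ler_pdivlMr ?ltr0n //.
set X := (2 * (C * mu) + 1)%N; set B := (2 * b + 1)%N.
have -> : 2 * (C * mu)%:R + 1 = X%:R :> rat by exact: natr_odd.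
have -> : 2 * b%:R + 1 = B%:R :> rat by exact: natr_odd.
have X0 : X%:R != 0 :> rat by rewrite /X addn1 pnatr_eq0.
have B0 : B%:R != 0 :> rat by rewrite /B addn1 pnatr_eq0.
have EX : X%:R ^+ m / X%:R ^+ 2 = X%:R ^+ p :> rat by rewrite -(expf_div p 2 X0) addn2.
have EB : B%:R ^+ m / B%:R ^+ 2 = B%:R ^+ p :> rat by rewrite -(expf_div p 2 B0) addn2.
have EB1 : B%:R ^+ m / B%:R = B%:R ^+ p.+1 :> rat by rewrite -(expf_div p.+1 1 B0) addn1 expr1.
have ET : 2 * T%:R + 1 = (2 * T + 1)%N%:R :> rat by exact: natr_odd.
have E18 : 18 * (2 + C%:R) * C%:R * T%:R * b%:R * mu%:R = (c3 * T * b * mu)%N%:R :> rat.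
  by rewrite /c3 !natrM natrD.
rewrite EX EB -[X in X * (2 * T%:R + 1)]mulrA EB1 ET E18 -!natrX -!natrM -natrD -!natrM ler_nat.
rewrite -mulnA; apply: leq_trans (leq_mul (leqnn m) (bad_bound c2 c3 (a := a) _ _ T0 mub)) _.
- rewrite /X /a; move: mu0; lia.
- rewrite /B; move: b0; lia.
rewrite mulnA mulnA -/K; apply: leq_mul.
  by rewrite leq_mul2r /c leq_addl orbT.
by rewrite leq_pexp2l // /c -!addnA leq_addr.
Qed.

Lemma main_bound (m h K D k b T : nat) : (0 < T)%N -> (0 < b)%N ->
  ((2 * ((h + 2 * (4 * T ^ 2)) * b) + 1) ^ m * (2 * T * (4 * T ^ 2 * K ^ m)) * ((m * D + T * k) * 2)
   <= ((3 * (h + 8)) ^ m * 16 * K ^ m * (m * D + k)) * b ^ m * T ^ (2 * m + 4))%N.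
Proof.
move=> T0 b0; have T2 : (0 < T ^ 2)%N by rewrite expn_gt0 T0.
have H1 : (2 * ((h + 2 * (4 * T ^ 2)) * b) + 1 <= 3 * (h + 8) * T ^ 2 * b)%N.
  by move: (T ^ 2)%N T2 => u u0; nia.
have H2 : (m * D + T * k <= (m * D + k) * T)%N by nia.
apply: (@leq_trans ((3 * (h + 8)) ^ m * (T ^ 2) ^ m * b ^ m * (2 * T * (4 * T ^ 2 * K ^ m)) * ((m * D + k) * T * 2))).
  by rewrite leq_mul ?leq_mul // -!expnMn expn_mono.
have -> : (T ^ (2 * m + 4) = (T ^ 2) ^ m * (T * (T ^ 2 * T)))%N by rewrite expnD expnM [(T ^ 4)%N]expnS [(T ^ 3)%N]expnSr.
move: ((3 * (h + 8)) ^ m)%N ((T ^ 2) ^ m)%N (b ^ m)%N (K ^ m)%N (T ^ 2)%N (m * D + k)%N => u1 u2 u3 u4 u5 u6.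
by rewrite leq_eqVlt; apply/orP; left; apply/eqP; ring.
Qed.

(** * Points whose first coordinate is prime to p *)

Section FiberCount.
Variables (m : nat) (Q0 : {mpoly int[m]}).
Hypotheses (Q0_homog : Q0 \is 2.-homog) (Q0_rank : (2 < qf_rank Q0)%N).
Variables (r : nat) (F : 'I_r -> {mpoly int[1 + (1 + m)]}).
Hypothesis F_form : forall j, is_form (F j).
Hypothesis Z_codim : @codim_ge algC m.+1 3 (variety (quadric Q0) F).

Definition fiber_pair (s : bool) (w : 'rV[int]_m) (b mu : nat) (t : int * 'rV[int]_m) : Prop :=
  [/\ t.1 != 0, (`|t.1| <= b)%N, forall i, (`|t.2 ord0 i| <= b)%N, (t.1 %| qval Q0 t.2)%Z &
    exists p, [/\ prime p, (mu < p)%N, ~~ (p%:Z %| t.1)%Z &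
      forall j, (p%:Z %| evz (fiber_form Q0 F s w j) (pt t.1 t.2))%Z]].

Lemma rank_gt2 : (2 < m)%N.
Proof. exact: leq_trans Q0_rank (rank_leq_col _). Qed.

Lemma Q0_neq0 : Q0 != 0.
Proof.
apply: contraTneq Q0_rank => ->; rewrite /qf_rank -leqNgt.
have -> : qf_matrix (0 : {mpoly int[m]}) = 0.
  by apply/matrixP => i j; rewrite !mxE !mcoeff0 mul0r; case: ifP.
by rewrite mxrank0.
Qed.

Lemma fiber_form_neq0 s w : exists j, fiber_form Q0 F s w j != 0.
Proof.
have [||v /(_ 0)[j]] := @fiber_no_common_root m Q0 Q0_homog r F F_form Z_codim s w 1
    (delta_mx ord0 (Ordinal (ltnW (ltnW rank_gt2)))) => //.
  apply/eqP => /matrixP/(_ ord0 (Ordinal (ltnW (ltnW rank_gt2)))).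
  by rewrite !mxE !eqxx.
by move=> H; exists j; apply: contraNneq H => ->; rewrite /evz mmap0.
Qed.

Lemma dvdz_prime_expM (p a : nat) (x y : int) : prime p -> ~~ (p%:Z %| x)%Z ->
  (p%:Z %| x ^+ a * y)%Z -> (p%:Z %| y)%Z.
Proof.
move=> pp px; rewrite !dvdzE /= abszM Euclid_dvdM// abszX => /orP[|//].
by rewrite Euclid_dvdX// => /andP[H]; case/negP: px; rewrite dvdzE.
Qed.

Lemma bounded_fiber_pair s w : bounded m (fiber_pair s w).
Proof.
have [C C0 C_spec] := lat_short_basis m.
have [j0 fj0] := fiber_form_neq0 s w.
have [d fd] := fiber_form_homog Q0_homog F_form s w j0.
have [a [k [f0 [fE f0k f0t]]]] := first_variable_part fj0 fd.
have f0_dvd (p : nat) (x : int) (y : 'rV[int]_m) : prime p -> ~~ (p%:Z %| x)%Z ->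
    (forall j, (p%:Z %| evz (fiber_form Q0 F s w j) (pt x y))%Z) -> (p%:Z %| evz f0 (pt x y))%Z.
  move=> pp px /(_ j0); rewrite fE.
  set phi : {rmorphism {mpoly int[1 + m]} -> int} := mmap intr (pt x y).
  rewrite -[evz _ _]/(phi _) rmorphM rmorphXn /= mmapX mmap1U pt_l; exact: dvdz_prime_expM.
pose Fs := fiber_form Q0 F s w.
(* For k = 0 the form f0 is a nonzero constant; a prime above its absolute value does not divide it,
   and nothing is left to count. *)
have [k0|k0] := posnP k.
  pose c := evz f0 (fun=> 0 : int).
  have cE (v : 'I_(1 + m) -> int) : evz f0 v = c.
    have := evz_homog_scale v 0 f0k; rewrite [X in _ ^+ X]k0 mul1r => <-.
    by apply: eq_evz => i; rewrite mul0r.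
  have c0 : c != 0.
    have [e] := int_grid_nonvanishing f0t.
    by rewrite evz_meval evz_top_form cE.
  exists `|c|%N => b mu T cmu _ _ _ _ _ [|t l] _ tl /=; first by rewrite divr_ge0 ?ler0n.
  have [_ _ _ _ [p [pp mup px pF]]] := tl t (mem_head _ _).
  have := f0_dvd p _ _ pp px pF; rewrite cE dvdzE /= => /dvdn_leq.
  by rewrite absz_gt0 c0 leqNgt (leq_ltn_trans cmu mup) => /(_ isT).
have no_root (x : int) (e : 'rV[int]_m) : x != 0 -> evz (top_form f0) (e ord0) != 0 ->
    exists v : 'rV[algC]_m, forall t : algC, evz f0 (pt x%:~R (v + t *: map_mx intr e)) = 0 ->
      exists j, evz (Fs j) (pt x%:~R (v + t *: map_mx intr e)) != 0.
  move=> x0 te; have e0 : e != 0.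
    apply: contraNneq te => ->; rewrite evz_top_form.
    have := evz_homog_scale (pt 0 (0 : 'rV[int]_m)) 0 f0k; rewrite expr0n gtn_eqF// mul0r => H.
    by apply/eqP; rewrite -[RHS]H; apply: eq_evz => i; case: (split_ordP i) => j ->;
      rewrite ?(pt_l, pt_r) ?mxE mulr0.
  by have [v vP] := fiber_no_common_root Q0_homog F_form Z_codim s w x0 e0; exists v.
apply: (@bounded_sub _ _ _ (fun b mu t => bad_pair Q0 C b mu t \/ main_pair Q0 f0 Fs C b mu t)).
  exists 0 => b mu t _ _ _ [x0 xb yb xq [p [pp mup px pF]]].
  have [bad|nbad] := pselect (bad_pair Q0 C b mu t); [by left|right].
  by split=> //; split=> //; exists p; split=> //; exact: f0_dvd.
apply: bounded_or; first exact: bounded_bad.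
pose Phi c := line_res f0 (power_comb Fs c).
pose K := (m * (msize (top_form f0)).+1)%N; pose h := (1 + 2 * m + m * K)%N.
pose S := (\max_(c < (k * r).+1) (msize (Phi c)))%N; pose N := (\max_(c < (k * r).+1) (mnorm (Phi c)))%N.
have SP c : (c <= k * r)%N -> (msize (Phi c) <= S)%N.
  by rewrite -ltnS => ck; exact: (@leq_bigmax _ (fun c : 'I__ => msize (Phi c)) (Ordinal ck)).
have NP c : (c <= k * r)%N -> (mnorm (Phi c) <= N)%N.
  by rewrite -ltnS => ck; exact: (@leq_bigmax _ (fun c : 'I__ => mnorm (Phi c)) (Ordinal ck)).
pose D3 := S.+2; pose G := ((3 * (h + 8)) ^ m * 16 * K.+1 ^ m * (m * D3 + k))%N.
pose s0 := msize Q0.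
exists (mnorm (top_form f0) + K + 2 * (m * s0.+1) + (h + 8) + mnorm Q0 + N + 2 + (4 * s0 + 1) + (4 * S + 1) + G + (2 * m + 4))%N.
move=> b mu T cmu mub Tb T0 mu0 Td; set c := (_ + (2 * m + 4))%N in cmu Td *.
have mu1 : (mu <= b)%N by apply: leq_trans mub; rewrite -[X in (X <= _)%N]expn1 leq_pexp2l.
have b0 : (0 < b)%N by apply: leq_trans mu1.
have cb : (c <= b)%N by apply: leq_trans mu1.
have b3b : ((h + 2 * (4 * T ^ 2)) * b <= b ^ 3)%N.
  rewrite [(b ^ 3)%N]expnSr leq_mul2r; apply/orP; right.
  apply: (@leq_trans ((h + 8) * b)%N); last by rewrite expnS expn1 leq_mul2r; apply/orP; right; apply: leq_trans cb; rewrite /c; lia.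
  by rewrite mulnDl; apply: leq_add; [exact: leq_pmulr|rewrite mulnA leq_mul].
have b3b' : (2 * ((h + 2 * (4 * T ^ 2)) * b) <= b ^ 4)%N.
  by rewrite expnS leq_mul //; apply: leq_trans cb; rewrite /c; lia.
have H := @main_count m Q0 Q0_homog Q0_neq0 r k f0 Fs f0k k0 f0t no_root C C_spec b mu T (b ^ c)
  mu0 mu1 Td _ _ _ _ _ _ D3 _.
apply: (atmost_sub _ (H _ _ _ _ _ _ _)) => //.
- by apply: leq_trans cmu; rewrite /c; lia.
- by apply: leq_trans cmu; rewrite /c -/K; lia.
- by apply: leq_trans cmu; rewrite /c /s0; lia.
- by rewrite -[X in (X <= _)%N]expn1 leq_pexp2l // /c; lia.
- rewrite -/K -/h; apply: (@leq_trans (b * (b ^ 3) ^ s0)).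
    by apply: leq_mul; [apply: leq_trans cb; rewrite /c; lia|exact: expn_mono].
  by rewrite -expnM -expnS leq_pexp2l // /c; lia.
- move=> c' ck; rewrite -/K -/h -/(Phi c'); apply: (@leq_trans (b * (b ^ 4) ^ S)).
    apply: leq_mul; first by apply: leq_trans (NP _ ck) _; apply: leq_trans cb; rewrite /c; lia.
    apply: leq_trans (expn_mono _ b3b') _; rewrite leq_pexp2l ?expn_gt0 ?b0 //; exact: SP.
  by rewrite -expnM -expnS leq_pexp2l // /c; lia.
- rewrite ler_pdivlMr ?ltr0n // -/K -/h natr_odd.
  have mm : mu%:R != 0 :> rat by rewrite pnatr_eq0 -lt0n.
  have mmm : mu%:R ^+ m != 0 :> rat by rewrite expf_neq0.
  set A := (2 * _ + 1)%N%:R ^+ m; set B := 2 * T%:R * _.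
  have -> : A * B * (mu%:R * ((m * D3)%:R * mu%:R ^+ m / mu%:R) + mu%:R ^+ m * (T%:R * k%:R)) /
      (mu%:R ^+ m * mu%:R / 2) * mu%:R = A * B * ((m * D3 + T * k) * 2)%N%:R.
    have -> : ((m * D3 + T * k) * 2)%N%:R = ((m * D3)%:R + T%:R * k%:R) * 2 :> rat.
      by rewrite natrM natrD (natrM _ T k).
    by field; rewrite mm mmm.
  rewrite /A /B -!natrX -!natrM ler_nat; apply: leq_trans (main_bound _ _ _ _ _ T0 b0) _.
  rewrite -/G !leq_mul // ?leq_pexp2l // /c; lia.
Qed.

End FiberCount.

(** * Points at which p divides the gradient *)

Lemma atmost_slice (m b : nat) (i0 : 'I_m) :
  atmost (fun y : 'rV[int]_m => (forall i, (`|y ord0 i| <= b)%N) /\ y ord0 i0 = 0)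
    ((2 * b + 1)%N%:R ^+ m.-1).
Proof.
have H : forall i, atmost (fun a : int => if i == i0 then a = 0 else (`|a| <= b)%N)
    (if i == i0 then 1 else (2 * b + 1)%N%:R).
  move=> i; case: ifP => _; first by apply: atmost1 => a a' -> ->.
  by rewrite -natr_odd; exact: atmost_int.
have := atmost_row H; rewrite (bigD1 i0)//= eqxx mul1r.
rewrite (eq_bigr (fun=> (2 * b + 1)%N%:R)) => [|i /negbTE ->//].
rewrite prodr_const cardC1 card_ord => K; apply: (atmost_sub _ K) => // y [yb y0] i.
by case: ifP => [/eqP ->|].
Qed.

Lemma bounded_inj (X U : eqType) (m : nat) (f : X -> U) S1 S2 :
  (exists c, forall b mu t, (c <= mu)%N -> (0 < mu)%N -> (mu ^ m.+1 <= b)%N -> S1 b mu t -> S2 b mu (f t)) ->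
  (forall b mu t t', S1 b mu t -> S1 b mu t' -> f t = f t' -> t = t') ->
  bounded m S2 -> bounded m S1.
Proof.
move=> [c S12] inj [c2 H2]; exists (c + c2)%N => b mu T cmu mub Tb T0 mu0 Td.
have H := bounded_ge (leq_addl c c2) H2 cmu mub Tb T0 mu0 Td.
apply: (atmost_inj _ _ H) => [t|t t']; last exact: inj.
by apply: S12 => //; exact: leq_trans (leq_addr _ _) cmu.
Qed.

Section Leftover.
Variables (m : nat) (Q0 : {mpoly int[m]}).
Hypotheses (Q0_homog : Q0 \is 2.-homog) (Q0_rank : (2 < qf_rank Q0)%N).

Definition radical_pair (b mu : nat) (t : int * 'rV[int]_m) : Prop :=
  [/\ forall i, (`|t.2 ord0 i| <= b)%N, qval Q0 t.2 != 0, (t.1 %| qval Q0 t.2)%Z &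
    exists p, [/\ prime p, (mu < p)%N & forall l, (p%:Z %| (t.2 *m quad_mx Q0) ord0 l)%Z]].

Lemma mulmx_upd (y : 'rV[int]_m) (S : 'M[int]_m) i a j :
  (y *m S) ord0 j = S i j * y ord0 i + (upd y i a *m S) ord0 j - a * S i j.
Proof.
rewrite [LHS]mxE [(upd _ _ _ *m S) _ _]mxE (bigD1 i)//= [in RHS](bigD1 i)//= mxE eqxx.
rewrite [in RHS](eq_bigr (fun l => y ord0 l * S l j)) => [|l li]; last by rewrite mxE (negbTE li).
by move: (\sum_(l < m | _) _) => u; ring.
Qed.

(** The prime p divides (y S)_j and y . c. As c_i = 0, the integer y . c does not involve y_i: if it
    is nonzero it leaves T choices for p, and then (y S)_j fixes y_i modulo p. If y . c = 0, another
    entry of y is determined by the rest. *)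
Lemma bounded_radical : bounded m radical_pair.
Proof.
have [i [j [c [Sij ci c0 rad]]]] := quad_mx_minor Q0_rank.
have /existsP[i1 ci1] : [exists l, c ord0 l != 0].
  apply: contraNT c0 => /existsPn H; apply/eqP/rowP => l; rewrite mxE.
  by have := H l; rewrite negbK => /eqP.
pose cm := (\max_l `|c ord0 l|)%N; pose s := msize Q0.
have cmP l : (`|c ord0 l| <= cm)%N by exact: (@leq_bigmax _ (fun l => `|c ord0 l|)%N).
have m0 : (0 < m)%N by exact: leq_ltn_trans (ltn_ord i).
exists (`|quad_mx Q0 i j| + m * cm + mnorm Q0 + (s + 2) + 8 * 3 ^ m.-1)%N.
move=> b mu T cmu mub Tb T0 mu0 Td; set k := (_ + 8 * 3 ^ m.-1)%N in cmu Td *.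
have mu1 : (mu <= b)%N by apply: leq_trans mub; rewrite -[X in (X <= _)%N]expn1 leq_pexp2l.
have b0 : (0 < b)%N by apply: leq_trans mu1.
have kb : (k <= b)%N by apply: leq_trans mu1.
pose box (y : 'rV[int]_m) := forall i, (`|y ord0 i| <= b)%N.
pose rad_cond (y : 'rV[int]_m) := exists p, [/\ prime p, (mu < p)%N & forall l, (p%:Z %| (y *m quad_mx Q0) ord0 l)%Z].
pose BB : rat := (2 * b + 1)%N%:R.
have BB0 : 0 <= BB by exact: ler0n.
have updbox y l : box y -> box (upd y l 0) by move=> yb l'; rewrite mxE; case: ifP.
have muR : 0 < mu%:R :> rat by rewrite ltr0n.
have c3 : 0 <= 3 * b%:R / mu%:R :> rat by rewrite divr_ge0 ?ler0n // mulr_ge0 ?ler0n.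
have H1 : atmost (fun y => [/\ box y, rad_cond y & dot y c = 0]) (BB ^+ m.-1 * 1).
  apply: (@atmost_rel 'rV[int]_m 'rV[int]_m _ (fun z => box z /\ z ord0 i1 = 0) (fun y z => upd y i1 0 = z)).
  - by move=> y [yb _ _]; exists (upd y i1 0) => //; split; [exact: updbox|rewrite mxE eqxx].
  - exact: atmost_slice.
  - move=> z _; apply: atmost1 => y y' [[_ _ yc] yz] [[_ _ yc'] yz'].
    have E l : l != i1 -> y ord0 l = y' ord0 l.
      by move=> li; have := congr1 (fun v : 'rV[int]_m => v ord0 l) (etrans yz (esym yz')); rewrite !mxE (negbTE li).
    apply/rowP => l; have [->|] := eqVneq l i1; last exact: E.
    move: yc yc'; rewrite !dotE (bigD1 i1)//= => e1; rewrite (bigD1 i1)//= => e2.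
    have : y ord0 i1 * c ord0 i1 = y' ord0 i1 * c ord0 i1.
      apply: (addIr (\sum_(l0 < m | l0 != i1) y ord0 l0 * c ord0 l0)); rewrite e1 -[LHS]e2; congr (_ + _).
      by apply: eq_bigr => l0 /E ->.
    exact: mulIf.
  - exact: ler01.
have H2 : atmost (fun y => [/\ box y, rad_cond y & dot y c != 0]) (BB ^+ m.-1 * (T%:R * (3 * b%:R / mu%:R))).
  apply: (@atmost_rel 'rV[int]_m 'rV[int]_m _ (fun z => box z /\ z ord0 i = 0) (fun y z => upd y i 0 = z)).
  - by move=> y [yb _ _]; exists (upd y i 0) => //; split; [exact: updbox|rewrite mxE eqxx].
  - exact: atmost_slice.
  - move=> z [zb zi].
    have dE y : upd y i 0 = z -> dot y c = dot z c.
      by move=> <-; rewrite !dotE; apply: eq_bigr => l _; rewrite mxE; case: eqP => // ->; rewrite ci !mulr0.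
    have [/eqP dz|dz] := boolP (dot z c == 0).
      move=> [|y l] _ sy /=; first by rewrite mulr_ge0 ?ler0n.
      by have [[_ _ +] /dE yz] := sy y (mem_head _ _); rewrite yz dz eqxx.
    apply: (@atmost_rel 'rV[int]_m nat _ (fun p => p \in divisors `|dot z c| /\ [/\ prime p & (mu < p)%N])
       (fun y p => (p%:Z %| (y *m quad_mx Q0) ord0 j)%Z)).
    + move=> y [[yb [p [pp mup pS]] _] yz]; exists p => //; split=> //.
      by rewrite -dvdn_divisors ?absz_gt0 // -[(p %| _)%N]/(p%:Z %| dot z c)%Z -(dE y yz); exact: rad.
    + apply: (atmost_sub _ (@atmost_seq _ (divisors `|dot z c|))) => [p []//|].
      rewrite ler_nat; apply: Td; rewrite absz_gt0 dz /=.
      apply: (leq_trans (dot_bound zb cmP)).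
      apply: (@leq_trans (b ^ 2)); last by rewrite leq_pexp2l // /k -!addnA; lia.
      rewrite expnS expn1 [(b * cm)%N]mulnC mulnA leq_mul2r; apply/orP; right.
      by apply: leq_trans kb; rewrite /k; lia.
    + move=> p [_ [pp mup]].
      have p0 := prime_gt0 pp.
      have Hl := @atmost_int_lin b p (quad_mx Q0 i j) ((z *m quad_mx Q0) ord0 j) p0.
      apply: (@atmost_inj 'rV[int]_m int _ (fun a => (`|a| <= b)%N /\ (p%:Z %| quad_mx Q0 i j * a + (z *m quad_mx Q0) ord0 j)%Z) (fun y => y ord0 i)).
      * move=> y [[[yb _ _] yz] yp]; split; first exact: yb.
        by move: yp; rewrite (mulmx_upd y _ i 0) yz mul0r subr0.
      * move=> y y' [[_ yz] _] [[_ yz'] _] yi; apply/rowP => l; have [->//|li] := eqVneq l i.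
        by have := congr1 (fun v : 'rV[int]_m => v ord0 l) (etrans yz (esym yz')); rewrite !mxE (negbTE li).
      * apply: (atmost_sub _ Hl) => //.
        (* The entry S_ij is nonzero and below p in absolute value, since mu is at least the
           constant. *)
        have -> : gcdn p `|quad_mx Q0 i j| = 1%N.
          apply/eqP; rewrite -/(coprime _ _) prime_coprime // gtnNdvd ?absz_gt0 //.
          by apply: leq_ltn_trans mup; apply: leq_trans cmu; rewrite /k; lia.
        rewrite mulr1; have pR : 0 < p%:R :> rat by rewrite ltr0n.
        have h1 : 2 * b%:R / p%:R <= 2 * b%:R / mu%:R :> rat.
          by rewrite ler_wpM2l ?mulr_ge0 ?ler0n // lef_pV2 ?posrE // ler_nat ltnW.
        have h2 : 1 <= b%:R / mu%:R :> rat by rewrite ler_pdivlMr // mul1r ler_nat.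
        apply: (@le_trans _ _ (2 * b%:R / mu%:R + b%:R / mu%:R)); first exact: lerD.
        by rewrite -!mulrDl le_eqVlt; apply/orP; left; apply/eqP; ring.
    + exact: c3.
  - by rewrite mulr_ge0 ?ler0n.
have H12 : atmost (fun y => box y /\ rad_cond y) (BB ^+ m.-1 * 1 + BB ^+ m.-1 * (T%:R * (3 * b%:R / mu%:R))).
  apply: (atmost_sub _ (atmost_or H1 H2)) => // y [yb yr].
  by have /orP[/eqP q0|q0] := orbN (dot y c == 0); [left|right].
have H : atmost (radical_pair b mu)
   ((BB ^+ m.-1 * 1 + BB ^+ m.-1 * (T%:R * (3 * b%:R / mu%:R))) * (2 * T%:R)).
  apply: (@atmost_rel (int * 'rV[int]_m)%type 'rV[int]_m _ (fun y => box y /\ rad_cond y) (fun t y => t.2 = y)).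
  - by move=> t [tb _ _ tr]; exists t.2.
  - exact: H12.
  - move=> y [yb _]; have [qy|qy] := boolP (qval Q0 y == 0).
      move=> [|t l] _ st /=; first by rewrite mulr_ge0 ?ler0n.
      by have [[_ + _ _] ty] := st t (mem_head _ _); rewrite ty qy.
    apply: (@atmost_inj (int * 'rV[int]_m)%type int _ (fun x => (x %| qval Q0 y)%Z) fst).
    + by move=> t [[_ _ tq _] ty]; rewrite -ty.
    + by move=> [x1 y1] [x2 y2] [_ /= ->] [_ /= ->] /= ->.
    + apply: atmost_divisors => //; apply: Td; rewrite absz_gt0 qy /=.
      apply: leq_trans (qval_bound _ b0 yb) _.
      apply: (@leq_trans (b * b ^ s)); last by rewrite -expnS leq_pexp2l // /k; lia.
      by rewrite leq_mul2r; apply/orP; right; apply: leq_trans kb; rewrite /k; lia.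
  - by rewrite mulr_ge0 ?ler0n.
apply: (atmost_sub _ H) => //; rewrite ler_pdivlMr // mulr1.
have -> : (BB ^+ m.-1 + BB ^+ m.-1 * (T%:R * (3 * b%:R / mu%:R))) * (2 * T%:R) * mu%:R
    = ((2 * b + 1) ^ m.-1 * ((mu + 3 * T * b) * (2 * T)))%N%:R :> rat.
  by rewrite !natrM natrD natrX -/BB !natrM; field; rewrite gt_eqF.
rewrite ler_nat.
apply: (@leq_trans ((3 ^ m.-1 * b ^ m.-1) * ((4 * T * b) * (2 * T)))).
  apply: leq_mul; first by rewrite -expnMn expn_mono //; lia.
  by rewrite leq_mul2r; apply/orP; right; nia.
have -> : (3 ^ m.-1 * b ^ m.-1 * (4 * T * b * (2 * T)) = 8 * 3 ^ m.-1 * (b * b ^ m.-1) * T ^ 2)%N.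
  by rewrite expnS expn1; move: (3 ^ m.-1)%N (b ^ m.-1)%N => u v; ring.
rewrite -expnS prednK //; apply: leq_mul; last by rewrite leq_pexp2l // /k; lia.
by rewrite leq_mul2r /k leq_addl orbT.
Qed.

End Leftover.

(** * Change of coordinates by isometries *)

Section Combine.
Variables (m : nat) (Q0 : {mpoly int[m]}).
Hypotheses (Q0_homog : Q0 \is 2.-homog) (Q0_rank : (2 < qf_rank Q0)%N).
Variables (r : nat) (F : 'I_r -> {mpoly int[1 + (1 + m)]}).
Hypothesis F_form : forall j, is_form (F j).
Hypothesis Z_codim : @codim_ge algC m.+1 3 (variety (quadric Q0) F).

Let vec := 'rV[int]_(1 + (1 + m)).

Definition ycoord (x : vec) : 'rV[int]_m := \row_j x ord0 (ixy j).

Lemma pt3_coord (s : bool) (x : vec) :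
  x ord0 =1 pt3 s (x ord0 (ix0 m s)) (x ord0 (ix0 m (~~ s))) (ycoord x).
Proof. by move=> i; case: (pt3P s i) => [->|->|[j ->]]; rewrite ?(pt3_x0, pt3_x1, pt3_y) // mxE. Qed.

Lemma on_quadric (s : bool) (x : vec) : evz (quadric Q0) (x ord0) = 0 ->
  x ord0 (ix0 m s) * x ord0 (ix0 m (~~ s)) = qval Q0 (ycoord x).
Proof. by rewrite (eq_evz _ (pt3_coord s x)) evz_quadric => /eqP; rewrite subr_eq0 => /eqP. Qed.

(** The image under the isometry without its coordinate x0, which [new_coord_quadric] gives back
    when the first component is nonzero. *)
Definition new_coord (s : bool) (w : 'rV[int]_m) (x : vec) : int * 'rV[int]_m :=
  (x ord0 (ix0 m (~~ s)) + bq Q0 (ycoord x) w + x ord0 (ix0 m s) * qval Q0 w,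
   ycoord x + x ord0 (ix0 m s) *: w).

Lemma new_coord_quadric s w (x : vec) : evz (quadric Q0) (x ord0) = 0 ->
  x ord0 (ix0 m s) * (new_coord s w x).1 = qval Q0 (new_coord s w x).2.
Proof.
by move=> /(on_quadric s) Qx; rewrite /new_coord /= qvalD// qvalZ// bqZr -Qx; ring.
Qed.

(** With X the new first coordinate, [fiber_param] inverts the isometry up to the factor X, so that
    a form of degree d is multiplied by X^d. *)
Lemma new_coord_fiber s w (x : vec) j : evz (quadric Q0) (x ord0) = 0 ->
  exists d, evz (fiber_form Q0 F s w j) (pt (new_coord s w x).1 (new_coord s w x).2) =
    (new_coord s w x).1 ^+ d * evz (F j) (x ord0).
Proof.
move=> Qx; have [d Fd] := F_form j; exists d.
have := new_coord_quadric s w Qx; rewrite (evz_fiber_form Q0 F).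
set X := (new_coord s w x).1; set y := (new_coord s w x).2 => qy.
rewrite -evz_homog_scale//; apply: eq_evz => i.
rewrite (pt3_coord s x) -qy intz_map.
have bw : bq Q0 w w = 2 * qval Q0 w by rewrite -qval2//; ring.
case: (pt3P s i) => [->|->|[l ->]]; rewrite ?(pt3_x0, pt3_x1, pt3_y).
- by rewrite mulrC.
- rewrite /y /X /new_coord /= bqDl bqZl bw intz; ring.
- by rewrite /y /new_coord /= !mxE -/X; ring.
Qed.

Lemma new_coord_inj s w (x x' : vec) : evz (quadric Q0) (x ord0) = 0 -> evz (quadric Q0) (x' ord0) = 0 ->
  (new_coord s w x).1 != 0 -> new_coord s w x = new_coord s w x' -> x = x'.
Proof.
move=> Qx Qx' X0 E.
have h0 : x ord0 (ix0 m s) = x' ord0 (ix0 m s).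
  apply: (mulIf X0); rewrite (new_coord_quadric s w Qx) {1}E -(new_coord_quadric s w Qx') -E.
  by [].
have hy : ycoord x = ycoord x'.
  by have := congr1 snd E; rewrite /new_coord /= h0 => /addIr.
have h1 : x ord0 (ix0 m (~~ s)) = x' ord0 (ix0 m (~~ s)).
  by have := congr1 fst E; rewrite /new_coord /= h0 hy => /addIr/addIr.
by apply/rowP => i; rewrite (pt3_coord s x) (pt3_coord s x') h0 h1 hy.
Qed.

Lemma new_coord_bound s w : exists2 C : nat, (0 < C)%N & forall b (x : vec), (forall i, (`|x ord0 i| <= b)%N) ->
  (`|(new_coord s w x).1| <= C * b)%N /\ forall i, (`|(new_coord s w x).2 ord0 i| <= C * b)%N.
Proof.
pose W := (\max_l `|w ord0 l|)%N; pose SS := (\max_i \max_j `|quad_mx Q0 i j|)%N.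
have WP l : (`|w ord0 l| <= W)%N by exact: (@leq_bigmax _ (fun l => `|w ord0 l|)%N).
have SP i j : (`|quad_mx Q0 i j| <= SS)%N.
  apply: leq_trans (@leq_bigmax _ (fun i => \max_j `|quad_mx Q0 i j|)%N i).
  exact: (@leq_bigmax _ (fun j => `|quad_mx Q0 i j|)%N).
exists (1 + m * (m * SS * W) + `|qval Q0 w| + W)%N; first by rewrite -!addnA.
move=> b x xb; have yb l : (`|ycoord x ord0 l| <= b)%N by rewrite mxE.
have qb : (`|bq Q0 (ycoord x) w| <= m * (m * (b * SS) * W))%N.
  by rewrite bq_int; apply: dot_bound => // l; exact: mulmx_bound.
split=> [|i]; rewrite /new_coord /=.
  have h : (`|(x ord0 (ix0 m s) * qval Q0 w)%R| <= b * `|qval Q0 w|)%N by rewrite abszM leq_mul2r xb orbT.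
  have h' := xb (ix0 m (~~ s)).
  apply: leq_trans (abszD_le _ _) _; apply: leq_trans (leq_add (abszD_le _ _) (leqnn _)) _.
  apply: leq_trans (leq_add (leq_add h' qb) h) _.
  rewrite !mulnDl mul1n; move: (`|qval Q0 w|)%N => u; nia.
rewrite !mxE; apply: leq_trans (abszD_le _ _) _; rewrite abszM.
apply: leq_trans (leq_add (xb _) (leq_mul (xb _) (WP i))) _.
rewrite !mulnDl mul1n; nia.
Qed.

(* If p divides the new coordinate x1 for all these w, then p divides x0 and y is
   in the radical of Q0 modulo p. *)
Let dirs : seq 'rV[int]_m :=
  0 :: [seq delta_mx ord0 l | l <- enum 'I_m] ++
       [seq delta_mx ord0 i + delta_mx ord0 j | i <- enum 'I_m, j <- enum 'I_m].

Let bq_delta (y : 'rV[int]_m) l : bq Q0 y (delta_mx ord0 l) = (y *m quad_mx Q0) ord0 l.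
Proof.
rewrite bq_int dotE (bigD1 l)//= [delta_mx _ _ _ _]mxE !eqxx mulr1 big1 ?addr0// => l' /negbTE l'l.
by rewrite [delta_mx _ _ _ _]mxE l'l andbF mulr0.
Qed.

(** Polarization: w = 0 gives x1, w = e_l the gradient up to x0 Q0(e_l), and w = e_i + e_j leaves x0
    S_ij. The case d = 0 shows that some new coordinate is nonzero when x0 is. *)
Let dirs_dvd (d : int) s (x : vec) : (forall w, w \in dirs -> (d %| (new_coord s w x).1)%Z) ->
  [/\ (d %| x ord0 (ix0 m (~~ s)))%Z,
      forall l, (d %| (ycoord x *m quad_mx Q0) ord0 l + x ord0 (ix0 m s) * qval Q0 (delta_mx ord0 l))%Z &
      forall i j, (d %| x ord0 (ix0 m s) * quad_mx Q0 i j)%Z].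
Proof.
move=> H.
have q0 : qval Q0 (0 : 'rV[int]_m) = 0 by rewrite -(scale0r (0 : 'rV[int]_m)) qvalZ// expr0n mul0r.
have b0 (y : 'rV[int]_m) : bq Q0 y 0 = 0 by rewrite -(scale0r (0 : 'rV[int]_m)) bqZr mul0r.
have d0 : (d %| x ord0 (ix0 m (~~ s)))%Z.
  by have := H 0 (mem_head _ _); rewrite /new_coord /= q0 b0 addr0 mulr0 addr0.
have d1 l : (d %| (ycoord x *m quad_mx Q0) ord0 l + x ord0 (ix0 m s) * qval Q0 (delta_mx ord0 l))%Z.
  have := H (delta_mx ord0 l); rewrite inE mem_cat (map_f (fun l => delta_mx ord0 l)) ?mem_enum// orbT /= => /(_ isT).
  by rewrite /new_coord /= bq_delta -addrA rpredDl.
split=> // i j.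
have := H (delta_mx ord0 i + delta_mx ord0 j); rewrite inE mem_cat.
rewrite [X in _ || (_ || X)](allpairs_f (fun i j => delta_mx ord0 i + delta_mx ord0 j : 'rV[int]_m)) ?mem_enum//.
rewrite !orbT => /(_ isT); rewrite /new_coord /= bqDr qvalD// !bq_delta.
have -> : ((delta_mx ord0 i : 'rV[int]_m) *m quad_mx Q0) ord0 j = quad_mx Q0 i j.
  rewrite [LHS]mxE (bigD1 i)//= [delta_mx _ _ _ _]mxE !eqxx mul1r big1 ?addr0// => l /negbTE li.
  by rewrite [delta_mx _ _ _ _]mxE li andbF mul0r.
set a := x ord0 _; set e := x ord0 _; set q1 := qval _ _; set q2 := qval _ _; set u1 := (_ *m _) _ _; set u2 := (_ *m _) _ _.
have -> : a + (u1 + u2) + e * (q1 + q2 + quad_mx Q0 i j) = (a + (u1 + e * q1) + (u2 + e * q2)) + e * quad_mx Q0 i j by ring.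
by rewrite rpredDl //; apply: rpredD (d1 j); exact: rpredD d0 (d1 i).
Qed.

Definition common_prime_point (b mu : nat) (x : vec) : Prop :=
  [/\ evz (quadric Q0) (x ord0) = 0, forall i, (`|x ord0 i| <= b)%N &
    exists p, [/\ prime p, (mu < p)%N & forall j, (p%:Z %| evz (F j) (x ord0))%Z]].

Let reduced (sw : bool * 'rV[int]_m) (b mu : nat) (x : vec) : Prop :=
  [/\ common_prime_point b mu x, (new_coord sw.1 sw.2 x).1 != 0 &
    (exists p, [/\ prime p, (mu < p)%N, ~~ (p%:Z %| (new_coord sw.1 sw.2 x).1)%Z & forall j, (p%:Z %| evz (F j) (x ord0))%Z])
    \/ (exists p, [/\ prime p, (mu < p)%N & forall l, (p%:Z %| ((new_coord sw.1 sw.2 x).2 *m quad_mx Q0) ord0 l)%Z]) /\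
       qval Q0 (new_coord sw.1 sw.2 x).2 != 0].

Let bounded_reduced sw : bounded m (reduced sw).
Proof.
case: sw => s w; have [C C0 Cb] := new_coord_bound s w.
apply: (@bounded_inj _ _ _ (new_coord s w) _ (fun b mu t => fiber_pair Q0 F s w (C * b) mu t \/ radical_pair Q0 (C * b) mu t)); last first.
- apply: (@bounded_dilate _ _ (fun b mu t => fiber_pair Q0 F s w b mu t \/ radical_pair Q0 b mu t)) => //.
  by apply: bounded_or; [exact: bounded_fiber_pair|exact: bounded_radical].
- by move=> b mu x x' [[Qx _ _] /= X0 _] [[Qx' _ _] _ _]; exact: new_coord_inj.
- exists 0 => b mu x _ _ _ [[Qx xb _] /= X0]; have [b1 b2] := Cb b x xb.
  have Xq : ((new_coord s w x).1 %| qval Q0 (new_coord s w x).2)%Z by rewrite -new_coord_quadric// dvdz_mull.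
  case=> [[p [pp mup pX pF]]|[pS q0]]; [left|right]; last by split.
  split=> //; exists p; split=> // j.
  by have [d ->] := new_coord_fiber s w j Qx; rewrite dvdz_mull.
Qed.

Lemma bounded_common_prime_point : bounded m common_prime_point.
Proof.
have [i [j [c [Sij _ _ _]]]] := quad_mx_minor Q0_rank.
have m0 : (0 < m)%N by exact: leq_ltn_trans (ltn_ord i).
(* Points with x0 = x1 = 0 satisfy Q0(y) = 0 and are few. For the others, s selects a nonzero one of
   the two coordinates as x0. *)
pose zero b (mu : nat) (x : vec) := [/\ x ord0 (ix0 m true) = 0, x ord0 (ix0 m false) = 0,
  forall l, (`|ycoord x ord0 l| <= b)%N & evz Q0 (ycoord x ord0) = 0].
have bounded_zero : bounded m zero.
  exists (m * msize Q0 * 3 ^ m.-1)%N => b mu T cmu mub Tb T0 mu0 Td.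
  set k := (m * _ * _)%N in cmu Td *.
  have mu1 : (mu <= b)%N by apply: leq_trans mub; rewrite -[X in (X <= _)%N]expn1 leq_pexp2l.
  have b0 : (0 < b)%N by apply: leq_trans mu1.
  have Z := @box_zeros m b _ _ (Q0_neq0 Q0_rank) (leqnn _).
  apply: (atmost_sub (fun x z => z) (@atmost_inj vec 'rV[int]_m (zero b mu) _ ycoord _ _ _ Z)).
  - by move=> x [_ _ xb xq]; split; [exact: xb|exact: xq].
  - move=> x x' [x0 x1 _ _] [x0' x1' _ _] yy.
    by apply/rowP => l; rewrite (pt3_coord true x) (pt3_coord true x') /= x0 x1 x0' x1' yy.
  - rewrite natr_odd ler_pdivlMr ?ltr0n//; set B := (2 * b + 1)%N.
    have B0 : B%:R != 0 :> rat by rewrite /B addn1 pnatr_eq0.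
    have := expf_div m.-1 1 B0; rewrite addn1 prednK // expr1 => E.
    rewrite -[_ * _ / _]mulrA E -natrX -!natrM ler_nat.
    apply: (@leq_trans (m * msize Q0 * (3 ^ m.-1 * b ^ m.-1) * b)).
      by rewrite leq_mul // leq_mul2l -expnMn expn_mono ?orbT // /B; lia.
    have -> : (m * msize Q0 * (3 ^ m.-1 * b ^ m.-1) * b = k * (b * b ^ m.-1))%N by rewrite /k; ring.
    by rewrite -expnS prednK // leq_pmulr // expn_gt0 T0.
pose sws : seq (bool * 'rV[int]_m) := [seq (s, w) | s <- [:: true; false], w <- dirs].
apply: (@bounded_sub _ _ _ (fun b mu x => zero b mu x \/ exists2 sw, sw \in sws & reduced sw b mu x)); last first.
  by apply: bounded_or => //; apply: bounded_seq => sw _; exact: bounded_reduced.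
exists (`|quad_mx Q0 i j|)%N => b mu x cmu mu0 mub xp; case: (xp) => Qx xb [p [pp mup pF]].
have [z|nz] := pselect (x ord0 (ix0 m true) = 0 /\ x ord0 (ix0 m false) = 0).
  left; split; [exact: z.1|exact: z.2| |].
    by move=> l; rewrite mxE.
  by have := on_quadric true Qx; rewrite z.1 mul0r => /esym.
right; have [s x0] : exists s, x ord0 (ix0 m s) != 0.
  have /orP[/eqP t0|t0] := orbN (x ord0 (ix0 m true) == 0); last by exists true.
  have /orP[/eqP f0|f0] := orbN (x ord0 (ix0 m false) == 0); last by exists false.
  by case: nz.
have sw_in w : w \in dirs -> (s, w) \in sws.
  by move=> wd; apply: allpairs_f => //; case: (s); rewrite !inE.
have [[w [wd pw]]|now] := pselect (exists w, w \in dirs /\ ~~ (p%:Z %| (new_coord s w x).1)%Z).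
  exists (s, w); first exact: sw_in.
  split=> //; last by left; exists p.
  by apply: contraNneq pw => /= ->; exact: dvdz0.
have all_p w : w \in dirs -> (p%:Z %| (new_coord s w x).1)%Z.
  by move=> wd; apply: contrapT => H; apply: now; exists w; split=> //; exact/negP.
have [p1 pl pij] := dirs_dvd all_p.
(* S_ij is nonzero and below p, so that p divides x0. Then p divides the gradient at y, and also at
   y + x0 w. *)
have px0 : (p%:Z %| x ord0 (ix0 m s))%Z.
  have := pij i j; rewrite !dvdzE /= abszM Euclid_dvdM// => /orP[//|/dvdn_leq].
  by rewrite absz_gt0 Sij leqNgt (leq_ltn_trans cmu mup) => /(_ isT).
have [w wd Xw] : exists2 w, w \in dirs & (new_coord s w x).1 != 0.
  apply: contrapT => no; have [w wd|_ _ /(_ i j)] := @dirs_dvd 0 s x.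
    by rewrite dvd0z; apply: contrapT => H; apply: no; exists w => //; exact/negP.
  by rewrite dvd0z mulf_eq0 (negbTE x0) (negbTE Sij).
exists (s, w); first exact: sw_in.
split=> //; right; split; last by rewrite -new_coord_quadric// mulf_neq0.
exists p; split=> // l; rewrite /new_coord /=.
have -> : ((ycoord x + x ord0 (ix0 m s) *: w) *m quad_mx Q0) ord0 l
    = (ycoord x *m quad_mx Q0) ord0 l + x ord0 (ix0 m s) * (w *m quad_mx Q0) ord0 l.
  by rewrite mulmxDl -scalemxAl; move: (ycoord x *m _) (w *m _) => u v; rewrite !mxE.
rewrite rpredD// ?dvdz_mulr//.
by have := pl l; rewrite rpredDr // dvdz_mulr.
Qed.

End Combine.

(** * Choice of the parameters *)

Lemma divisor_sup (D K : nat) : exists2 C : nat, (0 < C)%N & forall b : nat, (0 < b)%N ->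
  exists T : nat, [/\ (0 < T)%N, forall q, (0 < q <= b ^ D)%N -> (size (divisors q) <= T)%N & (T ^ K <= C * b ^ D)%N].
Proof.
have [C CP] := divisors_bound K; exists C.+1 => // b b0.
have bD : (0 < b ^ D)%N by rewrite expn_gt0 b0.
pose T := (\max_(q < (b ^ D).+1) size (divisors q))%N.
have TP q : (0 < q <= b ^ D)%N -> (size (divisors q) <= T)%N.
  by move=> /andP[_ qb]; exact: (@leq_bigmax _ (fun q : 'I__ => size (divisors q)) (Ordinal (qb : (q < _.+1)%N))).
exists T; split=> //; first by apply: leq_trans (TP 1 _) => //; rewrite bD.
have [|q qT] := @bigop.eq_bigmax 'I_(b ^ D).+1 (fun q => size (divisors q)); first by rewrite card_ord.
rewrite /T qT; case: (posnP q) => [->|q0].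
  by rewrite /= exp1n muln_gt0 bD.
apply: leq_trans (CP q q0) _; rewrite leq_mul //; exact: ltn_ord q.
Qed.

Lemma floor_root (n b : nat) : (0 < n)%N -> (0 < b)%N ->
  exists mu : nat, [/\ (0 < mu)%N, (mu ^ n <= b)%N & (b < mu.+1 ^ n)%N].
Proof.
move=> n0 b0; have ex : exists i, (i ^ n <= b)%N by exists 1; rewrite exp1n.
have bd i : (i ^ n <= b)%N -> (i <= b)%N.
  by apply: leq_trans; case: i => // i; rewrite -[X in (X <= _)%N]expn1 leq_pexp2l.
case: (ex_maxnP ex bd) => mu mub mumax; exists mu; split=> //.
  by rewrite (leq_trans _ (mumax 1 _)) // exp1n.
by rewrite ltnNge; apply/negP => /mumax; rewrite ltnn.
Qed.

Lemma trivial_count (m : nat) (Q0 : {mpoly int[m]}) : Q0 != 0 ->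
  exists C : nat, forall b T : nat, (0 < b)%N -> (0 < T)%N ->
  (forall q, (0 < q <= mnorm Q0 * b ^ msize Q0)%N -> (size (divisors q) <= T)%N) ->
  atmost (fun x : 'rV[int]_(1 + (1 + m)) => evz (quadric Q0) (x ord0) = 0 /\ forall i, (`|x ord0 i| <= b)%N)
    (C * b ^ m * T)%N%:R.
Proof.
move=> Q00; exists (3 ^ m * (2 + 2 * (m * msize Q0)))%N => b T b0 T0 Td.
set V := fun x : 'rV[int]_(1 + (1 + m)) => _.
pose box (y : 'rV[int]_m) := forall i, (`|y ord0 i| <= b)%N.
pose BB : rat := (2 * b + 1)%N%:R.
have BB0 : 0 <= BB by exact: ler0n.
have ybox x : V x -> box (ycoord x) by move=> [_ xb] l; rewrite mxE.
have quad x : V x -> x ord0 (ix0 m true) * x ord0 (ix0 m false) = qval Q0 (ycoord x).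
  by move=> [Qx _]; exact: (on_quadric true).
have eq_coord (x x' : 'rV[int]_(1 + (1 + m))) : x ord0 (ix0 m true) = x' ord0 (ix0 m true) ->
    x ord0 (ix0 m false) = x' ord0 (ix0 m false) -> ycoord x = ycoord x' -> x = x'.
  by move=> h1 h2 h3; apply/rowP => l; rewrite (pt3_coord true x) (pt3_coord true x') /= h1 h2 h3.
have H1 : atmost (fun x => V x /\ qval Q0 (ycoord x) != 0) (BB ^+ m * (2 * T%:R)).
  apply: (@atmost_rel 'rV[int]_(1 + (1 + m)) 'rV[int]_m _ box (fun x y => ycoord x = y)).
  - by move=> x [Vx _]; exists (ycoord x) => //; exact: ybox.
  - by rewrite /BB -natr_odd; exact: atmost_box.
  - move=> y yb; have [qy|qy] := boolP (qval Q0 y == 0).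
      move=> [|x l] _ sx /=; first by rewrite mulr_ge0 ?ler0n.
      by have [[_ +] xy] := sx x (mem_head _ _); rewrite xy qy.
    apply: (@atmost_inj 'rV[int]_(1 + (1 + m)) int _ (fun a => (a %| qval Q0 y)%Z) (fun x => x ord0 (ix0 m true))).
    + by move=> x [[Vx _] <-]; rewrite -quad// dvdz_mulr.
    + move=> x x' [[Vx qx] xy] [[Vx' _] xy'] xx; apply: eq_coord => //; last by rewrite xy xy'.
      have x0 : x ord0 (ix0 m true) != 0 by apply: contraNneq qx => H; rewrite -quad// H mul0r.
      by apply: (mulfI x0); rewrite quad// {1}xx quad// xy xy'.
    + apply: atmost_divisors => //; apply: Td; rewrite absz_gt0 qy /=; exact: qval_bound.
  - by rewrite mulr_ge0 ?ler0n.
have H2 : atmost (fun x => V x /\ qval Q0 (ycoord x) = 0) ((m * msize Q0)%:R * BB ^+ m / BB * (BB + BB)).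
  apply: (@atmost_rel 'rV[int]_(1 + (1 + m)) 'rV[int]_m _ (fun y => box y /\ evz Q0 (y ord0) = 0) (fun x y => ycoord x = y)).
  - by move=> x [Vx qx]; exists (ycoord x) => //; split=> //; exact: ybox.
  - by rewrite /BB -natr_odd; exact: box_zeros Q00 (leqnn _).
  - move=> y _.
    have Hs s : atmost (fun x : 'rV[int]_(1 + (1 + m)) => [/\ V x, ycoord x = y & x ord0 (ix0 m s) = 0]) BB.
      apply: (@atmost_inj 'rV[int]_(1 + (1 + m)) int _ (fun a => (`|a| <= b)%N) (fun x => x ord0 (ix0 m (~~ s)))).
      + by move=> x [[_ xb] _ _].
      + move=> x x' [_ xy x0] [_ xy' x0'] x1; case: (s) x0 x0' x1 => x0 x0' x1.
          by apply: eq_coord; [rewrite x0 x0'|exact: x1|rewrite xy xy'].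
        by apply: eq_coord; [exact: x1|rewrite x0 x0'|rewrite xy xy'].
      + by rewrite /BB -natr_odd; exact: atmost_int.
    apply: (atmost_sub _ (atmost_or (Hs true) (Hs false))) => // x [[Vx qx] xy].
    have := quad x Vx; rewrite qx => /eqP; rewrite mulf_eq0 => /orP[/eqP x0|/eqP x0]; [by left|by right].
  - by rewrite addr_ge0.
apply: (atmost_sub _ (atmost_or H1 H2)) => [x Vx|].
  by have /orP[/eqP q0|q0] := orbN (qval Q0 (ycoord x) == 0); [right|left].
have BBn : BB != 0 by rewrite /BB addn1 pnatr_eq0.
have -> : BB ^+ m * (2 * T%:R) + (m * msize Q0)%:R * BB ^+ m / BB * (BB + BB)
    = ((2 * b + 1) ^ m * (2 * T + 2 * (m * msize Q0)))%N%:R.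
  have -> : ((2 * b + 1) ^ m * (2 * T + 2 * (m * msize Q0)))%N%:R
      = BB ^+ m * (2 * T%:R + 2 * (m * msize Q0)%:R) :> rat.
    by rewrite (natrM _ ((2 * b + 1) ^ m)) natrX (natrD _ (2 * T)) !(natrM _ 2).
  by move: BBn; move: (BB) ((m * msize Q0)%:R : rat) => X u X0; field.
rewrite ler_nat; apply: (@leq_trans ((3 ^ m * b ^ m) * ((2 + 2 * (m * msize Q0)) * T))).
  apply: leq_mul; first by rewrite -expnMn expn_mono //; lia.
  by rewrite mulnDl leq_add2l leq_pmulr.
by rewrite leq_eqVlt; apply/orP; left; apply/eqP; ring.
Qed.

Lemma count_points_atmost (R : realType) (n r : nat) (P : {mpoly int[n.+1]})
    (F : 'I_r -> {mpoly int[n.+1]}) (B M : R) (A : 'rV[int]_n.+1 -> Prop) (N : rat) :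
  (forall x, counted_points P F B M x -> A x) -> atmost A N -> (count_points P F B M)%:R <= N.
Proof.
move=> cA AN; apply: AN; first exact: fset_uniq.
by move=> x; rewrite (in_fset_set (counted_points_finite P F B M)) => /set_mem/cA.
Qed.

Lemma divisor_power (R : realType) (T C b K c D : nat) (d : R) : (0 < K)%N -> (0 < b)%N ->
  (T ^ K <= C * b ^ D)%N -> c%:R * D%:R <= d * K%:R ->
  T%:R ^+ c <= C%:R `^ (c%:R / K%:R) * b%:R `^ d.
Proof.
move=> K0 b0 TK cD; have KR : 0 < K%:R :> R by rewrite ltr0n.
have cK : 0 <= c%:R / K%:R :> R by rewrite divr_ge0 ?ler0n.
have -> : T%:R ^+ c = (T%:R ^+ K) `^ (c%:R / K%:R) :> R.
  rewrite -!powR_mulrn ?ler0n // -powRrM; congr (_ `^ _).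
  by rewrite mulrCA mulfV ?mulr1 // gt_eqF.
apply: (@le_trans _ _ ((C%:R * b%:R ^+ D) `^ (c%:R / K%:R))).
  apply: ge0_ler_powR => //; rewrite ?nnegrE ?exprn_ge0 ?mulr_ge0 ?ler0n ?exprn_ge0 ?ler0n //.
  by rewrite -!natrX -natrM ler_nat.
rewrite powRM ?ler0n ?exprn_ge0 ?ler0n //; apply: ler_wpM2l; first exact: powR_ge0.
rewrite -powR_mulrn ?ler0n // -powRrM; apply: ler_powR; first by rewrite ler1n.
by rewrite mulrA ler_pdivrMr // mulrC.
Qed.

Lemma ln_le_powR (R : realType) (x d : R) : 0 < x -> 0 < d -> ln x <= d^-1 * x `^ d.
Proof.
move=> x0 d0; rewrite ler_pdivlMl // -ln_powR.
by apply: ltW; apply: ln_sublinear; exact: powR_gt0.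
Qed.

Section Final.
Variables (R : realType) (m : nat) (Q0 : {mpoly int[m]}).
Hypotheses (Q0_homog : Q0 \is 2.-homog) (Q0_rank : (2 < qf_rank Q0)%N).
Variables (r : nat) (F : 'I_r -> {mpoly int[1 + (1 + m)]}).
Hypothesis F_form : forall j, is_form (F j).
Hypothesis Z_codim : @codim_ge algC m.+1 3 (variety (quadric Q0) F).

Let N (B M : R) : nat := @count_points R m.+1 r (quadric Q0) F B M.

Let counted_box (B M : R) x : 0 <= B -> @counted_points R m.+1 r (quadric Q0) F B M x ->
  evz (quadric Q0) (x ord0) = 0 /\ forall i, (`|x ord0 i| <= Num.truncn B)%N.
Proof.
move=> B0 [Qx xB _]; split=> [|i]; first by rewrite -evz_meval.
have /andP[_ Bt] := truncn_itv B0.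
have : (supnorm x < (Num.truncn B).+1)%N by rewrite -(ltr_nat R) (le_lt_trans xB).
rewrite ltnS; apply: leq_trans; exact: (@leq_bigmax _ (fun i => `|x ord0 i|%N) i).
Qed.

Let count_box (B M : R) : 0 <= B -> (N B M <= (2 * Num.truncn B + 1) ^ m.+2)%N.
Proof.
move=> B0; rewrite -(ler_nat rat) natrX -natr_odd.
apply: (count_points_atmost _ (@atmost_box m.+2 (Num.truncn B))) => x.
by move=> /(counted_box B0)[].
Qed.

Let count_trivial (B M : R) (C b T : nat) : 0 <= B -> Num.truncn B = b ->
  atmost (fun x : 'rV[int]_(1 + (1 + m)) => evz (quadric Q0) (x ord0) = 0 /\ forall i, (`|x ord0 i| <= b)%N)
    (C * b ^ m * T)%N%:R -> (N B M <= C * b ^ m * T)%N.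
Proof.
move=> B0 bE H; rewrite -(ler_nat rat); apply: (count_points_atmost _ H) => x.
by rewrite -bE; exact: counted_box.
Qed.

Let count_prime (B M : R) (b mu K : nat) : 0 <= B -> Num.truncn B = b -> (0 < mu)%N -> mu%:R <= M ->
  atmost (common_prime_point Q0 F b mu) (K%:R / mu%:R) -> (N B M * mu <= K)%N.
Proof.
move=> B0 bE mu0 muM H; rewrite -(ler_nat rat) natrM -ler_pdivlMr ?ltr0n //.
apply: (count_points_atmost _ H) => x cx; have [Qx xb] := counted_box B0 cx.
split; [exact: Qx|by rewrite -bE|].
have [_ _ [p [pp Mp pF]]] := cx; exists p; split=> // [|j]; last by rewrite -evz_meval.
by rewrite -(ltr_nat R); exact: le_lt_trans muM Mp.
Qed.

Variable eps : R.
Hypothesis eps_gt0 : 0 < eps.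

Lemma count_points_bound : exists k : R, forall B M : R, 1 <= B -> 1 < M ->
  (N B M)%:R <= k * (B `^ (m.+1%:R - 1 + eps) / (M * ln M)
           + B `^ (m.+1%:R - 1 - m.+1%:R^-1 + eps)).
Proof.
have [C CP] := trivial_count (Q0_neq0 Q0_rank).
have [c cP] := bounded_common_prime_point Q0_homog Q0_rank F_form Z_codim.
(* One half of eps pays for the power of T, the other half for ln M. *)
pose d := eps / 2; have d0 : 0 < d by rewrite divr_gt0.
pose D := (c + msize Q0).+1; pose c' := c.+1.
(* The first summand gives c' D / K <= d. The second gives (T^2)^(2D) <= T^K <= C2 b^D <= b^(2D) for
   b >= C2, hence T^2 <= b. *)
pose K := (Num.bound (c'%:R * D%:R / d) + 4 * D)%N.
have K0 : (0 < K)%N by rewrite /K addn_gt0 muln_gt0 orbT.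
have cDK : c'%:R * D%:R <= d * K%:R.
  rewrite -ler_pdivrMl // mulrC; apply: (@le_trans _ _ (Num.bound (c'%:R * D%:R / d))%:R).
    by apply/ltW/archi_boundP/divr_ge0; [rewrite mulr_ge0 ?ler0n|exact: ltW].
  by rewrite ler_nat leq_addr.
have [C2 C20 supP] := divisor_sup D K.
pose C3 := C2%:R `^ (c'%:R / K%:R) : R.
have C30 : 0 <= C3 by exact: powR_ge0.
pose c0 := c.+1.
(* From b1 on, C2 and [mnorm Q0] are at most b, and the integral root [mu0] is at least c0. *)
pose b1 := (C2 + mnorm Q0 + c0 ^ m.+1)%N.
pose k1 : R := ((2 * b1 + 1) ^ m.+2)%N%:R.
pose k2 : R := C%:R * C3 * c0%:R ^+ 2.
pose k3 : R := 2 * (c%:R * C3).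
pose k4 : R := k3 * (d^-1 * 2 `^ d).
have k10 : 0 <= k1 by exact: ler0n.
have k20 : 0 <= k2 by rewrite mulr_ge0 ?exprn_ge0 ?ler0n // mulr_ge0 ?ler0n.
have k30 : 0 <= k3 by rewrite mulr_ge0 // mulr_ge0 ?ler0n.
have k40 : 0 <= k4 by rewrite mulr_ge0 // mulr_ge0 ?invr_ge0 ?powR_ge0 // (ltW d0).
exists (k1 + k2 + k3 + k4) => B M B1 M1.
have B0 : 0 < B by exact: lt_le_trans B1.
have Bn : B != 0 by rewrite gt_eqF.
have M0 : 0 < M by exact: lt_trans M1.
have lnM0 : 0 < ln M by exact: ln_gt0.
pose P := B ^+ m; pose G := B `^ d.
have P0 : 0 < P by exact: exprn_gt0.
have G1 : 1 <= G by rewrite -(powRr0 B); apply: ler_powR => //; exact: ltW.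
have E1 : B `^ (m.+1%:R - 1 + eps) = P * G * G.
  have -> : m.+1%:R - 1 + eps = m%:R + (d + d) :> R by rewrite -addn1 natrD /d; lra.
  by rewrite !powRD ?Bn ?implybT // powR_mulrn ?(ltW B0) // mulrA.
pose S := B `^ (m.+1%:R^-1).
have S0 : 0 < S by exact: powR_gt0.
have E2 : B `^ (m.+1%:R - 1 - m.+1%:R^-1 + eps) = P * G * G / S.
  have -> : m.+1%:R - 1 - m.+1%:R^-1 + eps = (m.+1%:R - 1 + eps) + - m.+1%:R^-1 :> R by ring.
  by rewrite powRD ?Bn ?implybT // E1 powRN.
pose X1 := P * G * G / (M * ln M); pose X2 := P * G * G / S.
have PGG : 0 < P * G * G by rewrite mulr_gt0 ?mulr_gt0 // (lt_le_trans ltr01).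
have X10 : 0 <= X1 by rewrite divr_ge0 ?ltW // mulr_gt0.
have X20 : 0 <= X2 by rewrite divr_ge0 ?ltW.
rewrite E1 E2 -/X1 -/X2.
(* One constant for each range: b < b1; M bounded; M beyond mu0, where mu = mu0; and M in between,
   where mu is the integral part of M. In each range one of the two terms suffices. *)
suff [k [kk [H|H]]] : exists k, k \in [:: k1; k2; k3; k4] /\ ((N B M)%:R <= k * X1 \/ (N B M)%:R <= k * X2).
- apply: (le_trans H); rewrite mulrDr; apply: ler_wpDr; first by rewrite mulr_ge0 // !addr_ge0.
  by apply: ler_wpM2r => //; move: kk; rewrite !inE => /or4P[] /eqP ->; lra.
- apply: (le_trans H); rewrite mulrDr; apply: ler_wpDl; first by rewrite mulr_ge0 // !addr_ge0.
  by apply: ler_wpM2r => //; move: kk; rewrite !inE => /or4P[] /eqP ->; lra.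
set b := Num.truncn B.
have /andP[bB Bb] : b%:R <= B < b.+1%:R by exact/truncn_itv/ltW.
have b0 : (0 < b)%N by rewrite -ltnS -(ltr_nat R); exact: le_lt_trans B1 Bb.
have [bb1|bb1] := ltnP b b1.
  exists k1; rewrite !inE eqxx; split=> //; right.
  apply: (@le_trans _ _ k1).
    rewrite ler_nat; apply: leq_trans (count_box M (ltW B0)) _; rewrite -/b; apply: expn_mono.
    by rewrite leq_add2r leq_mul2l ltnW.
  rewrite ler_peMr // /X2 ler_pdivlMr // mul1r.
  have SP : S <= P * G.
    have nR : 1 <= m.+1%:R :> R by rewrite ler1n.
    have SB : S <= B.
      by rewrite /S; apply: ler1_powR => //; rewrite invf_le1 // (lt_le_trans ltr01).
    apply: (le_trans SB); apply: (@le_trans _ _ P); last by rewrite ler_peMr // ltW.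
    by rewrite /P ler_eXnr // (leq_ltn_trans _ (rank_gt2 Q0_rank)).
  by apply: le_trans SP _; rewrite ler_peMr // ltW // mulr_gt0 // (lt_le_trans ltr01).
have [T [T0 Td TK]] := supP b b0.
have T2 : (T ^ 2 <= b)%N.
  have D0 : (0 < 2 * D)%N by [].
  rewrite -(leq_exp2r _ _ D0) -expnM mulnA.
  apply: (@leq_trans (T ^ K)); first by rewrite leq_pexp2l // leq_addl.
  apply: leq_trans TK _; apply: (@leq_trans (b * b ^ D)).
    by rewrite leq_mul2r; apply/orP; right; apply: leq_trans bb1; rewrite /b1 -addnA leq_addr.
  by rewrite -expnS leq_pexp2l // mul2n -addnn addSn ltnS leq_addl.
have Tc : T%:R ^+ c' <= C3 * G.
  apply: (le_trans (divisor_power K0 b0 TK cDK)); rewrite ler_wpM2l //.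
  by apply: ge0_ler_powR; rewrite ?nnegrE ?ler0n // ltW.
have bP : b%:R ^+ m <= P by rewrite lerXn2r ?nnegrE ?ler0n // ltW.
have [mu0 [mu00 mu0b bmu0]] := floor_root (ltn0Sn m) b0.
have c0mu0 : (c0 <= mu0)%N.
  rewrite -ltnS -(ltn_exp2r _ _ (ltn0Sn m)); apply: leq_ltn_trans bmu0.
  by apply: leq_trans bb1; rewrite /b1 leq_addl.
pose Mn := Num.truncn M.
have /andP[MnM MMn] : Mn%:R <= M < Mn.+1%:R by exact/truncn_itv/ltW.
have Mn0 : (0 < Mn)%N by rewrite -ltnS -(ltr_nat R); exact: lt_trans M1 MMn.
have [Mnc|Mnc] := ltnP Mn c0.
  exists k2; rewrite !inE eqxx orbT; split=> //; left.
  have H : (N B M <= C * b ^ m * T)%N.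
    apply: count_trivial => //; first exact: ltW.
    apply: CP => // q /andP[q0 qb]; apply: Td; rewrite q0 (leq_trans qb) //.
    apply: (@leq_trans (b * b ^ msize Q0)); last by rewrite -expnS leq_pexp2l // ltnS leq_addl.
    by rewrite leq_mul2r; apply/orP; right; apply: leq_trans bb1; rewrite /b1 addnAC leq_addl.
  have T1 : T%:R <= C3 * G.
    apply: le_trans Tc; rewrite -[X in X <= _]expr1 ler_weXn2l // ler1n //.
  apply: (@le_trans _ _ (C%:R * P * (C3 * G))).
    apply: (@le_trans _ _ (C%:R * b%:R ^+ m * T%:R)); first by rewrite -natrX -!natrM ler_nat.
    by rewrite ler_pM ?mulr_ge0 ?exprn_ge0 ?ler0n // ler_wpM2l ?ler0n.
  have MlnM : M * ln M <= c0%:R ^+ 2.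
    have Mc : M <= c0%:R by apply: (le_trans (ltW MMn)); rewrite ler_nat.
    by rewrite expr2 ler_pM ?(ltW M0) ?(ltW lnM0) // (le_trans (ltW (ln_sublinear M0))).
  have -> : C%:R * P * (C3 * G) = C%:R * C3 * (P * G) by ring.
  apply: (@le_trans _ _ (C%:R * C3 * (c0%:R ^+ 2 * X1))); last by rewrite /k2 !mulrA.
  apply: ler_wpM2l; first by rewrite mulr_ge0 ?ler0n.
  rewrite /X1 mulrA ler_pdivlMr ?mulr_gt0 //.
  have PG0 : 0 <= P * G by rewrite mulr_ge0 ?(ltW P0) ?powR_ge0.
  apply: (@le_trans _ _ (P * G * c0%:R ^+ 2)); first exact: ler_wpM2l.
  have -> : c0%:R ^+ 2 * (P * G * G) = P * G * c0%:R ^+ 2 * G by ring.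
  by rewrite ler_peMr // mulr_ge0 ?exprn_ge0 ?ler0n.
have key mu : (c0 <= mu)%N -> (mu <= mu0)%N -> (mu <= Mn)%N -> (N B M)%:R * mu%:R <= c%:R * C3 * (P * G).
  move=> cmu mumu0 muMn; have mu_gt0 : (0 < mu)%N by exact: leq_trans cmu.
  have H : (N B M * mu <= c * b ^ m * T ^ c)%N.
    apply: (count_prime (b := b) (ltW B0)) => //; first by apply: le_trans MnM; rewrite ler_nat.
    apply: cP => //; first exact: ltnW.
      by apply: leq_trans mu0b; exact: expn_mono.
    move=> q /andP[q0 qb]; apply: Td; rewrite q0 (leq_trans qb) // leq_pexp2l //.
    by rewrite ltnW // ltnS leq_addr.
  apply: (@le_trans _ _ (c%:R * b%:R ^+ m * T%:R ^+ c)); first by rewrite -!natrX -!natrM ler_nat.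
  have -> : c%:R * C3 * (P * G) = c%:R * P * (C3 * G) by ring.
  apply: ler_pM; rewrite ?mulr_ge0 ?exprn_ge0 ?ler0n //; first by rewrite ler_wpM2l ?ler0n.
  by apply: le_trans Tc; rewrite ler_weXn2l // ler1n.
have cC : 0 <= c%:R * C3 * (P * G).
  by rewrite mulr_ge0 ?mulr_ge0 ?ler0n ?(ltW P0) // (le_trans ler01).
have [le|lt] := leqP mu0 Mn.
  exists k3; rewrite !inE eqxx !orbT; split=> //; right.
  have Smu : S <= 2 * mu0%:R.
    apply: (@le_trans _ _ mu0.+1%:R); last by rewrite -natrM ler_nat mul2n -addnn -addn1 leq_add2l.
    have -> : mu0.+1%:R = (mu0.+1%:R ^+ m.+1) `^ (m.+1%:R^-1) :> R.
      by rewrite -powR_mulrn ?ler0n // -powRrM mulfV ?powRr1 ?ler0n // pnatr_eq0.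
    apply: ge0_ler_powR; rewrite ?nnegrE ?invr_ge0 ?exprn_ge0 ?ler0n ?(ltW B0) //.
    by apply: (le_trans (ltW Bb)); rewrite -natrX ler_nat.
  have H := key mu0 c0mu0 (leqnn _) le.
  have muR : 0 < mu0%:R :> R by rewrite ltr0n.
  rewrite /X2 mulrA ler_pdivlMr //.
  apply: (@le_trans _ _ (2 * (c%:R * C3 * (P * G)))).
    apply: (@le_trans _ _ ((N B M)%:R * (2 * mu0%:R))); first by rewrite ler_wpM2l ?ler0n.
    by rewrite mulrCA ler_wpM2l.
  have -> : k3 * (P * G * G) = 2 * (c%:R * C3 * (P * G)) * G by rewrite /k3; ring.
  by rewrite ler_peMr // mulr_ge0.
exists k4; rewrite !inE eqxx !orbT; split=> //; left.
have H := key Mn Mnc (ltnW lt) (leqnn _).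
have MnR : 0 < Mn%:R :> R by rewrite ltr0n.
have M2 : M <= 2 * Mn%:R.
  by apply: (le_trans (ltW MMn)); rewrite -natrM ler_nat mul2n -addnn -addn1 leq_add2l.
(* This makes ln M at most a constant times B^d. *)
have MB : M <= 2 * B.
  apply: (le_trans M2); rewrite ler_wpM2l //; apply: le_trans bB; rewrite ler_nat.
  apply: leq_trans (ltnW lt) (leq_trans _ mu0b); rewrite -[X in (X <= _)%N]expn1 leq_pexp2l //.
have lnG : ln M <= d^-1 * 2 `^ d * G.
  apply: (le_trans (ln_le_powR M0 d0)); rewrite -mulrA ler_wpM2l ?invr_ge0 ?(ltW d0) //.
  rewrite /G -powRM ?(ltW B0) //.
  by apply: ge0_ler_powR; rewrite ?nnegrE ?(ltW d0) ?(ltW M0) // mulr_ge0 ?(ltW B0).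
rewrite /X1 mulrA ler_pdivlMr ?mulr_gt0 //.
apply: (@le_trans _ _ (2 * (c%:R * C3 * (P * G)) * (d^-1 * 2 `^ d * G))).
  rewrite [_ * (M * ln M)]mulrA; apply: ler_pM; rewrite ?mulr_ge0 ?ler0n ?(ltW M0) ?(ltW lnM0) //.
  apply: (@le_trans _ _ ((N B M)%:R * (2 * Mn%:R))); first by rewrite ler_wpM2l ?ler0n.
  by rewrite mulrCA ler_wpM2l.
by rewrite /k4 /k3 le_eqVlt; apply/orP; left; apply/eqP; ring.
Qed.

End Final.

Theorem theorem3p1 (R : realType) (n r : nat)
    (Q0 : {mpoly int[n.-1]}) (F : 'I_r -> {mpoly int[n.+1]})
    (Q0_quadratic : Q0 \is 2.-homog)
    (Q0_rank : (3 <= qf_rank Q0)%N)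
    (F_form : forall j, is_form (F j))
    (Z_codim : codim_ge 3 (variety (hyperbolic_form Q0) F))
    (eps : R) (eps_gt0 : 0 < eps) :
  exists k : R, forall B M : R, 1 <= B -> 1 < M ->
    (count_points (hyperbolic_form Q0) F B M)%:R <=
      k * (B `^ (n%:R - 1 + eps) / (M * ln M)
           + B `^ (n%:R - 1 - n%:R^-1 + eps)).
Proof.
case: n Q0 F Q0_quadratic Q0_rank F_form Z_codim => [|m] Q0 F Q0h Q0r Ff Zc.
  by have := leq_trans Q0r (rank_leq_col _).
exact: (@count_points_bound R m Q0 Q0h Q0r r F Ff Zc eps eps_gt0).
Qed.
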